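(* There is an absolute constant $\kappa>0$, and for every $\delta\in(0,1)$ a constant $C$ depending only on $\delta$, such that the following holds for every integer $n\ge1$, $\sigma>0$, $\overline r>0$, $\lambda\ge0$, $x\in\mathbb{C}(\mathbb{Z})$, and every admissible choice of proximal setup described in the context. Let $y_\tau=x_\tau+\sigma\zeta_\tau$, $-n\le\tau\le n$, with $\zeta_\tau$ i.i.d. standard complex Gaussian. Consider either a least-squares problem (Con-LS) or (Pen-LS), solved by the Fast Gradient Method, with target accuracy $\varepsilon_*=\sigma^2r^2$; or a uniform-fit problem (Con-UF) or (Pen-UF), solved by Composite Mirror Prox, with target accuracy $\varepsilon_*=\sigma r$; here $r=\sqrt{n+1}\,\|F_n[\widehat\varphi]\|_1$ for an optimal solution $\widehat\varphi$ of the problem. Let $T_*$ be the smallest $T_0\ge1$ such that for all $T\ge T_0$ the $T$-th approximate solution $u^T$ has objective value within $\varepsilon_*$ of the optimal value. Then with probability at least $1-\delta$, whenever $r>0$, $$T_*\le C(\log^\kappa(n)+1)\,\frac{\|F_{2n}[y]_{-n}^n\|_\infty}{\sigma}\quad\text{and}\quad T_*\le C(\log^\kappa(n)+1)\,(\mathrm{PSNR}+1),\qquad \mathrm{PSNR}:=\frac{\|F_{2n}[x]_{-n}^n\|_\infty}{\sigma}.$$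
   Context: Signals and DFT. $\mathbb{C}(\mathbb{Z})$ is the space of two-sided complex sequences; $\mathbb{C}_n(\mathbb{Z})$ is the subspace of sequences supported on $[0,n]$. A standard complex Gaussian variable has independent standard real Gaussian real and imaginary parts. For $x\in\mathbb{C}(\mathbb{Z})$, $[x]_m^k=(x_m,\dots,x_k)\in\mathbb{C}^{k-m+1}$. $F_n$ is the unitary DFT on $\mathbb{C}^{n+1}$: $[F_nx]_k=\frac1{\sqrt{n+1}}\sum_{t=0}^n x_t e^{2\pi i kt/(n+1)}$, $0\le k\le n$ (so $F_{2n}$ acts on $\mathbb{C}^{2n+1}$). For a signal $x$, $F_n[x]$ means $F_n[x]_0^n$; $F_n^{\mathrm H}$ is the inverse, and $F_n^{\mathrm H}z$ is also regarded as an element of $\mathbb{C}_n(\mathbb{Z})$ by zero-padding. $[\varphi*y]_t=\sum_\tau\varphi_\tau y_{t-\tau}$. $\|\cdot\|_p$ is the $\ell_p$-norm. Put $\mathrm{Res}_p(\varphi)=\|F_n[y-\varphi*y]\|_p$. Problems. With $\Phi_n(\overline r)=\{\varphi\in\mathbb{C}_n(\mathbb{Z}):\|F_n[\varphi]\|_1\le \overline r/\sqrt{n+1}\}$: (Con-UF) $\min_{\varphi\in\Phi_n(\overline r)}\mathrm{Res}_\infty(\varphi)$; (Con-LS) $\min_{\varphi\in\Phi_n(\overline r)}\frac12\mathrm{Res}_2^2(\varphi)$; (Pen-UF) $\min_{\varphi\in\mathbb{C}_n(\mathbb{Z})}\mathrm{Res}_\infty(\varphi)+\lambda\|F_n[\varphi]\|_1$;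 (Pen-LS) $\min_{\varphi\in\mathbb{C}_n(\mathbb{Z})}\frac12\mathrm{Res}_2^2(\varphi)+\lambda\|F_n[\varphi]\|_1$. Reformulation. Let $N=2n+2$, $\mathrm{Vec}_n:\mathbb{C}^{n+1}\to\mathbb{R}^{N}$, $\mathrm{Vec}_nz=[\Re z_0;\Im z_0;\dots;\Re z_n;\Im z_n]$, and $\|u\|_{\mathbb{C},p}=\|\mathrm{Vec}_n^{-1}u\|_p$. Let $\mathcal{A}\psi=F_n[y*F_n^{\mathrm H}\psi]$ on $\mathbb{C}^{n+1}$, $A=\mathrm{Vec}_n\circ\mathcal{A}\circ\mathrm{Vec}_n^{-1}$, $b=\mathrm{Vec}_nF_n[y]$, and substitute $u=\mathrm{Vec}_nF_n[\varphi]$. In the constrained problems $U=\{u\in\mathbb{R}^N:\|u\|_{\mathbb{C},1}\le \overline r/\sqrt{n+1}\}$ and $\Psi=0$; in the penalized problems $U=\mathbb{R}^N$ and $\Psi(u)=\lambda\|u\|_{\mathbb{C},1}$. For (Con-LS), (Pen-LS): minimize $f(u)+\Psi(u)$ over $U$, $f(u)=\frac12\|Au-b\|_2^2$. For (Con-UF), (Pen-UF): minimize over $U$ the objective $\max_{v\in V}f(u,v)+\Psi(u)$ with $f(u,v)=\langle v,Au-b\rangle$, $V=\{v\in\mathbb{R}^N:\|v\|_{\mathbb{C},1}\le1\}$; $F([u;v])=[A^{\mathrm T}v;\,-(Au-b)]$. In each case $u^*=\mathrm{Vec}_nF_n[\widehat\varphi]$. Proximal setups. The $\ell_2$-setup is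 the norm $\|\cdot\|_{\mathbb{C},2}$ with $\omega(u)=\frac12\|u\|_2^2$. The complex $\ell_1$-setup is the norm $\|\cdot\|_{\mathbb{C},1}$ with $\omega(u)=\frac{(n+1)^{(\tilde q-1)(2-\tilde q)/\tilde q}}{2\tilde c}\|u\|_{\mathbb{C},\tilde q}^2$, where $(\tilde q,\tilde c)=(2,\frac1{n+1})$ if $n\le1$ and $(\tilde q,\tilde c)=(1+\frac1{\log(n+1)},\frac1{e\log(n+1)})$ if $n\ge2$. Admissible choices: either setup in $u$ and either setup in $v$. Let $q_u,q_v\in\{1,2\}$ be the index of the setup chosen in $u$, resp. $v$, and $p_v=q_v/(q_v-1)$ ($=\infty$ if $q_v=1$). For a set $S$ containing $0$, the $\omega$-radius is $\Omega[S]=(2\sup_{S}(\omega-\omega(0)))^{1/2}$. $\Omega_*[U]=\min(\Omega[U],\Omega[U_*])$, where $U_*$ is the segment $[0,u^*]$. With $\|\mathcal{A}\|_{\alpha\to\beta}=\sup_{\|\psi\|_\alpha=1}\|\mathcal{A}\psi\|_\beta$, put $L_f=\|\mathcal{A}\|_{q_u\to2}^2$ and $L_F=\|\mathcal{A}\|_{q_u\to p_v}$. Bregman divergence $D_u(\xi)=\omega(\xi)-\omega(u)-\langle\nabla\omega(u),\xi-u\rangle$; $\mathrm{Prox}_{\Psi,u}(g)=\arg\min_{\xi}\{\langle g,\xi\rangle+D_u(\xi)+\Psi(\xi)\}$, with $\xi$ ranging over the domain ($U$, or $W=U\times V$, in which case $\Psi$ acts on the $u$-component). The joint setup on $W$ uses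 $\omega(w)=\Omega^2[V]\,\omega_U(u)+\Omega_*^2[U]\,\omega_V(v)$. Fast Gradient Method, $\eta=1/L_f$: $u^0=0$, $g^0=0$; for $t=0,1,\dots$ with $a_t=\frac{t+2}2$, $A_{t-1}=\sum_{s=0}^{t-1}a_s$, $\tau_t=\frac{2(t+2)}{(t+1)(t+4)}$: $u_t=\mathrm{Prox}_{\eta A_{t-1}\Psi,0}(\eta g^t)$; $u_{t+1/3}=\tau_tu_t+(1-\tau_t)u^t$; $g_t=a_t\nabla f(u_{t+1/3})$; $u_{t+2/3}=\mathrm{Prox}_{\eta a_t\Psi,u_t}(\eta g_t)$; $u^{t+1}=\tau_tu_{t+2/3}+(1-\tau_t)u^t$; $g^{t+1}=\sum_{s=0}^tg_s$. Composite Mirror Prox with the joint setup, $\eta=\Omega_*[U]\Omega[V]/L_F$: $w_0=0$; for $t=0,1,\dots$: $w_{t+1/2}=\mathrm{Prox}_{\eta\Psi,w_t}(\eta F(w_t))$; $w_{t+1}=\mathrm{Prox}_{\eta\Psi,w_t}(\eta F(w_{t+1/2}))$; $w^{t+1}=[u^{t+1};v^{t+1}]=\frac1{t+1}\sum_{s=0}^tw_{s+1/2}$. *)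

(* Defs.v *)
From HB Require Import structures.
From mathcomp Require Import all_boot all_order all_algebra finmap.
From mathcomp Require Import complex.
From mathcomp Require Import all_classical all_reals all_analysis.

Set Implicit Arguments.
Unset Strict Implicit.
Unset Printing Implicit Defensive.

Import Order.TTheory GRing.Theory Num.Theory.
Import numFieldNormedType.Exports.

Local Open Scope classical_set_scope.
Local Open Scope ring_scope.
Local Open Scope complex_scope.

(** * Probability *)

Section Probability.
Context {R : realType} {d : measure_display} {T : measurableType d}.
Variable P : probability T R.

(* Mutual independence of the family (X_i), i in D: product rule over every
   finite subfamily. *)
Definition mutually_independent {d'} {S : measurableType d'} {I : choiceType}
    (D : set I) (X : I -> T -> S) : Prop :=
  forall (J : {fset I}) (B : I -> set S),
    [set` J] `<=` D ->
    (forall i, i \in J -> measurable (B i)) ->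
    P (\bigcap_(i in [set` J]) (X i @^-1` B i)) =
    (\prod_(i <- J) P (X i @^-1` B i))%E.

Definition standard_gaussian (X : T -> R) : Prop :=
  measurable_fun setT X /\
  forall B : set R, measurable B -> P (X @^-1` B) = normal_prob 0 1 B.

Definition standard_complex_gaussian (Z : T -> R[i]) : Prop :=
  [/\ standard_gaussian (fun om => complex.Re (Z om)),
      standard_gaussian (fun om => complex.Im (Z om)) &
      forall B B' : set R, measurable B -> measurable B' ->
        P ([set om | B (complex.Re (Z om))] `&` [set om | B' (complex.Im (Z om))]) =
        (P [set om | B (complex.Re (Z om))] *
         P [set om | B' (complex.Im (Z om))])%E].

(* Independence of complex variables is expressed through the measurable space
   R * R, since R[i] carries no sigma-algebra in the library. *)
Definition iid_complex_gaussian (D : set int) (zeta : int -> T -> R[i]) : Prop :=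
  (forall tau, D tau -> standard_complex_gaussian (zeta tau)) /\
  mutually_independent D
    (fun tau om => (complex.Re (zeta tau om), complex.Im (zeta tau om))).

End Probability.

(** * Signals, the unitary DFT and convex-analytic notions *)

Section Signals.
Context {R : realType}.

Definition signal := int -> R[i].

Definition supported_in (n : nat) : set signal :=
  [set phi | forall t : int, ~~ (0 <= t <= n%:Z) -> phi t = 0].

(* The l samples of x starting at time m; [x]_m^k is [segment m (k - m + 1) x]. *)
Definition segment (m : int) (l : nat) (x : signal) : 'cV[R[i]]_l :=
  \col_(j < l) x (m + (j : nat)%:Z).

Definition zero_pad (n : nat) (z : 'cV[R[i]]_n.+1) : signal := fun t =>
  if t is Posz k then (if insub k is Some i then z i 0 else 0) else 0.

(* The sum ranges over all of Z; it is meaningful as soon as one of the two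
   signals has finite support, which is always the case below. *)
Definition convolve (phi x : signal) : signal :=
  fun t => \sum_(tau \in [set: int]) phi tau * x (t - tau).

Definition dft (n : nat) : 'M[R[i]]_n.+1 :=
  \matrix_(k, t) let theta := 2 * pi * (k : nat)%:R * (t : nat)%:R / n.+1%:R in
    ((Num.sqrt n.+1%:R)^-1)%:C * (cos theta +i* sin theta).

Definition dftH (n : nat) : 'M[R[i]]_n.+1 := map_mx conjc (dft n)^T.

(* F_n[x] for a signal x *)
Definition dft_signal (n : nat) (x : signal) : 'cV[R[i]]_n.+1 :=
  dft n *m segment 0 n.+1 x.

(* l_p norm on C^m for 1 <= p <= +oo *)
Definition cnorm (m : nat) (p : \bar R) (z : 'cV[R[i]]_m) : R :=
  match p with
  | r%:E => (\sum_k Normc.normc (z k 0) `^ r) `^ r^-1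
  | +oo%E => \big[Num.max/0]_k Normc.normc (z k 0)
  | -oo%E => 0
  end.

Definition vec (n : nat) (z : 'cV[R[i]]_n.+1) : 'cV[R]_(n.+1.*2) :=
  \col_(j < n.+1.*2)
    let c := z (inord j./2) 0 in if odd j then complex.Im c else complex.Re c.

Definition unvec (n : nat) (u : 'cV[R]_(n.+1.*2)) : 'cV[R[i]]_n.+1 :=
  \col_(k < n.+1) (u (inord k.*2) 0 +i* u (inord k.*2.+1) 0).

Definition rcnorm (n : nat) (p : \bar R) (u : 'cV[R]_(n.+1.*2)) : R :=
  cnorm p (unvec u).

Definition dot (m : nat) (u v : 'cV[R]_m) : R := \sum_i u i 0 * v i 0.

Definition grad (m : nat) (f : 'cV[R]_m -> R) (u : 'cV[R]_m) : 'cV[R]_m :=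
  \col_i 'D_(delta_mx i 0) (f : 'cV[R]_m -> R^o) u.

Definition bregman (m : nat) (omega : 'cV[R]_m -> R) (u xi : 'cV[R]_m) : R :=
  omega xi - omega u - dot (grad omega u) (xi - u).

Definition argmin (T : choiceType) (D : set T) (h : T -> R) : set T :=
  [set x | D x /\ forall x', D x' -> h x <= h x'].

(* Prox_{Psi,u}(g) over the domain D; a point of the argmin is selected (it is
   unique for a strongly convex omega). *)
Definition prox (m : nat) (omega : 'cV[R]_m -> R) (D : set 'cV[R]_m)
    (Psi : 'cV[R]_m -> R) (u g : 'cV[R]_m) : 'cV[R]_m :=
  xget 0 (argmin D (fun xi => dot g xi + bregman omega u xi + Psi xi)).

Definition omega_radius (m : nat) (omega : 'cV[R]_m -> R) (S : set 'cV[R]_m)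
    : \bar R :=
  ((2%:E * ereal_sup [set (omega u - omega 0)%:E | u in S]) `^ 2^-1)%E.

(** ** Proximal setups *)

Variant prox_setup := L2_setup | complex_L1_setup.

Definition setup_index (s : prox_setup) : R :=
  if s is L2_setup then 2 else 1.

Definition conj_exponent (q : R) : \bar R :=
  if q == 1 then +oo%E else (q / (q - 1))%:E.

Definition qtilde (n : nat) : R :=
  if (n <= 1)%N then 2 else 1 + (ln n.+1%:R)^-1.

Definition ctilde (n : nat) : R :=
  if (n <= 1)%N then n.+1%:R^-1 else (expR 1 * ln n.+1%:R)^-1.

Definition setup_omega (s : prox_setup) (n : nat) (u : 'cV[R]_(n.+1.*2)) : R :=
  match s with
  | L2_setup => 2^-1 * dot u u
  | complex_L1_setup =>
      n.+1%:R `^ ((qtilde n - 1) * (2 - qtilde n) / qtilde n) /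
        (2 * ctilde n) * rcnorm (qtilde n)%:E u ^+ 2
  end.

End Signals.

Arguments signal : clear implicits.

(** * The recovery problems and the two first-order algorithms *)

Variant problem := ConUF | ConLS | PenUF | PenLS.

Definition is_LS (pb : problem) : bool :=
  match pb with ConLS | PenLS => true | ConUF | PenUF => false end.

Definition is_penalized (pb : problem) : bool :=
  match pb with PenUF | PenLS => true | ConUF | ConLS => false end.

Section Recovery.
Context {R : realType}.
Variables (n : nat) (y : signal R) (rbar lambda : R) (pb : problem).

Definition Res (p : \bar R) (phi : signal R) : R :=
  cnorm p (dft_signal n (fun t => y t - convolve phi y t)).

Definition filter_feasible : set (signal R) :=
  if is_penalized pb then supported_in n
  else [set phi | supported_in n phi /\
                  cnorm 1%:E (dft_signal n phi) <= rbar / Num.sqrt n.+1%:R].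

Definition filter_objective (phi : signal R) : R :=
  (if is_LS pb then 2^-1 * Res 2%:E phi ^+ 2 else Res +oo%E phi) +
  (if is_penalized pb then lambda * cnorm 1%:E (dft_signal n phi) else 0).

Definition optimal_filter (phi : signal R) : Prop :=
  argmin filter_feasible filter_objective phi.

Definition ell1_size (phi : signal R) : R :=
  Num.sqrt n.+1%:R * cnorm 1%:E (dft_signal n phi).

Definition calA (psi : 'cV[R[i]]_n.+1) : 'cV[R[i]]_n.+1 :=
  dft_signal n (convolve y (zero_pad (dftH n *m psi))).

(* Matrix of the real-linear map Vec o calA o Vec^-1, see [AmxE]. *)
Definition Amx : 'M[R]_(n.+1.*2) :=
  \matrix_(i, j) vec (calA (unvec (delta_mx j 0))) i 0.

Definition bvec : 'cV[R]_(n.+1.*2) := vec (dft_signal n y).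

Definition calA_norm (alpha beta : \bar R) : R :=
  sup [set cnorm beta (calA psi) | psi in [set psi | cnorm alpha psi = 1]].

Definition domU : set 'cV[R]_(n.+1.*2) :=
  if is_penalized pb then setT
  else [set u | rcnorm 1%:E u <= rbar / Num.sqrt n.+1%:R].

Definition domV : set 'cV[R]_(n.+1.*2) := [set v | rcnorm 1%:E v <= 1].

Definition Psi (u : 'cV[R]_(n.+1.*2)) : R :=
  if is_penalized pb then lambda * rcnorm 1%:E u else 0.

Definition fLS (u : 'cV[R]_(n.+1.*2)) : R :=
  2^-1 * dot (Amx *m u - bvec) (Amx *m u - bvec).

Definition fUF (u v : 'cV[R]_(n.+1.*2)) : R := dot v (Amx *m u - bvec).

Definition objective (u : 'cV[R]_(n.+1.*2)) : R :=
  (if is_LS pb then fLS u else sup [set fUF u v | v in domV]) + Psi u.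

Definition optimal_value : R := inf [set objective u | u in domU].

(** ** Fast Gradient Method *)

Section FGM.
Variable su : prox_setup.

Definition L_f : R := calA_norm (setup_index su)%:E 2%:E ^+ 2.

Definition fgm_a (t : nat) : R := t.+2%:R / 2.
Definition fgm_tau (t : nat) : R := (2 * t.+2%:R) / (t.+1%:R * t.+4%:R).

(* The state is the pair (u^t, g^t). *)
Definition fgm_step (t : nat) (st : 'cV[R]_(n.+1.*2) * 'cV[R]_(n.+1.*2)) :=
  let: (U, G) := st in
  let eta := L_f^-1 in
  let A_prev := \sum_(s < t) fgm_a s in
  let Prox c := prox (setup_omega su (n := n)) domU (fun xi => c * Psi xi) in
  let u0 := Prox (eta * A_prev) 0 (eta *: G) in
  let u13 := fgm_tau t *: u0 + (1 - fgm_tau t) *: U in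
  let g := fgm_a t *: grad fLS u13 in
  let u23 := Prox (eta * fgm_a t) u0 (eta *: g) in
  (fgm_tau t *: u23 + (1 - fgm_tau t) *: U, G + g).

Definition fgm_state (T : nat) : 'cV[R]_(n.+1.*2) * 'cV[R]_(n.+1.*2) :=
  iteri T fgm_step (0, 0).

Definition fgm (T : nat) : 'cV[R]_(n.+1.*2) := (fgm_state T).1.

End FGM.

(** ** Composite Mirror Prox *)

Section CMP.
Variables (su sv : prox_setup) (ustar : 'cV[R]_(n.+1.*2)).

Definition L_F : R :=
  calA_norm (setup_index su)%:E (conj_exponent (setup_index sv)).

Definition radiusV : R := fine (omega_radius (setup_omega sv (n := n)) domV).

Definition segment0 : set 'cV[R]_(n.+1.*2) :=
  [set s *: ustar | s in [set s : R | 0 <= s <= 1]].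

(* Omega[U] is +oo in the penalized problems, so the minimum is taken in the
   extended reals; it is always finite. *)
Definition radiusU_star : R :=
  fine (Order.min (omega_radius (setup_omega su (n := n)) domU)
                  (omega_radius (setup_omega su (n := n)) segment0)).

(* Points of W = U x V are stacked vectors [u; v]. *)
Definition domW : set 'cV[R]_(n.+1.*2 + n.+1.*2) :=
  [set w | domU (usubmx w) /\ domV (dsubmx w)].

Definition joint_omega (w : 'cV[R]_(n.+1.*2 + n.+1.*2)) : R :=
  radiusV ^+ 2 * setup_omega su (usubmx w) +
  radiusU_star ^+ 2 * setup_omega sv (dsubmx w).

Definition Fop (w : 'cV[R]_(n.+1.*2 + n.+1.*2))
    : 'cV[R]_(n.+1.*2 + n.+1.*2) :=
  col_mx (Amx^T *m dsubmx w) (- (Amx *m usubmx w - bvec)).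

Definition cmp_eta : R := radiusU_star * radiusV / L_F.

Definition cmp_prox := prox joint_omega domW (fun w => cmp_eta * Psi (usubmx w)).

Definition cmp_half (w : 'cV[R]_(n.+1.*2 + n.+1.*2)) :=
  cmp_prox w (cmp_eta *: Fop w).

Definition cmp_step (w : 'cV[R]_(n.+1.*2 + n.+1.*2)) :=
  cmp_prox w (cmp_eta *: Fop (cmp_half w)).

Definition cmp_w (t : nat) : 'cV[R]_(n.+1.*2 + n.+1.*2) := iter t cmp_step 0.

Definition cmp_average (T : nat) : 'cV[R]_(n.+1.*2 + n.+1.*2) :=
  T%:R^-1 *: \sum_(s < T) cmp_half (cmp_w s).

Definition cmp (T : nat) : 'cV[R]_(n.+1.*2) := usubmx (cmp_average T).

End CMP.

(* The T-th approximate solution u^T. *)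
Definition approx_solution (su sv : prox_setup) (phihat : signal R) (T : nat)
    : 'cV[R]_(n.+1.*2) :=
  if is_LS pb then fgm su T else cmp su sv (vec (dft_signal n phihat)) T.

Definition target_accuracy (sigma r : R) : R :=
  if is_LS pb then sigma ^+ 2 * r ^+ 2 else sigma * r.

(* [T0] is an admissible threshold: T0 >= 1 and the accuracy [eps] holds from
   T0 on; T_* is the least such threshold. *)
Definition accurate_from (eps : R) (u : nat -> 'cV[R]_(n.+1.*2)) (T0 : nat)
    : Prop :=
  (1 <= T0)%N /\
  forall T, (T0 <= T)%N -> objective (u T) - optimal_value <= eps.

Definition is_Tstar (eps : R) (u : nat -> 'cV[R]_(n.+1.*2)) (Ts : nat) : Prop :=
  accurate_from eps u Ts /\ forall T0, accurate_from eps u T0 -> (Ts <= T0)%N.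

End Recovery.

(* || F_{2n}[x]_{-n}^n ||_oo *)
Definition spectral_sup {R : realType} (n : nat) (x : signal R) : R :=
  cnorm +oo%E (dft n.*2 *m segment (- n%:Z) n.*2.+1 x).

(** * Sanity checks of the encodings *)

Lemma vecK (R : realType) n (z : 'cV[R[i]]_n.+1) : unvec (vec z) = z.
Proof.
apply/matrixP => k j; rewrite !mxE ord1.
have hk : (k.*2.+1 < n.+1.*2)%N by rewrite -doubleS leq_double ltn_ord.
rewrite !inordK //; last by apply: leq_trans hk; rewrite ltnS ltnW.
rewrite /= odd_double /= uphalf_double doubleK inord_val.
by case: (z k 0).
Qed.

Lemma unvecK (R : realType) n (u : 'cV[R]_(n.+1.*2)) : vec (unvec u) = u.
Proof.
apply/matrixP => k j; rewrite !mxE ord1.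
have hk : (k < n.+1.*2)%N by exact: ltn_ord.
have h2 : (k./2 < n.+1)%N by rewrite ltn_half_double.
rewrite (inordK h2).
have := odd_double_half k.
case ok: (odd k) => /=; rewrite ?add0n ?add1n => E; congr (u _ _); apply: val_inj; rewrite /= inordK E //.
Qed.

Lemma convolve_zero_pad (R : realType) n (y : signal R) (z : 'cV[R[i]]_n.+1) t :
  convolve y (zero_pad z) t = \sum_(i < n.+1) y (t - (i : nat)%:Z) * z i 0.
Proof.
rewrite /convolve (@fsbigE _ _ _ _ _ [seq t - (val i)%:Z | i <- enum 'I_n.+1]).
- rewrite big_map big_enum_cond /=; apply: eq_big => [i|i _]; first by rewrite /= in_setT.
  rewrite /zero_pad subKr /=.
  case: insubP => [j _ /val_inj -> //|]; by rewrite ltn_ord.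
- rewrite map_inj_uniq ?enum_uniq // => a b /eqP.
  by rewrite (inj_eq (addrI _)) (inj_eq oppr_inj) => /eqP [] /val_inj.
- by [].
- move=> i _; apply: contraNeq => h; apply/mapP.
  move: h; rewrite /zero_pad; case E : (t - i) => [k|k]; last by rewrite mulr0 eqxx.
  case: insubP => [j kn jk _|_]; last by rewrite mulr0 eqxx.
  exists j; first by rewrite mem_enum.
  by rewrite jk -E subKr.
Qed.

Lemma calA_mulmx (R : realType) n (y : signal R) :
  exists M : 'M[R[i]]_n.+1, forall psi, calA y psi = M *m psi.
Proof.
pose Y := \matrix_(t < n.+1, i < n.+1) y (0 + (t : nat)%:Z - (i : nat)%:Z).
exists (dft n *m Y *m dftH n) => psi.
rewrite /calA /dft_signal -!mulmxA; congr (_ *m _).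
apply/matrixP => t j; rewrite !mxE ord1 convolve_zero_pad; apply: eq_bigr => i _.
by rewrite !mxE; congr (_ * _); rewrite mxE.
Qed.

Lemma vec_linear (R : realType) n (a : R) (z w : 'cV[R[i]]_n.+1) :
  vec (a%:C *: z + w) = a *: vec z + vec w.
Proof.
apply/matrixP => k j; rewrite !mxE.
by case: (z _ _) (w _ _) => [? ?] [? ?] /=; case: odd; rewrite /= ?mul0r ?subr0 ?addr0.
Qed.

Lemma unvec_linear (R : realType) n (a : R) (z w : 'cV[R]_(n.+1.*2)) :
  unvec (a *: z + w) = a%:C *: unvec z + unvec w.
Proof.
apply/matrixP => k j; rewrite !mxE.
by apply/eqP; rewrite eq_complex /= !mul0r subr0 addr0 !eqxx.
Qed.

Lemma AmxE (R : realType) n (y : signal R) u :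
  Amx n y *m u = vec (calA y (unvec u)).
Proof.
have [M ME] := calA_mulmx n y.
pose f (u : 'cV[R]_(n.+1.*2)) := vec (calA y (unvec u)).
have fl a v w : f (a *: v + w) = a *: f v + f w.
  by rewrite /f unvec_linear !ME mulmxDr -scalemxAr vec_linear.
have f0 : f 0 = 0.
  have := fl (-1) 0 0; rewrite scaler0 addr0 scaleN1r addNr //.
have fs (r : seq 'I_(n.+1.*2)) (c : 'I_(n.+1.*2) -> R) v : f (\sum_(i <- r) c i *: v i) = \sum_(i <- r) c i *: f (v i).
  elim: r => [|a r IH]; first by rewrite !big_nil.
  by rewrite !big_cons fl IH.
rewrite -/(f u) [in RHS](_ : u = \sum_j u j 0 *: delta_mx j 0); last first.
  rewrite {1}[u]matrix_sum_delta; apply: eq_bigr => i _; by rewrite big_ord1.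
rewrite fs; apply/matrixP => i j; rewrite !mxE summxE ord1; apply: eq_bigr => k _.
by rewrite !mxE mulrC; congr (_ * _); rewrite /f mxE.
Qed.

(* Main.v *)
Require Import Defs.
From mathcomp Require Import all_boot all_order all_algebra finmap.
From mathcomp Require Import complex ring lra.
From mathcomp Require Import all_classical all_reals all_analysis measurable_realfun.

Set Implicit Arguments.
Unset Strict Implicit.
Unset Printing Implicit Defensive.

Import Order.TTheory GRing.Theory Num.Theory.
Import numFieldNormedType.Exports.

Local Open Scope classical_set_scope.
Local Open Scope ring_scope.
Local Open Scope complex_scope.

(** The proof combines a deterministic bound with two probabilistic ones.

    Deterministic part. On [0, n] the convolution of [y] with a filter supported on [0, n] is a circular convolution of
    length 2n+1, so every operator norm of [A] occurring in the step sizes is at most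
    sqrt(2n+1) ||F_2n[y]||_oo. Both proximal setups have squared radius O(ln n + 1) in units of the complex l1-norm.
    Inserting this into the rates 4 L_f omega(u_opt) / T^2 of the Fast Gradient Method and L_F Omega_*[U] Omega[V] / T
    of Mirror Prox, and comparing with the accuracy, which is expressed by r = sqrt(n+1) ||u_opt||_1, gives
      T_* <= 18 (ln n + 1) ||F_2n[y]||_oo / sigma + 2.

    Probabilistic part. The probability that |Re y_t| is at most (delta/8) sigma is at most delta/4, so by Markov's
    inequality at most half of the samples are that small, up to probability delta/2; by Parseval ||F_2n[y]||_oo / sigma
    is then at least delta/16 and absorbs the additive constant 2. The real and imaginary parts of the Fourier
    coefficients of the noise are sums of two Gaussian sums with explicit exponential moments, so Chernoff's
    bound gives ||F_2n[zeta]||_oo = O(ln n + 1) up to probability delta/2, hence the bound by PSNR with kappa = 2. *)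

(** * Proximal steps *)

(** The setup built on an l_q-norm with q slightly above 1 is the delicate one: for q < 2 its square
    is not twice differentiable where a complex coordinate vanishes. Strong convexity is therefore
    proved on lines for a regularised power sum, and gradients are treated through directional
    derivatives that are linear in the direction. The factor in [setup_omega] is what converts the
    modulus q - 1 into modulus 1 for the complex l1-norm.

    The bound on T_* is free of the size of the solution because both rates carry the same power of
    its l1-norm as the accuracy does. For Mirror Prox this rests on the segment from 0 to the
    solution lying in U, so that Omega_*[U] is the radius of the segment. If the operator norm is 0,
    the step size 1/L is 0 by the convention for division; the iterates then stay at 0, which is
    already optimal.

    Independence is given as a product rule for events, so exponential moments of Gaussian sums go
    through expectations of products of functions. In the PSNR bound, kappa = 2 counts one logarithm
    from the radii and one from the noise. *)

Section Dot.
Context {R : realType} (m : nat).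
Implicit Types u v w : 'cV[R]_m.

Lemma dotC u v : dot u v = dot v u.
Proof. by apply: eq_bigr => i _; rewrite mulrC. Qed.

Lemma dotDl u v w : dot (u + v) w = dot u w + dot v w.
Proof. by rewrite -big_split; apply: eq_bigr => i _; rewrite mxE mulrDl. Qed.

Lemma dotZl (a : R) u v : dot (a *: u) v = a * dot u v.
Proof. by rewrite /dot mulr_sumr; apply: eq_bigr => i _; rewrite mxE mulrA. Qed.

Lemma dotNl u v : dot (- u) v = - dot u v.
Proof. by rewrite -scaleN1r dotZl mulN1r. Qed.

Lemma dotBl u v w : dot (u - v) w = dot u w - dot v w.
Proof. by rewrite dotDl dotNl. Qed.

Lemma dotDr u v w : dot u (v + w) = dot u v + dot u w.
Proof. by rewrite !(dotC u) dotDl. Qed.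

Lemma dotZr (a : R) u v : dot u (a *: v) = a * dot u v.
Proof. by rewrite !(dotC u) dotZl. Qed.

Lemma dotNr u v : dot u (- v) = - dot u v.
Proof. by rewrite !(dotC u) dotNl. Qed.

Lemma dotBr u v w : dot u (v - w) = dot u v - dot u w.
Proof. by rewrite dotDr dotNr. Qed.

Lemma dot0l u : dot 0 u = 0.
Proof. by rewrite -(scale0r 0) dotZl mul0r. Qed.

Lemma dot0r u : dot u 0 = 0.
Proof. by rewrite dotC dot0l. Qed.

Lemma dot_suml (I : Type) (r : seq I) (F : I -> 'cV[R]_m) v :
  dot (\sum_(i <- r) F i) v = \sum_(i <- r) dot (F i) v.
Proof.
elim: r => [|i r IH]; first by rewrite !big_nil dot0l.
by rewrite !big_cons dotDl IH.
Qed.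

Lemma dot_ge0 u : 0 <= dot u u.
Proof. by apply: sumr_ge0 => i _; rewrite -expr2 sqr_ge0. Qed.

Lemma dot_trmx k (B : 'M[R]_(k, m)) (x : 'cV[R]_k) u :
  dot x (B *m u) = dot (B^T *m x) u.
Proof.
rewrite /dot; under eq_bigr => i _ do rewrite mxE mulr_sumr.
rewrite exchange_big /=; apply: eq_bigr => j _.
rewrite mxE mulr_suml; apply: eq_bigr => i _; rewrite mxE; ring.
Qed.

Lemma coord_le_norm u i : `|u i 0| <= `|u|.
Proof.
by rewrite [leRHS]/Num.norm /= mx_normrE; exact: (le_bigmax _ (fun ij => `|u ij.1 ij.2|) (i, 0)).
Qed.

Lemma dot_bound u v : `|dot u v| <= (\sum_i `|u i 0|) * `|v|.
Proof.
rewrite mulr_suml; apply: le_trans (ler_norm_sum _ _ _) _.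
by apply: ler_sum => i _; rewrite normrM ler_wpM2l// coord_le_norm.
Qed.

End Dot.

Section Convexity.
Context {R : realType} {V : lmodType R}.

Definition is_convex_set (D : set V) := forall x y (t : R),
  D x -> D y -> 0 <= t <= 1 -> D (x + t *: (y - x)).

Definition is_convex_fun (f : V -> R) := forall x y (t : R),
  0 <= t <= 1 -> f (x + t *: (y - x)) <= f x + t * (f y - f x).

End Convexity.

(** Serves to compare a function with its derivative on short segments, both for the optimality of
    proximal points and for strong convexity. *)
Lemma is_derive_dirP {R : realType} m (f : 'cV[R]_m -> R) (u h : 'cV[R]_m) (l e : R) :
  is_derive u h (f : 'cV[R]_m -> R^o) l -> 0 < e ->
  exists2 d : R, 0 < d & forall t, 0 < t <= d ->
    `|f (u + t *: h) - f u - t * l| <= t * e.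
Proof.
move=> [dv dE] e0.
move: dv; rewrite /derivable => /cvg_ex[l' lP].
have ll : l' = l by rewrite -dE; apply/esym/cvg_lim.
move/cvgrPdist_le : lP => /(_ e e0).
rewrite /dnbhs /within /= => /nbhs_ballP[d /= d0 dP].
exists (d / 2); first by rewrite divr_gt0.
move=> t /andP[t0 td].
have := dP t; rewrite /ball /= sub0r normrN gtr0_norm//.
have -> : t < d by apply: le_lt_trans td _; lra.
move=> /(_ isT) /(_ (lt0r_neq0 t0)) /=.
rewrite ll (addrC (t *: h)) /GRing.scale /= distrC => e1.
rewrite -[f _ - f _](mulVKf (lt0r_neq0 t0)) -mulrBr normrM gtr0_norm//.
by rewrite ler_pM2l.
Qed.

Section Prox.
Context {R : realType} (m : nat).
Implicit Types (u v g : 'cV[R]_m) (D : set 'cV[R]_m) (Psi omega : 'cV[R]_m -> R).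

(** Heine-Borel for row vectors is carried over by transposition, which is continuous because balls
    are entrywise. *)
Lemma cV_bounded_closed_compact D (M : R) :
  (forall x, D x -> `|x| <= M) -> closed D -> compact D.
Proof.
move=> bD cD.
have ct : continuous (@trmx R 1 m).
  move=> x A /nbhs_ballP[e /= e0 xA]; apply/nbhs_ballP; exists e => // y [_ xy].
  by apply: xA; split => // i j; rewrite !mxE.
have ct' : continuous (@trmx R m 1).
  move=> x A /nbhs_ballP[e /= e0 xA]; apply/nbhs_ballP; exists e => // y [_ xy].
  by apply: xA; split => // i j; rewrite !mxE.
have -> : D = (@trmx R 1 m) @` ((@trmx R 1 m) @^-1` D).
  apply/seteqP; split => [x Dx|x [y Dy <-]] //.
  by exists x^T; rewrite /= ?trmxK.
apply: continuous_compact; first by apply: continuous_subspaceT => x; exact: ct.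
apply: bounded_closed_compact.
  exists M; split; first exact: num_real.
  move=> N MN x /= /bD xM; apply: le_trans (ltW MN); apply: le_trans xM.
  rewrite [leLHS]/Num.norm /= mx_normrE; apply/bigmax_leP; split => // -[i j] _ /=.
  by rewrite (_ : x i j = x^T j 0) ?coord_le_norm// mxE ord1.
by move=> x; apply: (@preimage_closed _ _ (@trmx R 1 m)).
Qed.

Lemma argmin_exists D (h : 'cV[R]_m -> R) (x0 : 'cV[R]_m) (M : R) :
  D x0 -> closed D -> continuous h ->
  (forall x, D x -> h x <= h x0 -> `|x| <= M) -> argmin D h !=set0.
Proof.
move=> Dx0 cD ch bh; pose S := D `&` [set x | h x <= h x0].
have cS : closed S.
  apply: closedI => //; apply: (@preimage_closed _ _ h [set y | y <= h x0]) => //.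
have := @compact_EVT_min _ _ h S _ _ _.
case.
- by exists x0; split => /=.
- by apply: (@cV_bounded_closed_compact _ M) => // x [Dx hx]; exact: bh.
- exact: continuous_subspaceT.
move=> c; rewrite inE => -[Dc hc] cmin; exists c; split => // x Dx.
have [xx0|xx0] := leP (h x) (h x0); first by apply: cmin; rewrite inE.
exact: le_trans hc (ltW xx0).
Qed.

(** Conditions on a distance-generating function under which proximal points exist and satisfy the
    three-point inequality. Differentiability is directional, strong convexity is expressed by the
    Bregman divergence, and coercivity ties [nrm] to the sup-norm, in which compactness is
    available. *)
Record dgf omega (nrm : 'cV[R]_m -> R) : Prop := Dgf {
  dgf_derive : forall u h, is_derive u h (omega : 'cV[R]_m -> R^o) (dot (grad omega u) h);
  dgf_strong : forall u v, 2^-1 * nrm (v - u) ^+ 2 <= bregman omega u v;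
  dgf_cont : continuous omega;
  dgf_coercive : exists2 c : R, 0 < c & forall u, c * `|u| ^+ 2 <= nrm u ^+ 2
}.

Variables (omega nrm : 'cV[R]_m -> R) (hw : dgf omega nrm).

Lemma dgf_dirP u h (e : R) : 0 < e ->
  exists2 d : R, 0 < d & forall t, 0 < t <= d ->
    omega (u + t *: h) - omega u <= t * (dot (grad omega u) h + e).
Proof.
move=> e0; have [d d0 dP] := is_derive_dirP (dgf_derive hw u h) e0.
exists d => // t td; have := dP t td.
by rewrite ler_norml => /andP[_]; rewrite mulrDr; lra.
Qed.

Lemma bregman_id u : bregman omega u u = 0.
Proof. by rewrite /bregman !subrr dot0r subr0. Qed.

Lemma bregman_ge0 u v : 0 <= bregman omega u v.
Proof. by apply: le_trans (dgf_strong hw u v); rewrite mulr_ge0// ?invr_ge0// sqr_ge0. Qed.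

Lemma dot_continuous g : continuous (dot g).
Proof.
apply: (@continuous_big R _ +%R 0 xpredT _ 'cV[R]_m _ (fun i (v : 'cV[R]_m) => g i 0 * v i 0)); first exact: add_continuous.
move=> i _ x; apply: (@continuousM R _ (cst (g i 0)) (fun v : 'cV[R]_m => v i 0)); first exact: cst_continuous.
exact: coord_continuous.
Qed.

(** The divergence grows quadratically and g only linearly, so sublevel sets are bounded. *)
Lemma prox_exists D Psi u g : closed D -> D !=set0 ->
  continuous Psi -> (forall x, D x -> 0 <= Psi x) ->
  argmin D (fun xi => dot g xi + bregman omega u xi + Psi xi) !=set0.
Proof.
move=> cD [x0 Dx0] cPsi Psi0.
set h := (fun xi => _).
have [c c0 cP] := dgf_coercive hw.
pose K := \sum_i `|g i 0|.
have K0 : 0 <= K by apply: sumr_ge0.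
pose B := `|h x0 - dot g u|.
have csub : continuous (fun xi : 'cV[R]_m => xi - u).
  by move=> y; apply: continuousB; [move=> A /= hA|exact: cst_continuous].
(* The radius comes from c s^2 / 2 <= B + K s, which forces s <= 1 or s <= 2 (B + K) / c. *)
apply: (@argmin_exists D h x0 (`|u| + 1 + 2 * (B + K) / c)) => //.
  move=> x; apply: (@continuousD R R^o _ (fun xi => dot g xi + bregman omega u xi)); last exact: cPsi.
  apply: (@continuousD R R^o); first exact: dot_continuous.
  apply: (@continuousD R R^o); last first.
    apply: (@continuousN R R^o).
    apply: (@continuous_comp _ _ _ (fun xi : 'cV[R]_m => xi - u) (dot (grad omega u) : 'cV[R]_m -> R)); last exact: dot_continuous.
    exact: csub.
  apply: (@continuousD R R^o); [exact: (dgf_cont hw)|exact: cst_continuous].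
move=> x Dx hx.
pose s := `|x - u|.
have h1 : c / 2 * s ^+ 2 <= B + K * s.
  have := dgf_strong hw u x; have := cP (x - u); have := Psi0 _ Dx.
  have : dot g (x - u) >= - (K * s).
    by have := dot_bound g (x - u); rewrite ler_norml => /andP[].
  rewrite dotBr => e1 e2 e3 e4.
  have e5 := ler_norm (h x0 - dot g u).
  rewrite -/B in e5; move: hx; rewrite {1}/h -/s in e3 * => hx.
  lra.
have s0 : 0 <= s by exact: normr_ge0.
have xs : `|x| <= `|u| + s by rewrite -[x in leLHS](subrK u) addrC ler_normD.
apply: le_trans xs _; rewrite -addrA lerD2l.
have [s1|s1] := leP s 1.
  by rewrite ler_wpDr// divr_ge0 ?(ltW c0)// mulr_ge0// addr_ge0// normr_ge0.
apply: ler_wpDl => //.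
rewrite ler_pdivlMr// -(ler_pM2r (ltr01 : 0 < 1 :> R)) mulr1.
have B0 : 0 <= B by exact: normr_ge0.
have : c / 2 * s * s <= (B + K) * s.
  apply: le_trans (_ : B + K * s <= _); first by rewrite -mulrA -expr2.
  by rewrite mulrDl lerD2r ler_peMr// ltW.
rewrite ler_pM2r; last by apply: lt_trans s1.
lra.
Qed.

Lemma prox_argmin D Psi u g : closed D -> D !=set0 ->
  continuous Psi -> (forall x, D x -> 0 <= Psi x) ->
  argmin D (fun xi => dot g xi + bregman omega u xi + Psi xi) (prox omega D Psi u g).
Proof. by move=> ? ? ? ?; apply: xgetPex; exact: prox_exists. Qed.

(** First-order optimality: z is compared with z + t (v - z), convexity bounds the increment of
    [Psi], and division by a small t leaves a variational inequality up to e. Expanding the three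
    divergences shows that this inequality is the claim. *)
Lemma prox_three_point D Psi u g : closed D -> is_convex_set D ->
  continuous Psi -> is_convex_fun Psi -> (forall x, D x -> 0 <= Psi x) ->
  forall v, D v ->
  let z := prox omega D Psi u g in D z /\
  dot g (z - v) + Psi z - Psi v <=
  bregman omega u v - bregman omega z v - bregman omega u z.
Proof.
move=> cD cvD cPsi cvPsi Psi0 v Dv z.
have [Dz zmin] : argmin D (fun xi => dot g xi + bregman omega u xi + Psi xi) z.
  by apply: prox_argmin => //; exists v.
split => //.
suff : 0 <= dot g (v - z) + dot (grad omega z) (v - z) - dot (grad omega u) (v - z)
          + Psi v - Psi z.
  by rewrite /bregman !dotBr; lra.
apply/ler_addgt0Pl => e e0.
have [d d0 dP] := dgf_dirP z (v - z) e0.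
pose t := Num.min d 1.
have t0 : 0 < t by rewrite lt_min d0 ltr01.
have t1 : t <= 1 by rewrite ge_min lexx orbT.
have td : 0 < t <= d by rewrite t0 ge_min lexx.
have t01 : 0 <= t <= 1 by rewrite ltW.
have := zmin _ (cvD z v t Dz Dv t01).
have := cvPsi z v t t01.
have := dP t td.
rewrite /bregman !dotBr !dotDr !dotZr !dotBr => e1 e2 e3.
rewrite -(pmulr_rge0 _ t0); lra.
Qed.

End Prox.

(** * Strong convexity of the proximal setups *)

Section PowR.
Context {R : realType}.
Implicit Types (x y p r a : R).

(** Young's inequality for y^p and 1 with the conjugate exponents 1/p and 1/(1 - p). *)
Lemma powR_tangent y p : 0 <= y -> 0 < p <= 1 -> y `^ p <= 1 + p * (y - 1).
Proof.
move=> y0 /andP[p0]; rewrite le_eqVlt => /predU1P[->|p1].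
  by rewrite powRr1// mul1r addrC subrK.
have q0 : 0 < 1 - p by rewrite subr_gt0.
have := @conjugate_powR R (y `^ p) 1 p^-1 (1 - p)^-1 (powR_ge0 _ _) ler01.
rewrite !invr_gt0 !invrK (addrC p) subrK powR1 mulr1 mul1r -powRrM mulfV ?gt_eqF// powRr1//.
by move=> /(_ p0 q0 erefl); lra.
Qed.

(** Each x i is estimated by the tangent of the concave power at the mean X; if X = 0, every term
    vanishes. *)
Lemma jensen_powR (I : finType) (w x : I -> R) p : 0 < p <= 1 ->
  (forall i, 0 <= w i) -> \sum_i w i = 1 -> (forall i, 0 <= x i) ->
  \sum_i w i * x i `^ p <= (\sum_i w i * x i) `^ p.
Proof.
move=> p01 w0 w1 x0; set X := \sum_i w i * x i.
have X0 : 0 <= X by apply: sumr_ge0 => i _; rewrite mulr_ge0.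
have [p0 p1] := andP p01.
have [XE|XN] := eqVneq X 0.
  rewrite XE powR0 ?gt_eqF// big1// => i _.
  move/eqP: XE; rewrite /X psumr_eq0 => [/allP/(_ i)|j _]; last by rewrite mulr_ge0.
  rewrite mem_index_enum => /(_ isT); rewrite implyTb mulf_eq0 => /orP[]/eqP ->; first by rewrite mul0r.
  by rewrite powR0 ?mulr0// gt_eqF.
have XP : 0 < X by rewrite lt_neqAle eq_sym XN.
have h i : w i * x i `^ p <= w i * (X `^ p * (1 + p * (x i / X - 1))).
  rewrite ler_wpM2l// -[x i in leLHS](divfK XN) mulrC powRM//; last by rewrite divr_ge0.
  by rewrite ler_wpM2l ?powR_ge0// powR_tangent// divr_ge0.
apply: le_trans (ler_sum _ (fun i _ => h i)) _.
rewrite (eq_bigr (fun i => X `^ p * ((1 - p) * w i + p / X * (w i * x i)))); last first.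
  by move=> i _; field.
rewrite -mulr_sumr big_split /= -!mulr_sumr w1 -/X divfK// mulr1 subrK mulr1//.
Qed.

Lemma powRB1 x r : 0 < x -> x `^ (r - 1) = x `^ r / x.
Proof.
move=> x0; rewrite powRB; last by rewrite (gt_eqF x0) implybT.
by rewrite powRr1// ltW.
Qed.

(** Away from 0 differentiability suffices; at a = 0 the modulus e^(1/r) is explicit. *)
Lemma powR_continuous_ge0 (r a : R) : 0 < r -> 0 <= a -> forall e, 0 < e ->
  exists2 d : R, 0 < d & forall x, 0 <= x -> `|a - x| < d -> `|a `^ r - x `^ r| < e.
Proof.
move=> r0; rewrite le_eqVlt => /predU1P[<-|a0] e e0.
  exists (e `^ r^-1); first exact: powR_gt0.
  move=> x x0; rewrite !sub0r powR0 ?gt_eqF// !sub0r !normrN ger0_norm// ger0_norm ?powR_ge0//.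
  move=> /(gt0_ltr_powR r0); rewrite !nnegrE => /(_ x0 (powR_ge0 _ _)).
  by rewrite -powRrM mulVf ?gt_eqF// powRr1// ltW.
have [dv _] := is_derive1_powR r a0.
have : continuous_at a (@powR R ^~ r).
  by apply: differentiable_continuous; apply/derivable1_diffP.
move/cvgrPdist_lt => /(_ e e0)/nbhs_ballP[d /= d0 dP].
by exists d => // x _ xd; apply: dP.
Qed.

Lemma cvg_powR {T : Type} (F : set_system T) {FF : Filter F} (f : T -> R) a r :
  0 < r -> 0 <= a -> (forall z, 0 <= f z) -> f z @[z --> F] --> a ->
  (f z) `^ r @[z --> F] --> a `^ r.
Proof.
move=> r0 a0 f0 fa; apply/cvgrPdist_lt => e e0.
have [d d0 dP] := powR_continuous_ge0 r0 a0 e0.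
by move/cvgrPdist_lt : fa => /(_ d d0); apply: filterS => z; exact: dP.
Qed.

End PowR.

Lemma sum_pairs (R : nmodType) n (F : 'I_(n.+1.*2) -> R) :
  \sum_j F j = \sum_(k < n.+1) (F (inord k.*2) + F (inord k.*2.+1)).
Proof.
have H (G : nat -> R) m : \sum_(0 <= j < m.*2) G j = \sum_(0 <= k < m) (G k.*2 + G k.*2.+1).
  elim: m => [|m IH]; first by rewrite !big_nil.
  by rewrite doubleS !big_nat_recr //= IH addrA.
rewrite (eq_bigr (fun j : 'I_(n.+1.*2) => F (inord j))) => [|j _]; last by rewrite inord_val.
by rewrite -(big_mkord xpredT (fun j => F (inord j))) H big_mkord.
Qed.

(** * Complex moduli and norms in real coordinates *)

Section BlockNorm.
Context {R : realType} (n : nat).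
Implicit Types (u v h : 'cV[R]_(n.+1.*2)) (k : 'I_n.+1).

Definition re_block u k := u (inord k.*2) 0.
Definition im_block u k := u (inord k.*2.+1) 0.
Definition sqblock u k : R := re_block u k ^+ 2 + im_block u k ^+ 2.
Definition dotblock u h k : R := re_block u k * re_block h k + im_block u k * im_block h k.

Lemma sqblock_ge0 u k : 0 <= sqblock u k.
Proof. by rewrite addr_ge0 ?sqr_ge0. Qed.

Lemma normc_unvec u k : Normc.normc (unvec u k 0) = Num.sqrt (sqblock u k).
Proof. by rewrite mxE. Qed.

Lemma sqblock_line u h k t :
  sqblock (u + t *: h) k = sqblock u k + 2 * dotblock u h k * t + sqblock h k * t ^+ 2.
Proof. rewrite /sqblock /dotblock /re_block /im_block !mxE; ring. Qed.

Lemma sqblock_cauchy u h k : dotblock u h k ^+ 2 <= sqblock u k * sqblock h k.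
Proof.
rewrite -subr_ge0 (_ : _ - _ = (re_block u k * im_block h k - im_block u k * re_block h k) ^+ 2).
  exact: sqr_ge0.
rewrite /sqblock /dotblock; ring.
Qed.

Lemma dot_dotblock u h : dot u h = \sum_k dotblock u h k.
Proof. by rewrite /dot sum_pairs. Qed.

Lemma dotblockDr u h h' k : dotblock u (h + h') k = dotblock u h k + dotblock u h' k.
Proof. by rewrite /dotblock /re_block /im_block !mxE; ring. Qed.

Lemma dotblockZr u a h k : dotblock u (a *: h) k = a * dotblock u h k.
Proof. by rewrite /dotblock /re_block /im_block !mxE; ring. Qed.

(* [blockQ (q / 2) u] is the square of [rcnorm q u], written with the quadratic functions [sqblock]: unlike the moduli,
   they are smooth at 0. *)
Definition blockQ (p : R) u : R := (\sum_k sqblock u k `^ p) `^ p^-1.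

Lemma rcnorm_blockQ (q : R) u : 0 < q -> rcnorm q%:E u ^+ 2 = blockQ (q / 2) u.
Proof.
move=> q0; rewrite /rcnorm /cnorm /blockQ -powR_mulrn ?powR_ge0// -powRrM.
rewrite (_ : (q / 2)^-1 = q^-1 * 2%:R); last by field; rewrite gt_eqF.
congr (_ `^ _); apply: eq_bigr => k _; rewrite normc_unvec -powR12_sqrt ?sqblock_ge0//.
by rewrite -powRrM mulrC.
Qed.

Lemma rcnorm_ge0 (p : \bar R) u : 0 <= rcnorm p u.
Proof.
case: p => [r| |] //=; first exact: powR_ge0.
rewrite /rcnorm /=; elim/big_ind: _ => // [x y x0 y0|k _]; [by rewrite le_max x0|by rewrite normc_unvec sqrtr_ge0].
Qed.

Lemma rcnorm1E u : rcnorm 1%:E u = \sum_k Num.sqrt (sqblock u k).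
Proof.
rewrite /rcnorm /cnorm invr1 powRr1; last by apply: sumr_ge0 => k _; exact: powR_ge0.
by apply: eq_bigr => k _; rewrite normc_unvec powRr1// sqrtr_ge0.
Qed.

Lemma rcnorm2_sqr u : rcnorm 2%:E u ^+ 2 = dot u u.
Proof.
rewrite rcnorm_blockQ// mulfV// /blockQ invr1 powRr1; last first.
  by apply: sumr_ge0 => k _; exact: powR_ge0.
rewrite dot_dotblock; apply: eq_bigr => k _; rewrite powRr1 ?sqblock_ge0//.
Qed.

End BlockNorm.

(** * Strong convexity of power sums of positive quadratics *)

Section PowerSum.
Context {R : realType}.

Lemma chord_shift (a b c k t : R) :
  a - k * t ^+ 2 <= (1 - t) * (b - k * 0) + t * (c - k * 1) ->
  a + k * t * (1 - t) <= (1 - t) * b + t * c.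
Proof. by move=> h; lra. Qed.

Lemma second_derivative_chord (f f1 f2 : R -> R) :
  (forall x : R, is_derive x 1 f (f1 x)) ->
  (forall x : R, is_derive x 1 f1 (f2 x)) ->
  (forall x, 0 <= f2 x) ->
  forall t, 0 <= t <= 1 -> f t <= (1 - t) * f 0 + t * f 1.
Proof.
move=> d1 d2 f2_ge0 t /andP[t0 t1].
have D1 : 'D_1 f = f1 by apply/funext => x; have [_] := d1 x.
have D2 : 'D_1 f1 = f2 by apply/funext => x; have [_] := d2 x.
have cf : continuous f.
  by move=> x; apply: differentiable_continuous; apply/derivable1_diffP; have [] := d1 x.
have s0 : 0 <= 1 - t by rewrite subr_ge0.
have s1 : 1 - t <= 1 by rewrite gerBl.
have := @second_derivative_convex R f 0 1 _ _ _ _ _ (Itv01 s0 s1) ler01.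
rewrite !convRE /= /unstable.onem mulr0 add0r mulr1 opprB addrC subrK.
apply.
- move=> x _; rewrite [leRHS](_ : _ = f2 x)//.
  by transitivity ('D_1 f1 x); [rewrite -D1|have [] := d2 x].
- by apply: cvg_at_left_filter; exact: cf.
- by apply: cvg_at_right_filter; exact: cf.
- by move=> x _; have [] := d1 x.
- by move=> x _; have [] := d2 x; rewrite -D1.
Qed.

(** In the application s i t is the squared modulus of a complex coordinate of u + t h plus a
    positive constant, 2 p = q, and [disc] is Cauchy-Schwarz. *)
Variables (m : nat) (al be ga : 'I_m.+1 -> R) (p : R).
Let s i t := al i + be i * t + ga i * t ^+ 2.
Let s' i t := be i + 2 * ga i * t.
Hypothesis p01 : 0 < p <= 1.
Hypothesis p12 : 1 <= 2 * p.
Hypothesis ga0 : forall i, 0 <= ga i.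
Hypothesis s0 : forall i t, 0 < s i t.
Hypothesis disc : forall i t, s' i t ^+ 2 <= 4 * ga i * s i t.

Let S t := \sum_i s i t `^ p.
Let S1 t := \sum_i p * s i t `^ (p - 1) * s' i t.
Let S2 t := \sum_i (p * ((p - 1) * s i t `^ (p - 1 - 1) * s' i t) * s' i t + p * s i t `^ (p - 1) * (2 * ga i)).

Let S_gt0 t : 0 < S t.
Proof.
rewrite /S big_ord_recl; apply: ltr_pwDl; first by rewrite powR_gt0.
by apply: sumr_ge0 => i _; exact: powR_ge0.
Qed.

Let ds i t : is_derive (t : R) 1 (s i) (s' i t).
Proof.
rewrite /s.
apply: is_derive_eq; rewrite /s' /GRing.scale /=; ring.
Qed.

Let ds' i t : is_derive (t : R) 1 (s' i) (2 * ga i).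
Proof. rewrite /s'; apply: is_derive_eq; rewrite /GRing.scale /=; ring. Qed.

Let dspow r i t : is_derive (t : R) 1 ((fun x => s i x `^ r) ) (r * s i t `^ (r - 1) * s' i t).
Proof.
have := @is_derive1_comp R (fun x => x `^ r) (s i) t _ _ (is_derive1_powR r (s0 i t)) (ds i t).
by [].
Qed.

Let dS t : is_derive (t : R) 1 S (S1 t).
Proof.
rewrite (_ : S = \sum_i (fun x => s i x `^ p)); last first.
  by apply/funext => x; rewrite /S fct_sumE.
by apply: is_derive_sum => i; exact: dspow.
Qed.

Let dS1 t : is_derive (t : R) 1 S1 (S2 t).
Proof.
rewrite (_ : S1 = \sum_i (fun x => p * s i x `^ (p - 1) * s' i x)); last first.
  by apply/funext => x; rewrite /S1 fct_sumE.
apply: is_derive_sum => i.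
have h := dspow (p - 1) i t; have h' := ds' i t.
apply: is_derive_eq; rewrite /GRing.scale /=; ring.
Qed.

Let G t := S t `^ p^-1.
Let G1 t := p^-1 * S t `^ (p^-1 - 1) * S1 t.
Let G2 t := p^-1 * ((p^-1 - 1) * S t `^ (p^-1 - 1 - 1) * S1 t) * S1 t + p^-1 * S t `^ (p^-1 - 1) * S2 t.

Let dSpow r t : is_derive (t : R) 1 ((fun x => S x `^ r) ) (r * S t `^ (r - 1) * S1 t).
Proof.
exact: (@is_derive1_comp R (fun x => x `^ r) S t _ _ (is_derive1_powR r (S_gt0 t)) (dS t)).
Qed.

Let dG t : is_derive (t : R) 1 G (G1 t).
Proof. exact: dSpow. Qed.

Let dG1 t : is_derive (t : R) 1 G1 (G2 t).
Proof.
rewrite /G1.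
have h := dSpow (p^-1 - 1) t; have h' := dS1 t.
apply: is_derive_eq; rewrite /G2 /GRing.scale /=; ring.
Qed.

(** For ga i = |h_i|^2 this is the squared l_(2p)-norm of the direction h. *)
Definition power_sum_modulus := (\sum_i ga i `^ p) `^ p^-1.
Let H := power_sum_modulus.

(** Jensen for the power p with weights s_i^p / S at the points ga_i / s_i, then raised to the power
    1/p. *)
Let H_le t : H <= S t `^ (p^-1 - 1) * \sum_i s i t `^ (p - 1) * ga i.
Proof.
have [p0 p1] := andP p01.
have j := @jensen_powR R 'I_m.+1 (fun i => s i t `^ p / S t) (fun i => ga i / s i t) p p01.
have w0 i : 0 <= s i t `^ p / S t by rewrite divr_ge0 ?powR_ge0 ?ltW.
have w1 : \sum_i s i t `^ p / S t = 1 by rewrite -mulr_suml -/(S t) divff// gt_eqF.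
have x0 i : 0 <= ga i / s i t by rewrite divr_ge0// ltW.
have {w0 w1 x0} := j w0 w1 x0.
rewrite (eq_bigr (fun i => ga i `^ p / S t)); last first.
  move=> i _; rewrite powRM// ?invr_ge0 ?(ltW (s0 i t))// -(powR_inv1 (ltW (s0 i t))) -powRrM mulN1r powRN.
  by field; rewrite !gt_eqF// powR_gt0.
rewrite [X in _ <= X `^ p](eq_bigr (fun i => s i t `^ (p - 1) * ga i / S t)); last first.
  move=> i _; rewrite powRB1//.
  by field; rewrite !gt_eqF.
rewrite -!mulr_suml; set X := \sum_i s i t `^ (p - 1) * ga i.
have X0 : 0 <= X by apply: sumr_ge0 => i _; rewrite mulr_ge0 ?powR_ge0.
rewrite ler_pdivrMr// => h.
have {}h := ge0_ler_powR (ltW (eqbRL (invr_gt0 _) p0)) _ _ h.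
rewrite /H /power_sum_modulus; apply: le_trans (h _ _) _.
- by rewrite nnegrE; apply: sumr_ge0 => i _; exact: powR_ge0.
- by rewrite nnegrE mulr_ge0 ?powR_ge0// ltW.
rewrite (@powRM _ ((X / S t) `^ p)) ?powR_ge0//; last exact: ltW.
rewrite -powRrM mulfV ?gt_eqF// powRr1; last by rewrite divr_ge0// ltW.
rewrite powRB1//.
by rewrite le_eqVlt; apply/orP; left; apply/eqP; field; rewrite gt_eqF.
Qed.

(** The term of G'' containing S'^2 is nonnegative since 1/p >= 1. In S'' the factor p (p - 1) is
    nonpositive, so [disc] bounds the concave term below by 4 p (p - 1) ga s^(p-1); together with 2
    p ga s^(p-1) this is 2 p (2 p - 1) ga s^(p-1), and [H_le] concludes. *)
Let G2_ge t : 2 * (2 * p - 1) * H <= G2 t.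
Proof.
have [p0 p1] := andP p01.
have pV1 : 0 <= p^-1 - 1 by rewrite subr_ge0 invf_ge1.
apply: le_trans (_ : p^-1 * S t `^ (p^-1 - 1) * S2 t <= _); last first.
  rewrite lerDr (_ : _ * S1 t = p^-1 * (p^-1 - 1) * S t `^ (p^-1 - 1 - 1) * S1 t ^+ 2); last by ring.
  by rewrite mulr_ge0 ?sqr_ge0// mulr_ge0 ?powR_ge0// mulr_ge0// invr_ge0 ltW.
have hS2 : 2 * p * (2 * p - 1) * (\sum_i s i t `^ (p - 1) * ga i) <= S2 t.
  rewrite mulr_sumr; apply: ler_sum => i _.
  have : p * (p - 1) * s i t `^ (p - 1 - 1) * (4 * ga i * s i t) <=
         p * (p - 1) * s i t `^ (p - 1 - 1) * s' i t ^+ 2.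
    rewrite ler_wnM2l// pmulr_lle0 ?powR_gt0// pmulr_rle0// subr_le0//.
  have -> : p * (p - 1) * s i t `^ (p - 1 - 1) * (4 * ga i * s i t) =
    4 * p * (p - 1) * ga i * s i t `^ (p - 1).
    have -> : s i t `^ (p - 1) = s i t `^ (p - 1 - 1) * s i t.
      by rewrite (powRB1 (p - 1))// divfK// gt_eqF.
    ring.
  set a := s i t `^ (p - 1); set b := s i t `^ (p - 1 - 1).
  by move=> h; lra.
have c0 : 0 <= p^-1 * S t `^ (p^-1 - 1) by rewrite mulr_ge0 ?powR_ge0// invr_ge0 ltW.
apply: le_trans (ler_wpM2l c0 hS2).
rewrite [leRHS](_ : _ = 2 * (2 * p - 1) * (S t `^ (p^-1 - 1) * \sum_i s i t `^ (p - 1) * ga i)).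
  by apply: ler_wpM2l; [rewrite mulr_ge0// subr_ge0|exact: H_le].
by field; rewrite gt_eqF.
Qed.

(** The function G - (2 p - 1) H t^2 has nonnegative second derivative, so it lies below its chord
    on [0, 1]. *)
Lemma power_sum_strongly_convex t : 0 <= t <= 1 ->
  G t + (2 * p - 1) * H * t * (1 - t) <= (1 - t) * G 0 + t * G 1.
Proof.
move=> t01; pose M := (2 * p - 1) * H.
have := @second_derivative_chord (fun x => G x - M * x ^+ 2) (fun x => G1 x - M * (2 * x)) (fun x => G2 x - M * 2) _ _ _ t t01.
rewrite -/M expr0n expr1n /= => h.
suff : G t - M * t ^+ 2 <= (1 - t) * (G 0 - M * 0) + t * (G 1 - M * 1).
  exact: chord_shift.
apply: h => x.
- by have h := dG x; apply: is_derive_eq; rewrite /GRing.scale /=; ring.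
- by have h := dG1 x; apply: is_derive_eq; rewrite /GRing.scale /=; ring.
- by rewrite subr_ge0 mulrC mulrA G2_ge.
Qed.

End PowerSum.

Section BlockConvex.
Context {R : realType} (n : nat).
Implicit Types u v h : 'cV[R]_(n.+1.*2).

Lemma blockQ_ge0 p u : 0 <= blockQ p u.
Proof. exact: powR_ge0. Qed.

Lemma blockQZ p a u : 0 < p -> blockQ p (a *: u) = a ^+ 2 * blockQ p u.
Proof.
move=> p0; rewrite /blockQ (eq_bigr (fun k => (a ^+ 2) `^ p * sqblock u k `^ p)); last first.
  move=> k _; rewrite -powRM ?sqr_ge0 ?sqblock_ge0//; congr (_ `^ _).
  by rewrite /sqblock /re_block /im_block !mxE; ring.
rewrite -mulr_sumr powRM ?powR_ge0//; last by apply: sumr_ge0 => k _; exact: powR_ge0.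
by rewrite -powRrM mulfV ?gt_eqF// powRr1// sqr_ge0.
Qed.

(* Along a line each [sqblock] is a nonnegative quadratic polynomial, and adding [e > 0] makes it positive,
   so that [power_sum_strongly_convex] applies; then [e] tends to 0. *)
Let Qe p (e : R) u := (\sum_k (sqblock u k + e) `^ p) `^ p^-1.

Let Qe_cvg p u : 0 < p -> Qe p e u @[e --> 0^'+] --> blockQ p u.
Proof.
move=> p0; rewrite /Qe /blockQ.
pose f (e : R) := (\sum_k (sqblock u k + `|e|) `^ p) `^ p^-1.
have : f e @[e --> (0:R)^'+] --> (\sum_k sqblock u k `^ p) `^ p^-1.
  apply: cvg_powR.
  - by rewrite invr_gt0.
  - by apply: sumr_ge0 => k _; exact: powR_ge0.
  - by move=> e; apply: sumr_ge0 => k _; exact: powR_ge0.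
  apply: (@cvg_big _ _ +%R 0 xpredT); first exact: add_continuous.
  move=> k _; apply: cvg_powR => //.
  - exact: sqblock_ge0.
  - by move=> e; rewrite addr_ge0 ?sqblock_ge0.
  rewrite -[X in _ --> X]addr0; apply: cvgD; first exact: cvg_cst.
  apply: cvg_at_right_filter; rewrite -[X in _ --> X](@normr0 _ R).
  exact: norm_continuous.
apply: cvg_trans; apply: near_eq_cvg; near=> e.
rewrite /f; congr (_ `^ _); apply: eq_bigr => k _; rewrite ger0_norm//.
Unshelve. all: by end_near. Qed.

Let disc_bound (a b c e : R) : a <= c * b -> 0 <= b -> 0 <= e -> 2 ^+ 2 * a <= 4 * b * (c + e).
Proof. by move=> h b0 e0; have := mulr_ge0 b0 e0; lra. Qed.

(** With q = 2 p this is the 2-uniform convexity of the complex l_q-norm, with modulus q - 1. *)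
Lemma blockQ_strongly_convex p u v t : 0 < p <= 1 -> 1 <= 2 * p -> 0 <= t <= 1 ->
  blockQ p (u + t *: (v - u)) + (2 * p - 1) * blockQ p (v - u) * t * (1 - t) <=
  (1 - t) * blockQ p u + t * blockQ p v.
Proof.
move=> p01 p12 t01; have [p0 p1] := andP p01; have [t0 t1] := andP t01.
set h := v - u.
have cv : (1 - t) * Qe p e u + t * Qe p e v @[e --> 0^'+] -->
    (1 - t) * blockQ p u + t * blockQ p v.
  by apply: cvgD; apply: cvgM; [exact: cvg_cst|exact: Qe_cvg|exact: cvg_cst|exact: Qe_cvg].
rewrite -(cvg_lim _ cv)//; apply: limr_ge; first by apply/cvg_ex; eexists; exact: cv.
near=> e; have e0 : 0 < e by near: e; exact: nbhs_right_gt.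
have line x k : (sqblock u k + e) + 2 * dotblock u h k * x + sqblock h k * x ^+ 2 =
    sqblock (u + x *: h) k + e by rewrite sqblock_line; ring.
have := @power_sum_strongly_convex R n (fun k => sqblock u k + e) (fun k => 2 * dotblock u h k)
  (fun k => sqblock h k) p p01 p12 _ _ _ t t01.
have E x : \sum_k (sqblock u k + e + 2 * dotblock u h k * x + sqblock h k * x ^+ 2) `^ p =
    \sum_k (sqblock (u + x *: h) k + e) `^ p by apply: eq_bigr => k _; rewrite line.
rewrite !E scale0r addr0 scale1r (_ : u + h = v); last by rewrite addrC subrK.
move=> H; apply: le_trans (H _ _ _).
- rewrite lerD2r /blockQ ge0_ler_powR ?invr_ge0 ?(ltW p0)// ?nnegrE.
  + by apply: sumr_ge0 => k _; exact: powR_ge0.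
  + by apply: sumr_ge0 => k _; exact: powR_ge0.
  apply: ler_sum => k _; rewrite ge0_ler_powR ?(ltW p0)// ?nnegrE ?sqblock_ge0//.
  + by rewrite addr_ge0 ?sqblock_ge0// ltW.
  + by rewrite lerDl ltW.
- by move=> k; exact: sqblock_ge0.
- by move=> k x; rewrite line; rewrite ltr_wpDl// sqblock_ge0.
move=> k x; rewrite line.
have -> : 2 * dotblock u h k + 2 * sqblock h k * x = 2 * dotblock (u + x *: h) h k.
  by rewrite /sqblock /dotblock /re_block /im_block !mxE; ring.
rewrite exprMn; have := sqblock_cauchy (u + x *: h) h k.
by move=> /disc_bound; apply; rewrite ?sqblock_ge0// ltW.
Unshelve. all: by end_near. Qed.

End BlockConvex.

(** * Directional derivatives of the squared l_q-norm *)

Section Gateaux.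
Context {R : realType}.

Lemma is_derive_line m (f : 'cV[R]_m -> R) (u h : 'cV[R]_m) (l : R) :
  is_derive (0 : R) 1 (fun t : R => f (u + t *: h)) l ->
  is_derive u h (f : 'cV[R]_m -> R^o) l.
Proof.
have E : (fun t : R => t^-1 *: (((f : 'cV[R]_m -> R^o) \o shift u) (t *: h) - f u)) =
    (fun t : R => t^-1 *: (((fun t : R => f (u + t *: h)) \o shift 0) (t *: 1) - f (u + 0 *: h))).
  apply/funext => t; congr (_ *: _); rewrite /= scale0r addr0 [t *: 1]mulr1 addr0.
  by rewrite (addrC u).
move=> [h1 h2]; split; first by rewrite /derivable E.
by rewrite /derive E.
Qed.

(** As [grad] is assembled from partial derivatives, it represents all directional derivatives once
    these are linear in the direction. *)
Lemma grad_linear m (f : 'cV[R]_m -> R) (L : 'cV[R]_m -> 'cV[R]_m -> R) :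
  (forall u h, is_derive u h (f : 'cV[R]_m -> R^o) (L u h)) ->
  (forall u h h', L u (h + h') = L u h + L u h') ->
  (forall u a h, L u (a *: h) = a * L u h) ->
  forall u h, L u h = dot (grad f u) h.
Proof.
move=> df LD LZ u h.
have L0 : L u 0 = 0 by rewrite -(scale0r 0) LZ mul0r.
rewrite {1}[h](_ : h = \sum_j h j 0 *: delta_mx j 0); last first.
  by rewrite {1}[h]matrix_sum_delta; apply: eq_bigr => i _; rewrite big_ord1.
rewrite (big_morph (L u) (LD u) L0); apply: eq_bigr => i _.
by rewrite LZ mulrC mxE; have [_ ->] := df u (delta_mx i 0).
Qed.

(** The difference quotient has absolute value |t|^(2p-1). This is where q = 2 p > 1 enters. *)
Lemma is_derive_sqr_powR0 (p : R) : 1 < 2 * p -> is_derive (0 : R) 1 (fun t : R => (t ^+ 2) `^ p) 0.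
Proof.
move=> p12.
have p0 : 0 < p by lra.
have lim : (fun t : R => t^-1 *: (((fun t : R => (t ^+ 2) `^ p) \o shift 0) (t *: 1) - (0 ^+ 2) `^ p)) @ 0^' --> (0 : R).
  apply: norm_cvg0.
  have : `|t| `^ (2 * p - 1) @[t --> (0:R)^'] --> (0 : R).
    rewrite -[X in _ --> X](@powR0 _ (2 * p - 1)); last by rewrite gt_eqF// subr_gt0.
    apply: cvg_powR => //; first by rewrite subr_gt0.
    rewrite -[X in _ --> X](@normr0 _ R).
    by apply: cvg_within_filter; exact: norm_continuous.
  apply: cvg_trans; apply: near_eq_cvg; near=> t.
  have t0 : t != 0 by near: t; exact: nbhs_dnbhs_neq.
  rewrite /= [t *: 1]mulr1 addr0 expr0n /= powR0 ?gt_eqF// subr0 [_ *: _]/(_ * _).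
  rewrite normrM normfV (ger0_norm (powR_ge0 _ _)) -(real_normK (num_real t)).
  by rewrite -powR_mulrn ?normr_ge0// -powRrM powRB1 ?normr_gt0// mulrC.
split; first by apply/cvg_ex; eexists; exact: lim.
exact: cvg_lim lim.
Unshelve. all: by end_near. Qed.

Variable n : nat.
Implicit Types u v h : 'cV[R]_(n.+1.*2).

Lemma sqblock_eq0 u k : sqblock u k = 0 -> re_block u k = 0 /\ im_block u k = 0.
Proof.
rewrite /sqblock => /eqP; rewrite paddr_eq0 ?sqr_ge0// !sqrf_eq0.
by move=> /andP[/eqP -> /eqP ->].
Qed.

Lemma dotblock0 u h k : sqblock u k = 0 -> dotblock u h k = 0.
Proof. by move=> /sqblock_eq0[a b]; rewrite /dotblock a b !mul0r addr0. Qed.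

Definition blockQ_grad (p : R) u h :=
  p^-1 * (\sum_k sqblock u k `^ p) `^ (p^-1 - 1) *
  \sum_k p * sqblock u k `^ (p - 1) * (2 * dotblock u h k).

(** If the k-th complex coordinate of u vanishes, the function is a constant times (t^2)^p;
    otherwise the chain rule applies at a positive base. *)
Let dsq p u h k : 1 < 2 * p ->
  is_derive (0 : R) 1 (fun t : R => sqblock (u + t *: h) k `^ p)
    (p * sqblock u k `^ (p - 1) * (2 * dotblock u h k)).
Proof.
move=> p12.
have [s0|s0] := eqVneq (sqblock u k) 0.
  rewrite (dotblock0 h s0) !mulr0.
  rewrite (_ : (fun _ => _) = (fun t : R => sqblock h k `^ p * (t ^+ 2) `^ p)); last first.
    apply/funext => t; rewrite sqblock_line s0 (dotblock0 h s0) mulr0 mul0r !add0r.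
    by rewrite powRM ?sqblock_ge0 ?sqr_ge0.
  have d := is_derive_sqr_powR0 p12.
  by apply: is_derive_eq; rewrite /GRing.scale /= mulr0.
have sp : 0 < sqblock u k by rewrite lt_neqAle eq_sym s0 sqblock_ge0.
pose g t := sqblock u k + 2 * dotblock u h k * t + sqblock h k * t ^+ 2.
have g0 : g 0 = sqblock u k by rewrite /g mulr0 expr0n /= mulr0 !addr0.
have dg : is_derive (0 : R) 1 g (2 * dotblock u h k).
  by rewrite /g; apply: is_derive_eq; rewrite /GRing.scale /=; ring.
rewrite (_ : (fun _ => _) = (fun t => g t `^ p)); last first.
  by apply/funext => t; rewrite sqblock_line.
rewrite -g0.
apply: (@is_derive1_comp R (fun x => x `^ p) g 0 _ _ (is_derive1_powR p _) dg).
by rewrite g0.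
Qed.

(** If all complex coordinates of u vanish, homogeneity makes the function quadratic along the line;
    otherwise the outer power acts on a positive sum. *)
Lemma blockQ_derive p u h : 1 < 2 * p ->
  is_derive u h (blockQ p : 'cV[R]_(n.+1.*2) -> R^o) (blockQ_grad p u h).
Proof.
move=> p12; have p0 : 0 < p by lra.
apply: is_derive_line.
set f := fun t : R => _.
have [S0|S0] := eqVneq (\sum_k sqblock u k `^ p) 0.
  have sq0 k : sqblock u k = 0.
    move/eqP: S0; rewrite psumr_eq0 => [/allP/(_ k)|j _]; last exact: powR_ge0.
    by rewrite mem_index_enum => /(_ isT); rewrite implyTb => /eqP/powR_eq0_eq0.
  rewrite (_ : blockQ_grad p u h = 0); last first.
    by rewrite /blockQ_grad [X in _ * X]big1 ?mulr0// => k _; rewrite (dotblock0 h (sq0 k)) !mulr0.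
  rewrite (_ : f = (fun t => blockQ p h * t ^+ 2)); last first.
    apply/funext => t; rewrite [RHS]mulrC -(blockQZ t h p0) /f /blockQ.
    apply: (congr1 (fun x => x `^ p^-1)).
    apply: eq_bigr => k _; congr (_ `^ _).
    rewrite sqblock_line sq0 (dotblock0 h (sq0 k)) mulr0 mul0r !add0r.
    by rewrite /sqblock /re_block /im_block !mxE; ring.
  by apply: is_derive_eq; rewrite /GRing.scale /=; ring.
have Sp : 0 < \sum_k sqblock u k `^ p.
  by rewrite lt_neqAle eq_sym S0; apply: sumr_ge0 => k _; exact: powR_ge0.
pose g t := \sum_k sqblock (u + t *: h) k `^ p.
have g0 : g 0 = \sum_k sqblock u k `^ p.
  by apply: eq_bigr => k _; rewrite scale0r addr0.
have dg : is_derive (0 : R) 1 g (\sum_k p * sqblock u k `^ (p - 1) * (2 * dotblock u h k)).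
  rewrite (_ : g = \sum_k (fun t : R => sqblock (u + t *: h) k `^ p)); last first.
    by apply/funext => t; rewrite /g fct_sumE.
  by apply: is_derive_sum => k; exact: dsq.
rewrite /blockQ_grad -g0.
apply: (@is_derive1_comp R (fun x => x `^ p^-1) g 0 _ _ (is_derive1_powR p^-1 _) dg).
by rewrite g0.
Qed.

Lemma blockQ_gradD p u h h' : blockQ_grad p u (h + h') = blockQ_grad p u h + blockQ_grad p u h'.
Proof.
rewrite /blockQ_grad -mulrDr -big_split; congr (_ * _); apply: eq_bigr => k _.
by rewrite dotblockDr /=; ring.
Qed.

Lemma blockQ_gradZ p u a h : blockQ_grad p u (a *: h) = a * blockQ_grad p u h.
Proof.
rewrite /blockQ_grad [RHS]mulrCA [in RHS]mulr_sumr; congr (_ * _); apply: eq_bigr => k _.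
by rewrite dotblockZr /=; ring.
Qed.

End Gateaux.

(** * The two setups as distance-generating functions *)

Section Setups.
Context {R : realType}.

Lemma blockQ_continuous n (p : R) : 0 < p -> continuous (blockQ p : 'cV[R]_(n.+1.*2) -> R).
Proof.
move=> p0 u; apply: (@cvg_powR _ _ (nbhs u)).
- by rewrite invr_gt0.
- by apply: sumr_ge0 => k _; exact: powR_ge0.
- by move=> v; apply: sumr_ge0 => k _; exact: powR_ge0.
apply: (@cvg_big _ _ +%R 0 xpredT add_continuous _ (nbhs u)) => k _.
apply: (@cvg_powR _ _ (nbhs u)) => //; [exact: sqblock_ge0|by move=> v; exact: sqblock_ge0|].
have c i : (fun v : 'cV[R]_(n.+1.*2) => v i 0 ^+ 2) @ u --> u i 0 ^+ 2.
  by apply: (@cvgM _ _ (nbhs u)); exact: coord_continuous.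
by apply: (@cvgD _ _ _ (nbhs u)); exact: c.
Qed.

(** Hoelder's inequality, obtained from Jensen with uniform weights 1/(n+1). *)
Lemma rcnorm1_sqr_le n (q : R) (u : 'cV[R]_(n.+1.*2)) : 1 <= q ->
  rcnorm 1%:E u ^+ 2 <= (n.+1%:R `^ (1 - q^-1)) ^+ 2 * blockQ (q / 2) u.
Proof.
move=> q1; have q0 : 0 < q by lra.
have N0 : 0 < n.+1%:R :> R by rewrite ltr0n.
rewrite -(rcnorm_blockQ u q0) -exprMn; apply: lerXn2r; rewrite ?nnegrE ?mulr_ge0 ?rcnorm_ge0 ?powR_ge0//.
rewrite rcnorm1E /rcnorm /cnorm.
have := @jensen_powR R 'I_n.+1 (fun=> n.+1%:R^-1) (fun k => Normc.normc (unvec u k 0) `^ q) q^-1.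
rewrite invr_gt0 q0 invf_le1// q1 => /(_ isT) h.
rewrite -(ler_pM2l (_ : 0 < n.+1%:R^-1)); last by rewrite invr_gt0.
apply: le_trans (_ : _ <= (\sum_(k < n.+1) n.+1%:R^-1 * Normc.normc (unvec u k 0) `^ q) `^ q^-1) _.
  rewrite mulr_sumr; apply: le_trans (h _ _ _).
  - apply: ler_sum => k _; rewrite -normc_unvec -powRrM mulfV ?gt_eqF// powRr1//.
    by rewrite normc_unvec sqrtr_ge0.
  - by move=> _; rewrite invr_ge0 ltW.
  - by rewrite sumr_const card_ord -[_ *+ _]mulr_natr mulVf// gt_eqF.
  - by move=> k; exact: powR_ge0.
rewrite -mulr_sumr powRM ?invr_ge0 ?(ltW N0)//; last by apply: sumr_ge0 => k _; exact: powR_ge0.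
rewrite mulrA ler_wpM2r ?powR_ge0//.
rewrite (_ : 1 - q^-1 = - q^-1 + 1); last by rewrite addrC.
rewrite powRD ?(gt_eqF N0) ?implybT// powRr1 ?(ltW N0)// mulrCA mulVf ?gt_eqF// mulr1.
by rewrite -(powR_inv1 (ltW N0)) -powRrM mulN1r.
Qed.

(** With T the l1-norm, |z_k|^q <= |z_k| T^(q-1), and these bounds sum to T^q. *)
Lemma blockQ_le_rcnorm1 n (q : R) (u : 'cV[R]_(n.+1.*2)) : 1 <= q ->
  blockQ (q / 2) u <= rcnorm 1%:E u ^+ 2.
Proof.
move=> q1; have q0 : 0 < q by lra.
rewrite -(rcnorm_blockQ u q0); apply: lerXn2r; rewrite ?nnegrE ?rcnorm_ge0//.
set T := rcnorm 1%:E u.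
have T0 : 0 <= T by exact: rcnorm_ge0.
have TE : T = \sum_k Normc.normc (unvec u k 0).
  by rewrite /T rcnorm1E; apply: eq_bigr => k _; rewrite normc_unvec.
have nc0 k : 0 <= Normc.normc (unvec u k 0) by rewrite normc_unvec sqrtr_ge0.
rewrite /rcnorm /cnorm -[leRHS](powRr1 T0) -[X in _ <= _ `^ X](mulfV (lt0r_neq0 q0)) [leRHS]powRrM.
apply: ge0_ler_powR; rewrite ?invr_ge0 ?(ltW q0) ?nnegrE ?powR_ge0//.
  by apply: sumr_ge0 => k _; exact: powR_ge0.
have [TZ|TN] := eqVneq T 0.
  rewrite big1 ?powR_ge0// => k _.
  move/eqP: TZ; rewrite TE psumr_eq0// => /allP/(_ k); rewrite mem_index_enum => /(_ isT)/eqP ->.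
  by rewrite powR0// gt_eqF.
have TP : 0 < T by rewrite lt_neqAle eq_sym TN.
rewrite -mulr_powRB1// {1}TE mulr_suml; apply: ler_sum => k _.
rewrite -[in leLHS]mulr_powRB1// ler_wpM2l//.
rewrite ge0_ler_powR ?subr_ge0 ?nnegrE// TE (bigD1 k)//= lerDl.
by apply: sumr_ge0 => j _.
Qed.

Definition setup_exponent (s : prox_setup) (n : nat) : R :=
  if s is L2_setup then 2 else qtilde n.

Definition setup_coeff (s : prox_setup) (n : nat) : R :=
  if s is L2_setup then 1 else
  n.+1%:R `^ ((qtilde n - 1) * (2 - qtilde n) / qtilde n) / ctilde n.

(** From exp(-1/6) >= 5/6 follows e <= (6/5)^6 < 3. The bound gives ln(n+1) >= 1 for n >= 2, the
    threshold in [qtilde], and hence q <= 2. *)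
Lemma expR1_le3 : expR 1 <= 3 :> R.
Proof.
have h : expR (- 6^-1) >= 5 / 6 :> R by apply: le_trans (expR_ge1Dx _); lra.
have h6 : expR 6^-1 <= 6 / 5 :> R.
  by rewrite -[X in expR X]opprK expRN -[leRHS]invrK lef_pV2 ?posrE ?expR_gt0//; lra.
rewrite -[1 in leLHS](mulfV (_ : 6%:R != 0 :> R))// expRM_natl; apply: le_trans (_ : (6 / 5) ^+ 6 <= _); last lra.
by apply: lerXn2r; rewrite ?nnegrE ?expR_ge0//; lra.
Qed.

Lemma ln_ge1 n : (2 <= n)%N -> 1 <= ln n.+1%:R :> R.
Proof.
move=> n2; rewrite -[leLHS]expRK ler_ln ?posrE ?expR_gt0 ?ltr0n//.
by apply: le_trans expR1_le3 _; rewrite ler_nat.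
Qed.

Lemma qtilde_itv n : 1 < (qtilde n : R) <= 2.
Proof.
rewrite /qtilde; case: leqP => n1; first by rewrite ltr1n lexx.
have l1 := ln_ge1 n1; have l0 : 0 < ln n.+1%:R :> R by lra.
by rewrite ltrDl invr_gt0 l0/= -lerBrDl (_ : 2 - 1 = 1) ?invf_le1//; lra.
Qed.

Lemma setup_exponent_itv s n : 1 < setup_exponent s n <= 2.
Proof. by case: s => /=; [rewrite ltr1n lexx|exact: qtilde_itv]. Qed.

Lemma ctilde_gt0 n : 0 < ctilde n :> R.
Proof.
rewrite /ctilde; case: leqP => n1; first by rewrite invr_gt0 ltr0n.
rewrite invr_gt0 mulr_gt0 ?expR_gt0//; have := ln_ge1 n1; lra.
Qed.

Lemma setup_coeff_gt0 s n : 0 < setup_coeff s n.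
Proof. by case: s => //=; rewrite divr_gt0 ?ctilde_gt0 ?powR_gt0 ?ltr0n. Qed.

Lemma setup_omegaE s n (u : 'cV[R]_(n.+1.*2)) :
  setup_omega s u = setup_coeff s n / 2 * blockQ (setup_exponent s n / 2) u.
Proof.
have /andP[q1 _] := setup_exponent_itv s n.
rewrite -rcnorm_blockQ; last by apply: lt_trans q1.
case: s {q1} => /=; first by rewrite rcnorm2_sqr div1r.
by congr (_ * _); field; rewrite gt_eqF// ctilde_gt0.
Qed.

Lemma powR_inv_ln (x : R) : 1 < x -> x `^ (ln x)^-1 = expR 1.
Proof.
move=> x1; rewrite /powR gt_eqF; last by apply: lt_trans x1.
by rewrite mulVf// gt_eqF// ln_gt0.
Qed.

(** The normalisation of the complex l1-setup is made for this. For n >= 2 and N = n + 1, the factor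
    1/[ctilde] times q - 1 equals e = N^(q-1), and (q-1)(2-q)/q + (q-1) = 2 (1 - 1/q) is the
    exponent of the squared Hoelder constant. *)
Lemma setup_modulus s n (u : 'cV[R]_(n.+1.*2)) :
  rcnorm (setup_index s)%:E u ^+ 2 <=
  setup_coeff s n * (setup_exponent s n - 1) * blockQ (setup_exponent s n / 2) u.
Proof.
case: s => /=; first by rewrite mul1r (_ : 2 - 1 = 1) ?mul1r ?rcnorm_blockQ//; lra.
have /andP[q1 q2] := qtilde_itv n; have q0 : 0 < qtilde n :> R by lra.
have N0 : 0 < n.+1%:R :> R by rewrite ltr0n.
apply: le_trans (rcnorm1_sqr_le u (ltW q1)) _.
apply: ler_wpM2r; first exact: blockQ_ge0.
rewrite /ctilde; move: q1 q2 q0; rewrite /qtilde; case: leqP => n1 q1 q2 q0.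
  rewrite subrr mulr0 mul0r powRr0 invrK mul1r (_ : 1 - 2^-1 = 2^-1); last lra.
  by rewrite powR12_sqrt ?(ltW N0)// sqr_sqrtr ?(ltW N0)//; lra.
have l1 := ln_ge1 n1; have l0 : 0 < ln n.+1%:R :> R by lra.
have N1' : 1 < n.+1%:R :> R by rewrite ltr1n ltnS ltnW.
set q := 1 + _ in q0 q1 q2 *; rewrite invrK (_ : q - 1 = (ln n.+1%:R)^-1); last by rewrite /q addrAC subrr add0r.
rewrite mulrA mulfK ?gt_eqF// -(powR_inv_ln N1').
rewrite -powRD ?(gt_eqF N0) ?implybT// -powR_mulrn ?powR_ge0// -powRrM.
rewrite le_eqVlt; apply/orP; left; apply/eqP; congr (_ `^ _).
rewrite /q; field; rewrite !gt_eqF//.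
by move: q0; rewrite /q -(pmulr_lgt0 _ l0) mulrDl mul1r mulVf ?gt_eqF// addrC.
Qed.

(** For n >= 2 the power of N = n + 1 is at most N^(q-1) = e, because (2-q)/q <= 1. A second factor
    e comes from [ctilde], and ln(n+1) <= ln n + 1 since n + 1 <= 2n <= e n. The constant 9 bounds
    e^2. *)
Lemma setup_coeff_le s n : (1 <= n)%N -> setup_coeff s n <= 9 * (ln n%:R + 1).
Proof.
move=> n0.
have n0' : 0 < n%:R :> R by rewrite ltr0n.
have lnn : 0 <= ln n%:R :> R by rewrite ln_ge0// ler1n.
case: s => /=; first lra.
have /andP[q1 q2] := qtilde_itv n; have q0 : 0 < qtilde n :> R by lra.
have N1 : 1 <= n.+1%:R :> R by rewrite ler1n.
move: q1 q2 q0; rewrite /ctilde /qtilde; case: leqP => n1 q1 q2 q0.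
  rewrite subrr mulr0 mul0r powRr0 invrK mul1r.
  have : n.+1%:R <= 2 :> R by rewrite ler_nat.
  lra.
have l1 := ln_ge1 n1; have l0 : 0 < ln n.+1%:R :> R by lra.
have N1' : 1 < n.+1%:R :> R by rewrite ltr1n ltnS ltnW.
set q := 1 + _ in q0 q1 q2 *; rewrite invrK.
have qE : q - 1 = (ln n.+1%:R)^-1 by rewrite /q addrAC subrr add0r.
have h1 : n.+1%:R `^ ((q - 1) * (2 - q) / q) <= expR 1.
  rewrite -(powR_inv_ln N1').
  apply: ler_powR => //; rewrite -qE -mulrA ler_piMr//; first lra.
  by rewrite ler_pdivrMr//; lra.
have h2 : ln n.+1%:R <= ln n%:R + 1 :> R.
  have -> : ln n%:R + 1 = ln (n%:R * expR 1) :> R by rewrite lnM ?posrE ?expR_gt0// expRK.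
  rewrite ler_ln ?posrE ?mulr_gt0 ?expR_gt0 ?ltr0n//.
  apply: le_trans (_ : n%:R * 2 <= _).
    by rewrite -natrM ler_nat muln2 -addnn -addn1 leq_add2l.
  rewrite ler_pM2l//; have := expR_ge1Dx (1 : R); lra.
apply: le_trans (_ : expR 1 * (expR 1 * (ln n%:R + 1)) <= _).
  apply: ler_pM => //; rewrite ?powR_ge0 ?mulr_ge0 ?expR_ge0 ?(ltW l0)//.
  by rewrite ler_pM2l ?expR_gt0.
rewrite mulrA ler_pM2r; last lra.
have := expR1_le3; have := expR_gt0 (1 : R); nra.
Qed.

Lemma setup_omega_ge0 s n (u : 'cV[R]_(n.+1.*2)) : 0 <= setup_omega s u.
Proof. by rewrite setup_omegaE mulr_ge0 ?blockQ_ge0// divr_ge0// ltW// setup_coeff_gt0. Qed.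

Lemma setup_omegaZ s n a (u : 'cV[R]_(n.+1.*2)) : setup_omega s (a *: u) = a ^+ 2 * setup_omega s u.
Proof.
have /andP[q1 _] := setup_exponent_itv s n.
have p0 : 0 < setup_exponent s n / 2 by lra.
by rewrite !setup_omegaE (blockQZ a u p0) mulrCA.
Qed.

Lemma setup_omega0 s n : setup_omega s (0 : 'cV[R]_(n.+1.*2)) = 0.
Proof. by rewrite -(scale0r 0) setup_omegaZ expr0n mul0r. Qed.

Lemma setup_omega_le s n (u : 'cV[R]_(n.+1.*2)) : (1 <= n)%N ->
  2 * setup_omega s u <= 9 * (ln n%:R + 1) * rcnorm 1%:E u ^+ 2.
Proof.
move=> n1; have /andP[q1 q2] := setup_exponent_itv s n.
rewrite setup_omegaE mulrA mulrCA mulfV// mulr1.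
apply: ler_pM; rewrite ?blockQ_ge0 ?(ltW (setup_coeff_gt0 _ _)) ?setup_coeff_le//.
by rewrite blockQ_le_rcnorm1// ltW.
Qed.

Lemma rcnorm_coord (q : R) n (u : 'cV[R]_(n.+1.*2)) : 0 < q -> `|u| <= rcnorm q%:E u.
Proof.
move=> q0; rewrite [leLHS]/Num.norm [leLHS]/= mx_normrE; apply/bigmax_leP; split; first exact: rcnorm_ge0.
move=> [j i] _ /=; rewrite ord1.
have hk : (j < n.+1.*2)%N by exact: ltn_ord.
have h2 : (j./2 < n.+1)%N by rewrite ltn_half_double.
pose k := inord j./2 : 'I_n.+1.
have kE : k = j./2 :> nat by rewrite inordK.
have cj : `|u j 0| <= Normc.normc (unvec u k 0).
  rewrite normc_unvec -sqrtr_sqr ler_wsqrtr// /sqblock /re_block /im_block.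
  have jE := odd_double_half j; case oj : (odd j) jE => /= jE.
    rewrite add1n in jE; have -> : (inord k.*2.+1 : 'I_(n.+1.*2)) = j.
      by apply: val_inj; rewrite /= kE jE inordK.
    by rewrite lerDr sqr_ge0.
  rewrite add0n in jE; have -> : (inord k.*2 : 'I_(n.+1.*2)) = j.
    by apply: val_inj; rewrite /= kE jE inordK.
  by rewrite lerDl sqr_ge0.
apply: le_trans cj _.
have nc0 i' : 0 <= Normc.normc (unvec u i' 0) by rewrite normc_unvec sqrtr_ge0.
rewrite /rcnorm /cnorm -[leLHS](powRr1 (nc0 k)) -[X in _ `^ X <= _](mulfV (lt0r_neq0 q0)) [leLHS]powRrM.
apply: ge0_ler_powR; rewrite ?invr_ge0 ?(ltW q0) ?nnegrE ?powR_ge0//.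
  by apply: sumr_ge0 => i' _; exact: powR_ge0.
by rewrite (bigD1 k)//= lerDl; apply: sumr_ge0 => i' _; exact: powR_ge0.
Qed.

Lemma setup_index_gt0 s : 0 < setup_index s :> R.
Proof. by case: s. Qed.

Let setup_derive s n (u h : 'cV[R]_(n.+1.*2)) :
  is_derive u h (setup_omega s (n := n) : 'cV[R]_(n.+1.*2) -> R^o)
    (setup_coeff s n / 2 * blockQ_grad (setup_exponent s n / 2) u h).
Proof.
have /andP[q1 _] := setup_exponent_itv s n.
have d : is_derive u h (blockQ (setup_exponent s n / 2) : 'cV[R]_(n.+1.*2) -> R^o) (blockQ_grad (setup_exponent s n / 2) u h).
  by apply: blockQ_derive; rewrite mulrC divfK.
have -> : setup_omega s (n := n) = (fun u : 'cV[R]_(n.+1.*2) => setup_coeff s n / 2 *: (blockQ (setup_exponent s n / 2) u : R^o)).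
  by apply/funext => v; rewrite setup_omegaE.
exact: is_deriveZ.
Qed.

Lemma setup_gradE s n (u h : 'cV[R]_(n.+1.*2)) :
  setup_coeff s n / 2 * blockQ_grad (setup_exponent s n / 2) u h =
  dot (grad (setup_omega s (n := n)) u) h.
Proof.
apply: (grad_linear (L := fun u h => setup_coeff s n / 2 * blockQ_grad (setup_exponent s n / 2) u h)) => //.
- by move=> ? ? ?; rewrite blockQ_gradD mulrDr.
- by move=> ? ? ?; rewrite blockQ_gradZ mulrCA.
Qed.

Lemma setup_grad0 s n (h : 'cV[R]_(n.+1.*2)) : dot (grad (setup_omega s (n := n)) 0) h = 0.
Proof.
rewrite -setup_gradE /blockQ_grad [\sum_k _ * (2 * _)]big1 ?mulr0// => k _; rewrite dotblock0 ?mulr0//.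
by rewrite /sqblock /re_block /im_block !mxE expr0n addr0.
Qed.

Lemma secant_bound (t l M e k q a b c f : R) : 0 < t -> t <= 1 -> 0 <= k ->
  a + q * f * t * (1 - t) <= (1 - t) * b + t * c -> M <= k * (q * f) ->
  t * M <= e / 2 -> - (t * (e / 2)) <= k * a - k * b - t * l ->
  M <= e + (k * c - k * b - l).
Proof.
move=> t0 t1 k0 h1 h2 h3 h4.
have u0 : 0 <= t * (1 - t) by rewrite mulr_ge0 ?subr_ge0// ltW.
have e1 := ler_wpM2l k0 h1.
have e2 := ler_wpM2l u0 h2.
have e3 := ler_wpM2l (ltW t0) h3.
rewrite -(ler_pM2l t0); lra.
Qed.

(** Strong convexity follows from the chord inequality at u + t (v - u) divided by t. It loses the
    factor 1 - t and the error of the difference quotient, and t is chosen so small that each loss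
    is at most e/2. *)
Lemma setup_dgf s n : dgf (setup_omega s (n := n)) (rcnorm (setup_index s)%:E : 'cV[R]_(n.+1.*2) -> R).
Proof.
have /andP[q1 q2] := setup_exponent_itv s n.
have d u h : is_derive u h (setup_omega s (n := n) : 'cV[R]_(n.+1.*2) -> R^o) (dot (grad (setup_omega s (n := n)) u) h).
  by rewrite -setup_gradE.
split => //.
- move=> u v; rewrite /bregman; set h := v - u.
  set p := setup_exponent s n / 2; set K := setup_coeff s n.
  have K0 : 0 < K by exact: setup_coeff_gt0.
  apply/ler_addgt0Pl => e e0.
  have e2 : 0 < e / 2 by lra.
  have [t0 t00 tP] := is_derive_dirP (d u h) e2.
  set l := dot _ h in tP *.
  set M := 2^-1 * rcnorm (setup_index s)%:E h ^+ 2.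
  have M0 : 0 <= M by rewrite mulr_ge0 ?sqr_ge0// invr_ge0.
  have K20 : 0 <= K / 2 by rewrite divr_ge0// ltW.
  have Mle : M <= K / 2 * ((setup_exponent s n - 1) * blockQ p h).
    rewrite (_ : K / 2 * _ = 2^-1 * (K * (setup_exponent s n - 1) * blockQ p h)); last by ring.
    by rewrite /M; apply: ler_wpM2l; [rewrite invr_ge0|exact: setup_modulus].
  pose t := Num.min t0 (Num.min 1 (e / 2 / (M + 1))).
  have M1 : 0 < M + 1 by lra.
  have t_gt0 : 0 < t by rewrite !lt_min t00 ltr01 divr_gt0.
  have t1 : t <= 1 by rewrite !ge_min lexx !orbT.
  have tM : t * M <= e / 2.
    have : t <= e / 2 / (M + 1) by rewrite !ge_min lexx !orbT.
    rewrite ler_pdivlMr// mulrDr mulr1; lra.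
  have := tP t; rewrite t_gt0 ge_min lexx => /(_ isT); rewrite ler_norml => /andP[+ _].
  have := @blockQ_strongly_convex R n p u v t; rewrite -/h.
  rewrite divr_gt0 ?ler_pdivrMr ?mul1r ?q2 ?(lt_trans _ q1)// mulrCA mulfV// mulr1 (ltW q1) ltW//.
  move=> /(_ isT isT t1); rewrite !setup_omegaE -/K -/p => c1 c2.
  exact: (secant_bound t_gt0 t1 K20 c1 Mle tM c2).
- rewrite (_ : setup_omega s (n := n) = (fun u => setup_coeff s n / 2 * blockQ (setup_exponent s n / 2) u)).
    move=> u; apply: (@cvgM _ _ (nbhs u)); first exact: cvg_cst.
    by apply: blockQ_continuous; rewrite divr_gt0// (lt_trans _ q1).
  by apply/funext => v; rewrite setup_omegaE.
exists 1 => // u; rewrite mul1r lerXn2r ?nnegrE ?rcnorm_ge0//.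
exact/rcnorm_coord/setup_index_gt0.
Qed.

End Setups.

(** * Fourier analysis and operator norms *)

Section Fourier.
Context {R : realType}.
Implicit Types (a b : R) (z w : R[i]).

Definition cis (a : R) : R[i] := cos a +i* sin a.

Lemma cisD a b : cis (a + b) = cis a * cis b.
Proof.
apply/eqP; rewrite eq_complex /= cosD sinD; apply/andP; split; apply/eqP; ring.
Qed.

Lemma cis0 : cis 0 = 1.
Proof. by rewrite /cis cos0 sin0. Qed.

Lemma conjc_cis a : conjc (cis a) = cis (- a).
Proof. by rewrite /cis /= cosN sinN. Qed.

Lemma cis_nat a (k : nat) : cis (k%:R * a) = cis a ^+ k.
Proof.
elim: k => [|k IH]; first by rewrite mul0r cis0 expr0.
by rewrite exprS -IH -cisD; congr cis; rewrite -natr1; ring.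
Qed.

Lemma cis_2pi : cis (2 * pi) = 1.
Proof. by rewrite /cis mulr_natl -[pi *+ 2]add0r cosD2pi sinD2pi cos0 sin0. Qed.

(** By the duplication formula cos a = 1 forces sin(|a|/2) = 0, impossible for |a|/2 strictly
    between 0 and pi. *)
Lemma cis_neq1 a : 0 < `|a| < 2 * pi -> cis a != 1.
Proof.
move=> /andP[a0 a2]; apply/negP => /eqP/(congr1 (@complex.Re R)) /= h.
have aE : a = (a / 2) *+ 2 by rewrite -[RHS]mulr_natr divfK.
have : cos `|a| = 1.
  by case: (ger0P a) => _; rewrite ?cosN.
rewrite (_ : `|a| = (`|a| / 2) *+ 2); last by rewrite -[RHS]mulr_natr divfK.
rewrite cos_mulr2n => h2.
have s0 : 0 < sin (`|a| / 2) by apply: sin_gt0_pi; lra.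
have := cos2Dsin2 (`|a| / 2); have := mulr_gt0 s0 s0; rewrite -expr2.
move: h2; rewrite -mulr_natr; lra.
Qed.

Definition sqc z : R := complex.Re z ^+ 2 + complex.Im z ^+ 2.

Lemma sqc_ge0 z : 0 <= sqc z.
Proof. by rewrite addr_ge0 ?sqr_ge0. Qed.

Lemma normcE z : Normc.normc z = Num.sqrt (sqc z).
Proof. by case: z. Qed.

Lemma sqcM z w : sqc (z * w) = sqc z * sqc w.
Proof. by case: z w => [a b] [c e]; rewrite /sqc /=; ring. Qed.

Lemma sqc_cis a : sqc (cis a) = 1.
Proof. by rewrite /sqc /= cos2Dsin2. Qed.

Lemma sqc_real a : sqc a%:C = a ^+ 2.
Proof. by rewrite /sqc /= expr0n addr0. Qed.

Lemma sqcE z : (sqc z)%:C = conjc z * z.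
Proof. by case: z => a b; apply/eqP; rewrite eq_complex /sqc /=; apply/andP; split; apply/eqP; ring. Qed.

Definition cnorm2 (m : nat) (z : 'cV[R[i]]_m) : R := \sum_k sqc (z k 0).

Definition dft_angle (n : nat) (k t : nat) : R := 2 * pi * k%:R * t%:R / n.+1%:R.

Lemma dftE n k t : dft n k t = ((Num.sqrt n.+1%:R)^-1)%:C * cis (dft_angle n k t).
Proof. by rewrite mxE. Qed.

Lemma dftHE n k t : dftH n k t = ((Num.sqrt n.+1%:R)^-1)%:C * cis (- dft_angle n t k).
Proof. by rewrite !mxE rmorphM /= -conjc_cis oppr0. Qed.

Lemma dftH_dft n : dftH n *m dft n = 1%:M :> 'M[R[i]]_n.+1.
Proof.
apply/matrixP => i j; rewrite !mxE.
have N0 : 0 < n.+1%:R :> R by rewrite ltr0n.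
have cE : ((Num.sqrt n.+1%:R)^-1)%:C * ((Num.sqrt n.+1%:R)^-1)%:C = (n.+1%:R^-1)%:C :> R[i].
  by rewrite -rmorphM /= -expr2 exprVn sqr_sqrtr// ltW.
pose a : R := 2 * pi * (j%:R - i%:R) / n.+1%:R.
rewrite (eq_bigr (fun k : 'I_n.+1 => (n.+1%:R^-1)%:C * cis a ^+ k)); last first.
  move=> k _; rewrite dftHE dftE mulrACA cE -cisD -cis_nat; congr (_ * cis _).
  by rewrite /dft_angle /a; ring.
rewrite -mulr_sumr; have [ij|ij] := eqVneq i j.
  have -> : a = 0 by rewrite /a ij subrr mulr0 mul0r.
  rewrite cis0; under eq_bigr do rewrite expr1n.
  rewrite sumr_const card_ord (_ : 1 *+ n.+1 = (n.+1%:R : R)%:C); last by rewrite rmorph_nat.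
  by rewrite -rmorphM /= mulVf ?gt_eqF.
(* Off the diagonal this is a geometric sum whose ratio is a nontrivial root of unity of order
   dividing n + 1, because 0 < |j - i| < n + 1. *)
suff -> : \sum_(k < n.+1) cis a ^+ k = 0 by rewrite mulr0.
have aN : cis a != 1.
  apply: cis_neq1; rewrite /a !normrM normfV normr_nat (ger0_norm (pi_ge0 R)) (ger0_norm (_ : 0 <= n.+1%:R))//.
  have d0 : 0 < `|j%:R - i%:R| :> R.
    by rewrite normr_gt0 subr_eq0 eqr_nat eq_sym.
  rewrite !mulr_gt0 ?pi_gt0 ?invr_gt0//= ltr_pdivrMr// ltr_pM2l ?mulr_gt0 ?pi_gt0//.
  have := ltn_ord i; have := ltn_ord j; rewrite -!(ltr_nat R) => h1 h2.
  have := ler0n R i; have := ler0n R j => h3 h4.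
  rewrite ltr_norml; apply/andP; split; lra.
apply/eqP; have := subrX1 (cis a) n.+1.
rewrite -cis_nat (_ : n.+1%:R * a = 2 * pi * (j%:R - i%:R)); last first.
  by rewrite /a mulrC divfK// gt_eqF.
have -> : cis (2 * pi * (j%:R - i%:R)) = 1.
  rewrite mulrBr cisD -conjc_cis !(mulrC (2 * pi)) (cis_nat (2 * pi) j) (cis_nat (2 * pi) i).
  by rewrite cis_2pi !expr1n conjc1 mulr1.
by move/eqP; rewrite subrr eq_sym mulf_eq0 subr_eq0 (negbTE aN).
Qed.

Lemma dft_dftH n : dft n *m dftH n = 1%:M :> 'M[R[i]]_n.+1.
Proof. by apply: mulmx1C; exact: dftH_dft. Qed.

Lemma cnorm2E m (z : 'cV[R[i]]_m) : (cnorm2 z)%:C = ((map_mx conjc z)^T *m z) 0 0.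
Proof.
rewrite /cnorm2 rmorph_sum mxE; apply: eq_bigr => k _.
by transitivity ((sqc (z k 0))%:C); rewrite // sqcE !mxE.
Qed.

Lemma cnorm2_dft n (z : 'cV[R[i]]_n.+1) : cnorm2 (dft n *m z) = cnorm2 z.
Proof.
apply: (@complexI R); rewrite !cnorm2E map_mxM trmx_mul -mulmxA [X in _ *m X]mulmxA.
rewrite [X in _ *m (X *m _ *m _)](_ : _ = dftH n); last by rewrite /dftH map_trmx.
by rewrite dftH_dft mul1mx.
Qed.

Lemma cnorm2_dftH n (z : 'cV[R[i]]_n.+1) : cnorm2 (dftH n *m z) = cnorm2 z.
Proof. by rewrite -(cnorm2_dft (dftH n *m z)) mulmxA dft_dftH mul1mx. Qed.

Lemma dft_normc_le m (z : 'cV[R[i]]_m) k : Normc.normc (z k 0) <= cnorm +oo%E z.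
Proof. exact: (le_bigmax _ (fun k => Normc.normc (z k 0))). Qed.

Lemma sqc_le_cnormy m (z : 'cV[R[i]]_m) k : sqc (z k 0) <= cnorm +oo%E z ^+ 2.
Proof.
rewrite -[sqc _]sqr_sqrtr ?sqc_ge0// -normcE; apply: lerXn2r; rewrite ?nnegrE.
- by rewrite normcE sqrtr_ge0.
- by apply: le_trans (dft_normc_le z k); rewrite normcE sqrtr_ge0.
exact: dft_normc_le.
Qed.

Lemma sum_insub (V : nmodType) m N (H : 'I_m -> V) : (m <= N)%N ->
  \sum_(j < N) oapp H 0 (insub (j : nat)) = \sum_i H i.
Proof.
move=> mN; pose G (j : nat) := oapp H 0 (insub j : option 'I_m).
rewrite [RHS](eq_bigr (fun i : 'I_m => G i)); last by move=> i _; rewrite /G valK.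
rewrite (big_ord_widen N G mN) [RHS]big_mkcond /=; apply: eq_bigr => j _.
by rewrite /G; case: ifPn => // jm; rewrite insubN.
Qed.

(* On [0, n] the convolution of y with a filter supported on [0, n] is a circular convolution
   of length 2n + 1, hence diagonal in the Fourier basis of that length. *)
Lemma cnorm2_convolve n (y : signal R) (phi : 'cV[R[i]]_n.+1) :
  cnorm2 (segment 0 n.+1 (convolve y (zero_pad phi))) <=
  n.*2.+1%:R * spectral_sup n y ^+ 2 * cnorm2 phi.
Proof.
set N := n.*2.+1.
have N0 : 0 < N%:R :> R by rewrite ltr0n.
have sN : (Num.sqrt N%:R)%:C * ((Num.sqrt N%:R)^-1)%:C = 1 :> R[i].
  by rewrite -rmorphM /= mulfV// gt_eqF// sqrtr_gt0.
have nN : (n.+1 <= N)%N by rewrite /N ltnS -addnn leq_addr.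
pose Y := dft n.*2 *m segment (- n%:Z) N y.
pose pad : 'cV[R[i]]_N := \col_j oapp (fun i : 'I_n.+1 => phi i 0) 0 (insub (j : nat)).
pose Phi := dft n.*2 *m pad.
have PhiE k : Phi k 0 = \sum_(i < n.+1) dft n.*2 k (widen_ord nN i) * phi i 0.
  rewrite mxE -(sum_insub _ nN); apply: eq_bigr => j _; rewrite [pad j 0]mxE.
  case: insubP => [i _ ij|_] /=; last by rewrite mulr0.
  by congr (dft _ _ _ * _); apply: val_inj; rewrite /= ij.
have padn : cnorm2 pad = cnorm2 phi.
  rewrite /cnorm2 -(sum_insub (fun i => sqc (phi i 0)) nN); apply: eq_bigr => j _; rewrite mxE.
  by case: insubP => [i _ ij|_] //=; rewrite /sqc /= expr0n addr0.
(* The extra phase compensates for the window of samples starting at time -n: entry j of the segment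
   is y at time j - n. *)
pose Z : 'cV[R[i]]_N := \col_k (Y k 0 * cis (- dft_angle n.*2 k n) * Phi k 0).
have convE (t : 'I_n.+1) : segment 0 n.+1 (convolve y (zero_pad phi)) t 0 =
    (Num.sqrt N%:R)%:C * (dftH n.*2 *m Z) (widen_ord nN t) 0.
  rewrite [LHS]mxE convolve_zero_pad add0r.
  have yE (i : 'I_n.+1) : y (t%:Z - i%:Z) =
      \sum_(k < N) ((Num.sqrt N%:R)^-1)%:C * cis (- dft_angle n.*2 k t) * cis (- dft_angle n.*2 k n) * cis (dft_angle n.*2 k i) * Y k 0.
    (* Time t - i sits at position t + n - i, which stays in [0, 2n], so that no index wraps
       around. *)
    have jN : (t + n - i < N)%N.
      rewrite /N ltnS -addnn; apply: leq_trans (leq_subr _ _) _; by rewrite leq_add2r -ltnS.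
    have -> : y (t%:Z - i%:Z) = segment (- n%:Z) N y (Ordinal jN) 0.
      have i_n : (i <= t + n)%N by rewrite -ltnS; apply: leq_trans (ltn_ord i) _; rewrite ltnS leq_addl.
      by rewrite mxE /= -subzn// PoszD; congr y; ring.
    rewrite -[segment _ _ _]mul1mx -dftH_dft -mulmxA -/Y mxE; apply: eq_bigr => k _.
    rewrite dftHE -!mulrA; congr (_ * _); rewrite !mulrA -!cisD; congr (cis _ * _).
    rewrite /dft_angle /= natrB ?natrD; last first.
      by rewrite -ltnS; apply: leq_trans (ltn_ord i) _; rewrite ltnS leq_addl.
    by ring.
  rewrite (eq_bigr _ (fun i _ => congr1 (fun c => c * phi i 0) (yE i))).
  rewrite [in RHS]mxE mulr_sumr.
  under eq_bigr do rewrite mulr_suml.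
  rewrite exchange_big /=; apply: eq_bigr => k _.
  rewrite [Z k 0]mxE PhiE !mulr_sumr; apply: eq_bigr => i _.
  rewrite dftHE dftE /=.
  set a := cis _; set b := cis _; set c := cis _; set s := ((Num.sqrt N%:R)^-1)%:C.
  transitivity ((Num.sqrt N%:R)%:C * s * (s * a * b * c * Y k 0 * phi i 0)); first by rewrite sN mul1r.
  by ring.
(* Only n + 1 of the 2n + 1 coordinates are kept, hence an inequality. *)
apply: le_trans (_ : N%:R * cnorm2 Z <= _).
  rewrite -(cnorm2_dftH Z) /cnorm2 mulr_sumr.
  rewrite (eq_bigr _ (fun t _ => congr1 sqc (convE t))).
  under eq_bigr do rewrite sqcM sqc_real sqr_sqrtr ?(ltW N0)//.
  rewrite -(@big_ord_narrow _ 0 +%R _ _ (fun j => N%:R * sqc ((dftH n.*2 *m Z) j 0)) nN) /=.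
  rewrite big_mkcond /=; apply: ler_sum => j _; case: ifP => // _.
  by rewrite mulr_ge0 ?sqc_ge0// ltW.
rewrite -mulrA ler_pM2l// -padn -(cnorm2_dft pad) -/Phi /cnorm2 mulr_sumr.
apply: ler_sum => k _; rewrite mxE !sqcM sqc_cis mulr1 ler_wpM2r ?sqc_ge0//.
exact: sqc_le_cnormy.
Qed.

End Fourier.

(** * Norm comparisons and duality in real coordinates *)

Section Norms.
Context {R : realType} (n : nat).
Implicit Types (u v w : 'cV[R]_(n.+1.*2)).

Lemma sqblock_unvec u k : sqblock u k = sqc (unvec u k 0).
Proof. by rewrite mxE. Qed.

Lemma cnorm2_unvec u : cnorm2 (unvec u) = dot u u.
Proof.
rewrite dot_dotblock; apply: eq_bigr => k _.
by rewrite -sqblock_unvec /sqblock /dotblock -!expr2.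
Qed.

Lemma rcnorm2E u : rcnorm 2%:E u = Num.sqrt (dot u u).
Proof. by rewrite -rcnorm2_sqr sqrtr_sqr ger0_norm// rcnorm_ge0. Qed.

Lemma rcnormyE u : rcnorm +oo%E u = \big[Num.max/0]_k Num.sqrt (sqblock u k).
Proof. by apply: eq_bigr => k _; rewrite normc_unvec. Qed.

Lemma sqrt_sqblock_ley u k : Num.sqrt (sqblock u k) <= rcnorm +oo%E u.
Proof. by rewrite rcnormyE; exact: (le_bigmax _ (fun k => Num.sqrt (sqblock u k))). Qed.

Let sqr_le_inv (a b : R) : 0 <= b -> a ^+ 2 <= b ^+ 2 -> a <= b.
Proof.
move=> b0 ab; rewrite -(ger0_norm b0); apply: le_trans (ler_norm _) _.
by rewrite -!sqrtr_sqr ler_wsqrtr.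
Qed.

Lemma rcnorm2_le1 u : rcnorm 2%:E u <= rcnorm 1%:E u.
Proof.
apply: sqr_le_inv; first exact: rcnorm_ge0.
rewrite (rcnorm_blockQ u (ltr0n R 2)); apply: blockQ_le_rcnorm1; exact: ler1n.
Qed.

Lemma rcnormy_le2 u : rcnorm +oo%E u <= rcnorm 2%:E u.
Proof.
rewrite rcnormyE rcnorm2E; apply/bigmax_leP; split; first exact: sqrtr_ge0.
move=> k _; apply: ler_wsqrtr; rewrite -cnorm2_unvec /cnorm2 (bigD1 k)//= -sqblock_unvec lerDl.
by apply: sumr_ge0 => j _; exact: sqc_ge0.
Qed.

Lemma rcnorm2_le_setup s u : rcnorm 2%:E u <= rcnorm (setup_index s)%:E u.
Proof. by case: s; [exact: lexx|exact: rcnorm2_le1]. Qed.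

Lemma conj_setup s : conj_exponent (setup_index s) = (if s is L2_setup then 2%:E else +oo%E) :> \bar R.
Proof.
case: s; rewrite /conj_exponent /= ?eqxx//.
rewrite (_ : (2 == 1 :> R) = false); last by apply/negbTE; rewrite -[2]/(2%:R) pnatr_eq1.
by rewrite (_ : 2 - 1 = 1) ?divr1//; lra.
Qed.

Lemma conj_le_rcnorm2 s u : rcnorm (conj_exponent (setup_index s)) u <= rcnorm 2%:E u.
Proof. by rewrite conj_setup; case: s; [exact: lexx|exact: rcnormy_le2]. Qed.

Lemma sqblockZ a u k : sqblock (a *: u) k = a ^+ 2 * sqblock u k.
Proof. by rewrite /sqblock /re_block /im_block !mxE; ring. Qed.

Lemma sqrt_sqblockZ a u k : 0 <= a -> Num.sqrt (sqblock (a *: u) k) = a * Num.sqrt (sqblock u k).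
Proof. by move=> a0; rewrite sqblockZ sqrtrM ?sqr_ge0// sqrtr_sqr ger0_norm. Qed.

Lemma rcnorm1Z a u : 0 <= a -> rcnorm 1%:E (a *: u) = a * rcnorm 1%:E u.
Proof.
by move=> a0; rewrite !rcnorm1E mulr_sumr; apply: eq_bigr => k _; rewrite sqrt_sqblockZ.
Qed.

Lemma rcnorm2Z a u : 0 <= a -> rcnorm 2%:E (a *: u) = a * rcnorm 2%:E u.
Proof.
by move=> a0; rewrite !rcnorm2E dotZl dotZr mulrA -expr2 sqrtrM ?sqr_ge0// sqrtr_sqr ger0_norm.
Qed.

Lemma rcnormyZ a u : 0 <= a -> rcnorm +oo%E (a *: u) = a * rcnorm +oo%E u.
Proof.
move=> a0; rewrite !rcnormyE.
rewrite (big_morph ( *%R a) (id1 := 0) (op1 := Num.max)); last by rewrite mulr0.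
  by apply: eq_bigr => k _; rewrite sqrt_sqblockZ.
by move=> x y; rewrite maxr_pMr.
Qed.

Lemma rcnorm_setupZ s a u : 0 <= a ->
  rcnorm (setup_index s)%:E (a *: u) = a * rcnorm (setup_index s)%:E u.
Proof. by case: s => a0; [exact: rcnorm2Z|exact: rcnorm1Z]. Qed.

Lemma rcnorm_conjZ s a u : 0 <= a ->
  rcnorm (conj_exponent (setup_index s)) (a *: u) = a * rcnorm (conj_exponent (setup_index s)) u.
Proof. by rewrite conj_setup; case: s => a0; [exact: rcnorm2Z|exact: rcnormyZ]. Qed.

Lemma dotblock_le u v k : dotblock u v k <= Num.sqrt (sqblock u k) * Num.sqrt (sqblock v k).
Proof.
rewrite -sqrtrM ?sqblock_ge0//; apply: le_trans (ler_norm _) _.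
by rewrite -sqrtr_sqr; apply: ler_wsqrtr; exact: sqblock_cauchy.
Qed.

Lemma rcnorm1D u v : rcnorm 1%:E (u + v) <= rcnorm 1%:E u + rcnorm 1%:E v.
Proof.
rewrite !rcnorm1E -big_split; apply: ler_sum => k _ /=.
rewrite -[leRHS]ger0_norm ?addr_ge0 ?sqrtr_ge0// -sqrtr_sqr; apply: ler_wsqrtr.
have := dotblock_le u v k; rewrite sqrrD !sqr_sqrtr ?sqblock_ge0// -[v]scale1r.
by rewrite sqblock_line !scale1r; lra.
Qed.

Lemma rcnorm1_convex : is_convex_fun (rcnorm 1%:E : 'cV[R]_(n.+1.*2) -> R).
Proof.
move=> u v t /andP[t0 t1].
rewrite (_ : u + _ = (1 - t) *: u + t *: v); last by rewrite scalerBl scalerBr scale1r addrA addrAC.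
have s0 : 0 <= 1 - t by rewrite subr_ge0.
apply: le_trans (rcnorm1D _ _) _; rewrite (rcnorm1Z _ s0) (rcnorm1Z _ t0).
move: (rcnorm _ u) (rcnorm _ v) => a b; lra.
Qed.

Lemma rcnorm1_continuous : continuous (rcnorm 1%:E : 'cV[R]_(n.+1.*2) -> R).
Proof.
move=> u; rewrite (_ : rcnorm 1%:E = (fun u => \sum_k Num.sqrt (sqblock u k))); last first.
  by apply/funext => v; rewrite rcnorm1E.
apply: (@cvg_big _ _ +%R 0 xpredT add_continuous _ (nbhs u)) => k _.
apply: (@continuous_comp _ _ _ (fun v => sqblock v k) Num.sqrt); last exact: sqrt_continuous.
have c i : (fun v : 'cV[R]_(n.+1.*2) => v i 0 ^+ 2) @ u --> u i 0 ^+ 2.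
  by apply: (@cvgM _ _ (nbhs u)); exact: coord_continuous.
by apply: (@cvgD _ _ _ (nbhs u)); exact: c.
Qed.

Lemma dot_le1y v w : dot v w <= rcnorm 1%:E v * rcnorm +oo%E w.
Proof.
rewrite dot_dotblock rcnorm1E mulr_suml; apply: ler_sum => k _.
by apply: le_trans (dotblock_le _ _ _) _; rewrite ler_wpM2l ?sqrtr_ge0 ?sqrt_sqblock_ley.
Qed.

Lemma dot_le22 v w : dot v w <= rcnorm 2%:E v * rcnorm 2%:E w.
Proof.
rewrite !rcnorm2E -sqrtrM ?dot_ge0//; apply: le_trans (ler_norm _) _.
rewrite -sqrtr_sqr; apply: ler_wsqrtr.
have [w0|w0] := eqVneq (dot w w) 0.
  suff -> : w = 0 by rewrite !dot0r expr0n mulr0.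
  apply/matrixP => i j; rewrite ord1 mxE; apply/eqP.
  move/eqP: w0; rewrite psumr_eq0 => [/allP/(_ i)|k _]; last by rewrite -expr2 sqr_ge0.
  by rewrite mem_index_enum => /(_ isT); rewrite implyTb mulf_eq0 orbb.
have wp : 0 < dot w w by rewrite lt_neqAle eq_sym w0 dot_ge0.
have := dot_ge0 (dot w w *: v - dot v w *: w).
rewrite dotBl !dotBr !dotZl !dotZr (dotC w v) => h.
rewrite -subr_ge0 -(pmulr_rge0 _ wp); apply: le_trans h _; lra.
Qed.

Lemma dot_le_dual s v w :
  dot v w <= rcnorm (setup_index s)%:E v * rcnorm (conj_exponent (setup_index s)) w.
Proof. by rewrite conj_setup; case: s; [exact: dot_le22|exact: dot_le1y]. Qed.

(** Identifies the inner maximum of the saddle-point form with the uniform-fit residual. For the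
    lower bound, a vector v supported on the k-th complex coordinate and aligned there with w yields
    |w_k|. *)
Lemma sup_dot_domV w : sup [set dot v w | v in domV (n := n)] = rcnorm +oo%E w.
Proof.
have ub : ubound [set dot v w | v in domV (n := n)] (rcnorm +oo%E w).
  move=> _ [v Vv <-]; apply: le_trans (dot_le1y _ _) _.
  by rewrite ler_piMl// rcnorm_ge0.
have hs : has_ubound [set dot v w | v in domV (n := n)] by exists (rcnorm +oo%E w).
have V0 : domV (0 : 'cV[R]_(n.+1.*2)).
  by rewrite /domV /mkset -(scale0r 0) (rcnorm1Z _ (lexx 0)) mul0r ler01.
apply/eqP; rewrite eq_le; apply/andP; split.
  apply: ge_sup => //; exists (dot 0 w); exists 0 => //.
rewrite rcnormyE; apply/bigmax_leP; split => [|k _].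
  by apply: ub_le_sup => //; exists 0 => //; rewrite dot0l.
have [s0|s0] := eqVneq (sqblock w k) 0.
  rewrite s0 sqrtr0; by apply: ub_le_sup => //; exists 0 => //; rewrite dot0l.
set c := Num.sqrt (sqblock w k).
have c0 : 0 < c by rewrite sqrtr_gt0 lt_neqAle eq_sym s0 sqblock_ge0.
pose v : 'cV[R]_(n.+1.*2) := vec (\col_j (if j == k then (c^-1)%:C * unvec w j 0 else 0)).
have vE j : sqblock v j = if j == k then 1 else 0.
  rewrite sqblock_unvec /v vecK mxE; case: eqP => [->|_]; last by rewrite /sqc /= expr0n addr0.
  rewrite sqcM sqc_real -sqblock_unvec -[sqblock w k]sqr_sqrtr ?sqblock_ge0// -/c.
  by rewrite -exprMn mulVf ?gt_eqF// expr1n.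
apply: ub_le_sup => //; exists v.
  rewrite /domV /mkset rcnorm1E (bigD1 k)//= vE eqxx sqrtr1 big1 ?addr0// => j /negbTE jk.
  by rewrite vE jk sqrtr0.
have db j : dotblock v w j = complex.Re (unvec v j 0) * complex.Re (unvec w j 0)
   + complex.Im (unvec v j 0) * complex.Im (unvec w j 0) by rewrite [unvec v j 0]mxE [unvec w j 0]mxE.
rewrite dot_dotblock (bigD1 k)//= [X in _ + X]big1 ?addr0; last first.
  by move=> j /negbTE jk; rewrite db /v vecK mxE jk /= !mul0r addr0.
rewrite db /v vecK [X in complex.Re X * _ + complex.Im X * _]mxE eqxx.
rewrite [unvec w k 0]mxE /= !mul0r subr0 addr0 -!mulrA -mulrDr -!expr2.
rewrite -/(re_block w k) -/(im_block w k) -/(sqblock w k) -[sqblock w k]sqr_sqrtr ?sqblock_ge0// -/c.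
by rewrite expr2 mulrA mulVf ?gt_eqF// mul1r.
Qed.

End Norms.

(** * The operator A and the transfer of optimality to real coordinates *)

Section Operator.
Context {R : realType} (n : nat) (y : signal R).
Implicit Types (u v w : 'cV[R]_(n.+1.*2)).

Definition spectral_bound : R := Num.sqrt n.*2.+1%:R * spectral_sup n y.

Lemma spectral_sup_ge0 (x : signal R) : 0 <= spectral_sup n x.
Proof.
rewrite /spectral_sup /cnorm; elim/big_ind: _ => // [a b a0 b0|k _].
  by rewrite le_max a0.
by rewrite normcE sqrtr_ge0.
Qed.

Lemma spectral_bound_ge0 : 0 <= spectral_bound.
Proof. by rewrite mulr_ge0 ?sqrtr_ge0 ?spectral_sup_ge0. Qed.

Lemma Amx_rcnorm2 u : rcnorm 2%:E (Amx n y *m u) <= spectral_bound * rcnorm 2%:E u.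
Proof.
rewrite !rcnorm2E -(ger0_norm spectral_bound_ge0) -sqrtr_sqr -sqrtrM ?sqr_ge0//.
apply: ler_wsqrtr; rewrite AmxE -!cnorm2_unvec vecK /calA /dft_signal cnorm2_dft.
apply: le_trans (cnorm2_convolve _ _) _; rewrite cnorm2_dftH.
by rewrite /spectral_bound exprMn sqr_sqrtr.
Qed.

(** Each admissible input norm dominates the l2-norm and each output norm is dominated by it, so the
    l2 bound covers all cases. The value [be] = 2 is the case of [L_f], the conjugate exponent that
    of [L_F]. *)
Lemma Amx_rcnorm (s s' : prox_setup) (be : \bar R) u :
  be = 2%:E \/ be = conj_exponent (setup_index s') ->
  rcnorm be (Amx n y *m u) <= spectral_bound * rcnorm (setup_index s)%:E u.
Proof.
move=> hb; apply: (@le_trans _ _ (rcnorm 2%:E (Amx n y *m u))).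
  by case: hb => ->; [exact: lexx|exact: conj_le_rcnorm2].
apply: le_trans (Amx_rcnorm2 u) _; apply: ler_wpM2l; first exact: spectral_bound_ge0.
exact: rcnorm2_le_setup.
Qed.

Section OpNorm.
Variables (s s' : prox_setup) (be : \bar R).
Hypothesis hb : be = 2%:E \/ be = conj_exponent (setup_index s').
Let al : \bar R := (setup_index s)%:E.
Let S := [set cnorm be (calA y psi) | psi in [set psi : 'cV[R[i]]_n.+1 | cnorm al psi = 1]].

Let calA_unvec u : cnorm be (calA y (unvec u)) = rcnorm be (Amx n y *m u).
Proof. by rewrite AmxE /rcnorm vecK. Qed.

Let S_ub : ubound S spectral_bound.
Proof.
move=> _ [psi h <-]; rewrite -[psi]vecK calA_unvec.
have h1 : cnorm (setup_index s)%:E psi = 1 by exact: h.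
apply: le_trans (Amx_rcnorm s _ hb) _.
by rewrite /rcnorm vecK h1 mulr1.
Qed.

Lemma calA_norm_le : calA_norm n y al be <= spectral_bound.
Proof.
rewrite /calA_norm -/S; have [->|S0] := eqVneq S set0.
  by rewrite sup0 spectral_bound_ge0.
by apply: ge_sup; [exact/set0P|exact: S_ub].
Qed.

Let rcnorm_be_Z a u : 0 <= a -> rcnorm be (a *: u) = a * rcnorm be u.
Proof. by case: hb => -> a0; [exact: rcnorm2Z|exact: rcnorm_conjZ]. Qed.

Let rcnorm_be_ge0 u : 0 <= rcnorm be u.
Proof. exact: rcnorm_ge0. Qed.

Lemma calA_norm_ge0 : 0 <= calA_norm n y al be.
Proof.
rewrite /calA_norm -/S; have [->|/set0P[c Sc]] := eqVneq S set0; first by rewrite sup0.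
have c0 : 0 <= c by case: Sc => psi _ <-; rewrite -[psi]vecK calA_unvec rcnorm_be_ge0.
apply: le_trans c0 _; apply: ub_le_sup => //; exists spectral_bound; exact: S_ub.
Qed.

Lemma Amx_le_calA_norm u :
  rcnorm be (Amx n y *m u) <= calA_norm n y al be * rcnorm (setup_index s)%:E u.
Proof.
have [u0|uN] := eqVneq (rcnorm (setup_index s)%:E u) 0.
  by have := Amx_rcnorm s u hb; rewrite u0 !mulr0.
have up : 0 < rcnorm (setup_index s)%:E u by rewrite lt_neqAle eq_sym uN rcnorm_ge0.
set c := rcnorm _ u in up *.
have cV : 0 <= c^-1 by rewrite invr_ge0 ltW.
rewrite -ler_pdivrMr// mulrC -(rcnorm_be_Z _ cV) scalemxAr.
rewrite -calA_unvec; apply: ub_le_sup; first by exists spectral_bound; exact: S_ub.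
exists (unvec (c^-1 *: u)) => //.
change (rcnorm (setup_index s)%:E (c^-1 *: u) = 1).
by rewrite (rcnorm_setupZ _ _ cV) mulVf// gt_eqF.
Qed.

End OpNorm.

Lemma zero_pad_segment (phi : signal R) : supported_in n phi ->
  zero_pad (segment 0 n.+1 phi) = phi.
Proof.
move=> sp; apply/funext => -[k|k] /=; last by rewrite sp.
case: insubP => [i _ ik|]; first by rewrite mxE add0r ik.
by move=> h; rewrite sp//; move: h; rewrite ltnS lez_nat => /negbTE ->; rewrite andbF.
Qed.

Lemma segment_zero_pad (z : 'cV[R[i]]_n.+1) : segment 0 n.+1 (zero_pad z) = z.
Proof. by apply/matrixP => i j; rewrite mxE add0r /= valK ord1. Qed.

Lemma zero_pad_supported (z : 'cV[R[i]]_n.+1) : supported_in n (zero_pad z).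
Proof.
move=> [k|k] //=; case: insubP => //= i _ ik.
by rewrite lez_nat -ik -ltnS ltn_ord.
Qed.

Lemma convolve_zero_padl (z : 'cV[R[i]]_n.+1) t :
  convolve (zero_pad z) y t = \sum_(i < n.+1) y (t - (i : nat)%:Z) * z i 0.
Proof.
rewrite /convolve (@fsbigE _ _ _ _ _ [seq (val i)%:Z | i <- enum 'I_n.+1]).
- rewrite big_map big_enum_cond /=; apply: eq_big => [i|i _]; first by rewrite /= in_setT.
  by rewrite /= valK mulrC.
- by rewrite map_inj_uniq ?enum_uniq // => a b [] /val_inj.
- by [].
- move=> i _; apply: contraNeq => h; apply/mapP.
  move: h; rewrite /zero_pad; case: i => [k|k]; last by rewrite mul0r eqxx.
  case: insubP => [j _ jk _|_]; last by rewrite mul0r eqxx.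
  by exists j; rewrite ?mem_enum// jk.
Qed.

Lemma dft_signal_residual (phi : signal R) : supported_in n phi ->
  vec (dft_signal n (fun t => y t - convolve phi y t)) =
  - (Amx n y *m vec (dft_signal n phi) - bvec n y).
Proof.
move=> sp; rewrite AmxE vecK /calA /dft_signal mulmxA dftH_dft mul1mx.
rewrite zero_pad_segment// opprB.
rewrite /bvec /dft_signal -[vec (dft n *m segment 0 n.+1 y)]scale1r addrC -scaleN1r.
rewrite -[in LHS](zero_pad_segment sp).
set z := segment 0 n.+1 phi.
have -> : segment 0 n.+1 (fun t => y t - convolve (zero_pad z) y t) =
   (-1)%:C *: segment 0 n.+1 (convolve y (zero_pad z)) + segment 0 n.+1 y.
  apply/matrixP => i j; rewrite !mxE convolve_zero_padl convolve_zero_pad.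
  by rewrite rmorphN1 mulN1r addrC.
by rewrite mulmxDr -scalemxAr vec_linear scale1r zero_pad_segment.
Qed.

Lemma rcnormN (p : \bar R) u : rcnorm p (- u) = rcnorm p u.
Proof.
have E k : Normc.normc (unvec (- u) k 0) = Normc.normc (unvec u k 0).
  by rewrite !normc_unvec /sqblock /re_block /im_block !mxE !sqrrN.
case: p => [r| |]; rewrite /rcnorm /cnorm; last by [].
  by apply: (congr1 (fun x => x `^ r^-1)); apply: eq_bigr => k _; rewrite E.
by apply: eq_bigr => k _; rewrite E.
Qed.

Lemma Res_rcnorm p (phi : signal R) : supported_in n phi ->
  Res n y p phi = rcnorm p (Amx n y *m vec (dft_signal n phi) - bvec n y).
Proof. by move=> sp; rewrite -rcnormN -dft_signal_residual// /rcnorm vecK. Qed.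

Variables (rbar lambda : R) (pb : problem).

Lemma objective_UF u : ~~ is_LS pb ->
  objective y lambda pb u = rcnorm +oo%E (Amx n y *m u - bvec n y) + Psi lambda pb u.
Proof. by move=> /negbTE pbE; rewrite /objective pbE /fUF sup_dot_domV. Qed.

Lemma objective_filter (phi : signal R) : supported_in n phi ->
  objective y lambda pb (vec (dft_signal n phi)) = filter_objective n y lambda pb phi.
Proof.
move=> sp; rewrite /objective /filter_objective !(Res_rcnorm _ sp) /fUF sup_dot_domV rcnorm2_sqr.
by rewrite /Psi /fLS /rcnorm vecK.
Qed.

(** The zero-padded inverse DFT is a bijection from vectors to filters supported on [0, n], and it
    preserves feasibility and objective values. *)
Lemma optimal_filter_objective (phihat : signal R) :
  optimal_filter n y rbar lambda pb phihat ->
  let us := vec (dft_signal n phihat) in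
  domU rbar pb us /\ forall u, domU rbar pb u -> objective y lambda pb us <= objective y lambda pb u.
Proof.
move=> [feas opt] us.
have sp : supported_in n phihat by move: feas; rewrite /filter_feasible; case: is_penalized => // -[].
split.
  move: feas; rewrite /filter_feasible /domU; case: is_penalized => // -[_ h].
  by rewrite /mkset /us /rcnorm vecK.
move=> u Du; pose phi := zero_pad (dftH n *m unvec u).
have spp : supported_in n phi by exact: zero_pad_supported.
have uE : u = vec (dft_signal n phi).
  by rewrite /dft_signal /phi segment_zero_pad mulmxA dft_dftH mul1mx unvecK.
rewrite uE (objective_filter sp) (objective_filter spp); apply: opt.
move: Du; rewrite /filter_feasible /domU; case: is_penalized; first by [].
by rewrite /mkset uE /rcnorm vecK => h; split; [exact: spp|exact: h].
Qed.

Lemma optimal_value_at (us : 'cV[R]_(n.+1.*2)) : domU rbar pb us ->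
  (forall u : 'cV[R]_(n.+1.*2), domU rbar pb u -> objective y lambda pb us <= objective y lambda pb u) ->
  optimal_value n y rbar lambda pb = objective y lambda pb us.
Proof.
move=> Dus opt; apply/eqP; rewrite eq_le; apply/andP; split.
  apply: ge_inf; last by exists us.
  by exists (objective y lambda pb us) => _ [u Du <-]; exact: opt.
apply: lb_le_inf; first by exists (objective y lambda pb us); exists us.
by move=> _ [u Du <-]; exact: opt.
Qed.

Lemma ell1_sizeE (phihat : signal R) :
  ell1_size n phihat = Num.sqrt n.+1%:R * rcnorm 1%:E (vec (dft_signal n phihat)).
Proof. by rewrite /ell1_size /rcnorm vecK. Qed.

End Operator.

Lemma dot_eq0 {R : realType} m (u : 'cV[R]_m) : dot u u <= 0 -> u = 0.
Proof.
move=> u0; have /eqP : dot u u = 0 by apply/eqP; rewrite eq_le u0 dot_ge0.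
rewrite psumr_eq0 => [/allP h|k _]; last by rewrite -expr2 sqr_ge0.
apply/matrixP => i j; rewrite ord1 mxE; apply/eqP; move: (h i).
by rewrite mem_index_enum => /(_ isT); rewrite implyTb mulf_eq0 orbb.
Qed.

(** * Feasible sets, penalty and proximal steps *)

Section Domain.
Context {R : realType} (n : nat) (rbar lambda : R) (pb : problem).
Hypotheses (rbar0 : 0 < rbar) (lambda0 : 0 <= lambda).
Implicit Types u v : 'cV[R]_(n.+1.*2).

Lemma rcnorm1_0 : rcnorm 1%:E (0 : 'cV[R]_(n.+1.*2)) = 0.
Proof. by rewrite -(scale0r 0) (rcnorm1Z _ (lexx 0)) mul0r. Qed.

Let ball_closed (c : R) : closed [set u : 'cV[R]_(n.+1.*2) | rcnorm 1%:E u <= c].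
Proof.
apply: (@preimage_closed _ _ (rcnorm 1%:E : 'cV[R]_(n.+1.*2) -> R) [set x | x <= c]); last exact: closed_le.
by move=> x _; exact: rcnorm1_continuous.
Qed.

Let ball_convex (c : R) : is_convex_set [set u : 'cV[R]_(n.+1.*2) | rcnorm 1%:E u <= c].
Proof.
move=> u v t; rewrite /mkset => uc vc t01; apply: le_trans (rcnorm1_convex u v t01) _.
have /andP[t0 t1] := t01.
have s0 : 0 <= 1 - t by rewrite subr_ge0.
move: (ler_wpM2l s0 uc) (ler_wpM2l t0 vc) => {uc vc}.
move: (rcnorm _ u) (rcnorm _ v) => a b; lra.
Qed.

Lemma domV_closed : closed (domV (n := n) : set 'cV[R]_(n.+1.*2)).
Proof. exact: ball_closed. Qed.

Lemma domV_convex : is_convex_set (domV (n := n) : set 'cV[R]_(n.+1.*2)).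
Proof. exact: ball_convex. Qed.

Lemma domV0 : domV (0 : 'cV[R]_(n.+1.*2)).
Proof. by rewrite /domV /mkset rcnorm1_0 ler01. Qed.

Lemma domU_closed : closed (domU (n := n) rbar pb).
Proof. by rewrite /domU; case: is_penalized; [exact: closedT|exact: ball_closed]. Qed.

Lemma domU_convex : is_convex_set (domU (n := n) rbar pb).
Proof. by rewrite /domU; case: is_penalized; [by []|exact: ball_convex]. Qed.

Lemma domU0 : domU (n := n) rbar pb 0.
Proof.
rewrite /domU; case: is_penalized; first by [].
by rewrite /mkset rcnorm1_0 divr_ge0 ?sqrtr_ge0// ltW.
Qed.

Lemma Psi_ge0 u : 0 <= Psi lambda pb u.
Proof. by rewrite /Psi; case: is_penalized; [rewrite mulr_ge0 ?rcnorm_ge0|]. Qed.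

Lemma Psi0 : Psi lambda pb (0 : 'cV[R]_(n.+1.*2)) = 0.
Proof. by rewrite /Psi; case: is_penalized; rewrite ?rcnorm1_0 ?mulr0. Qed.

Lemma PsiZ a u : 0 <= a -> Psi lambda pb (a *: u) = a * Psi lambda pb u.
Proof.
by move=> a0; rewrite /Psi; case: is_penalized; rewrite ?mulr0// (rcnorm1Z _ a0) mulrCA.
Qed.

Lemma PsiD u v : Psi lambda pb (u + v) <= Psi lambda pb u + Psi lambda pb v.
Proof.
rewrite /Psi; case: is_penalized; last by rewrite addr0.
by rewrite -mulrDr ler_wpM2l// rcnorm1D.
Qed.

Lemma Psi_convex : is_convex_fun (Psi lambda pb : 'cV[R]_(n.+1.*2) -> R).
Proof.
move=> u v t t01; rewrite /Psi; case: is_penalized; last by rewrite subrr mulr0 addr0.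
move: (ler_wpM2l lambda0 (rcnorm1_convex u v t01)).
move: (rcnorm _ (_ + _)) (rcnorm _ u) (rcnorm _ v) => x z w; lra.
Qed.

Lemma Psi_scale_convex c : 0 <= c ->
  is_convex_fun (fun u : 'cV[R]_(n.+1.*2) => c * Psi lambda pb u).
Proof.
move=> c0 u v t t01; move: (ler_wpM2l c0 (Psi_convex u v t01)).
move: (Psi _ _ (_ + _)) (Psi _ _ u) (Psi _ _ v) => x z w; lra.
Qed.

Lemma Psi_continuous c : continuous (fun u => c * Psi lambda pb u).
Proof.
move=> u; rewrite /Psi; case: is_penalized; last exact: cst_continuous.
apply: (@cvgM _ _ (nbhs u)); first exact: cvg_cst.
by apply: (@cvgM _ _ (nbhs u)); [exact: cvg_cst|exact: rcnorm1_continuous].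
Qed.

Lemma setup_prox s (c : R) u g : 0 <= c ->
  forall v, domU rbar pb v ->
  let z := prox (setup_omega s (n := n)) (domU rbar pb) (fun xi => c * Psi lambda pb xi) u g in
  domU rbar pb z /\
  dot g (z - v) + c * Psi lambda pb z - c * Psi lambda pb v <=
  bregman (setup_omega s (n := n)) u v - bregman (setup_omega s (n := n)) z v
   - bregman (setup_omega s (n := n)) u z.
Proof.
move=> c0 v Dv; apply: (prox_three_point (setup_dgf s n)) => //.
- exact: domU_closed.
- exact: domU_convex.
- exact: Psi_continuous.
- exact: Psi_scale_convex.
- by move=> x _; rewrite mulr_ge0 ?Psi_ge0.
Qed.

Lemma setup_bregman0 s v : bregman (setup_omega s (n := n)) 0 v = setup_omega s v.
Proof. by rewrite /bregman setup_omega0 setup_grad0 !subr0. Qed.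

Lemma dgf_bregman_le0 m (om nrm : 'cV[R]_m -> R) (u v : 'cV[R]_m) :
  dgf om nrm -> bregman om u v <= 0 -> v = u.
Proof.
move=> hw h; have [c c0 cP] := dgf_coercive hw.
have h1 := dgf_strong hw u v; have h2 := cP (v - u).
apply/eqP; rewrite -subr_eq0 -normr_eq0 -sqrf_eq0 eq_le sqr_ge0 andbT.
by rewrite -(pmulr_rle0 _ c0); lra.
Qed.

(** Covers the step size 0 that arises when the operator norm is 0: with zero data the three-point
    inequality makes the divergence from x0 nonpositive. *)
Lemma prox_zero m (om nrm : 'cV[R]_m -> R) (D : set 'cV[R]_m) (P : 'cV[R]_m -> R) (x0 : 'cV[R]_m) :
  dgf om nrm -> closed D -> is_convex_set D -> D x0 ->
  prox om D (fun xi => 0 * P xi) x0 0 = x0.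
Proof.
move=> hw cD vD Du; rewrite (_ : (fun xi => _) = cst 0); last by apply/funext => x; rewrite mul0r.
have cc : continuous (cst 0 : 'cV[R]_m -> R) by move=> x; exact: cst_continuous.
have cv : is_convex_fun (cst 0 : 'cV[R]_m -> R) by move=> x z t _ /=; rewrite subrr mulr0 addr0.
have [_] := prox_three_point hw x0 0 cD vD cc cv (fun _ _ => lexx 0) Du.
rewrite dot0l bregman_id /= addr0 subr0 => h; apply: (dgf_bregman_le0 hw).
by have := bregman_ge0 hw (prox om D (cst 0) x0 0) x0; lra.
Qed.

End Domain.

(** * Fast Gradient Method *)

Section FastGradientWeights.
Context {R : realType}.

Definition fgm_weight (t : nat) : R := \sum_(s < t) fgm_a s.

Lemma fgm_weightE t : fgm_weight t = t%:R * (t%:R + 3) / 4.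
Proof.
rewrite /fgm_weight; elim: t => [|t IH]; first by rewrite big_ord0 mul0r mul0r.
by rewrite big_ord_recr /= IH /fgm_a -(natr1 t) -[in t.+2%:R](natr1 t.+1) -(natr1 t); by field.
Qed.

Lemma fgm_weightS t : fgm_weight t.+1 = fgm_weight t + fgm_a t.
Proof. by rewrite /fgm_weight big_ord_recr. Qed.

Lemma fgm_weight_ge0 t : 0 <= fgm_weight t.
Proof. by rewrite fgm_weightE !mulr_ge0// addr_ge0. Qed.

Lemma fgm_a_gt0 t : 0 < fgm_a t :> R.
Proof. by rewrite /fgm_a divr_gt0. Qed.

Lemma fgm_weightS_gt0 t : 0 < fgm_weight t.+1.
Proof. by rewrite fgm_weightS ltr_wpDl ?fgm_weight_ge0 ?fgm_a_gt0. Qed.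

(** The averaging coefficient is the share of the new weight in the total, which lets the linear
    terms combine in the estimate function. *)
Lemma fgm_tau_weight t : fgm_tau t * fgm_weight t.+1 = fgm_a t.
Proof.
rewrite /fgm_tau fgm_weightE /fgm_a -!(natr1 t.+3) -!(natr1 t.+2) -!(natr1 t.+1) -!(natr1 t).
have t0 : 0 <= t%:R :> R by [].
by field; rewrite !gt_eqF//; lra.
Qed.

(** This limits the growth of the weights, so that the strong convexity of the proximal term absorbs
    the smoothness error, which is proportional to tau^2. *)
Lemma fgm_weight_tau_sqr t : fgm_weight t.+1 * fgm_tau t ^+ 2 <= 1.
Proof.
have A0 := fgm_weightS_gt0 t.
rewrite expr2 mulrA (mulrC (fgm_weight _)) fgm_tau_weight.
rewrite -(ler_pM2r A0) -mulrA fgm_tau_weight mul1r fgm_weightE /fgm_a -!(natr1 t.+1) -!(natr1 t).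
have t0 : 0 <= t%:R :> R by [].
lra.
Qed.

Lemma fgm_tau_ge0 t : 0 <= fgm_tau t :> R.
Proof. by rewrite /fgm_tau divr_ge0 ?mulr_ge0. Qed.

Lemma fgm_tau_le1 t : fgm_tau t <= 1 :> R.
Proof.
have A0 := fgm_weightS_gt0 t.
by rewrite -(ler_pM2r A0) fgm_tau_weight mul1r fgm_weightS lerDr fgm_weight_ge0.
Qed.

End FastGradientWeights.

Section FastGradientAbstract.
Context {R : realType} (m : nat).
Notation V := 'cV[R]_m.
Variables (f P om nrm : V -> R) (gr : V -> V) (D : set V) (B : V -> V -> R) (px : R -> V -> V -> V) (L : R).
Hypotheses (L0 : 0 < L) (om0 : forall v, 0 <= om v) (B0 : forall v, B 0 v = om v).
Hypothesis B_strong : forall u v, 2^-1 * nrm (v - u) ^+ 2 <= B u v.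
Hypothesis nrmZ : forall a u, 0 <= a -> nrm (a *: u) = a * nrm u.
Hypothesis P_convex : is_convex_fun P.
Hypothesis pxP : forall c u g v, 0 <= c -> D v ->
  D (px c u g) /\ dot g (px c u g - v) + c * P (px c u g) - c * P v <=
                  B u v - B (px c u g) v - B u (px c u g).
Let lin x xi := f x + dot (gr x) (xi - x).
Hypothesis lin_le : forall x v, lin x v <= f v.
Hypothesis smooth : forall x v, f v <= lin x v + 2^-1 * L * nrm (v - x) ^+ 2.
Variables (U G : nat -> V).
Let eta := L^-1.
Let a t : R := fgm_a t.
Let A t : R := fgm_weight t.
Let tau t : R := fgm_tau t.
Let z0 t := px (eta * A t) 0 (eta *: G t).
Let x13 t := tau t *: z0 t + (1 - tau t) *: U t.
Let g t := a t *: gr (x13 t).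
Let z1 t := px (eta * a t) (z0 t) (eta *: g t).
Hypothesis U0 : U 0%N = 0.
Hypothesis G0 : G 0%N = 0.
Hypothesis US : forall t, U t.+1 = tau t *: z1 t + (1 - tau t) *: U t.
Hypothesis GS : forall t, G t.+1 = G t + g t.

(* Nesterov's estimate function: [a_s]-weighted linear minorants of the objective plus the proximal term. *)
Let psi t xi := eta * (\sum_(s < t) a s * lin (x13 s) xi) + eta * A t * P xi + om xi.

Let eta_gt0 : 0 < eta.
Proof. by rewrite invr_gt0. Qed.

Let GE t : G t = \sum_(s < t) g s.
Proof. by elim: t => [|t IH]; rewrite ?big_ord0// big_ord_recr /= -IH GS. Qed.

Let psi_sub t v z : psi t v - psi t z =
  dot (eta *: G t) (v - z) + eta * A t * (P v - P z) + (om v - om z).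
Proof.
rewrite /psi GE dotZl dot_suml.
have -> : \sum_(s < t) dot (g s) (v - z) = \sum_(s < t) a s * lin (x13 s) v - \sum_(s < t) a s * lin (x13 s) z.
  rewrite -sumrB; apply: eq_bigr => s _; rewrite /lin /g dotZl -mulrBr; congr (_ * _).
  by rewrite !dotBr; ring.
move: (\sum_(s < t) _) (\sum_(s < t) _) => X Y; ring.
Qed.

(** Scalar form of the inductive step: e l = 1 and A1 t^2 <= 1 reduce the smoothness error to N/2,
    where N is the squared norm of the proximal displacement. *)
Let step_arith (e A0 a0 A1 t fU fz fx PU Pz P' N l : R) :
  0 <= e -> A1 = A0 + a0 -> t * A1 = a0 -> A1 * t ^+ 2 <= 1 -> e * l = 1 -> 0 <= N ->
  fx <= t * fz + (1 - t) * fU + 2^-1 * l * (t ^+ 2 * N) ->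
  P' <= PU + t * (Pz - PU) -> 0 <= A1 ->
  e * A1 * (fx + P') <= e * A0 * (fU + PU) + e * a0 * (fz + Pz) + 2^-1 * N.
Proof.
move=> e0 AE tA tA2 el N0 h1 h2 A10.
have eA : 0 <= e * A1 by rewrite mulr_ge0.
have k1 := ler_wpM2l eA h1; have k2 := ler_wpM2l eA h2.
have k3 := ler_wpM2r N0 tA2.
have : e * A1 * (2^-1 * l * (t ^+ 2 * N)) = 2^-1 * (e * l) * (A1 * t ^+ 2 * N) by ring.
rewrite el => k4.
have k5 : e * A1 * (t * fz + (1 - t) * fU) = e * (t * A1) * fz + e * (A1 - t * A1) * fU by ring.
have k6 : e * A1 * (PU + t * (Pz - PU)) = e * (t * A1) * Pz + e * (A1 - t * A1) * PU by ring.
rewrite tA in k5 k6; have k7 : A1 - a0 = A0 by lra.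
rewrite k7 in k5 k6; lra.
Qed.

(** Induction on t. The point [z0 t] minimises [psi t] over D, with excess at least the divergence
    from [z0 t]. The second proximal step is regularised by this same divergence, whose strong
    convexity pays for the smoothness error at the averaged point. *)
Lemma fgm_estimate t v : D v -> eta * A t * (f (U t) + P (U t)) <= psi t v.
Proof.
have e0 := ltW eta_gt0.
elim: t v => [|t IH] v Dv.
  by rewrite /psi /A /fgm_weight !big_ord0 !mulr0 !mul0r add0r add0r.
have cA : 0 <= eta * A t by rewrite mulr_ge0 ?fgm_weight_ge0.
have ca : 0 <= eta * a t by rewrite mulr_ge0 ?(ltW (fgm_a_gt0 t)).
have [Dz0 h0] := pxP 0 (eta *: G t) cA Dv.
have [_ h1] := pxP (z0 t) (eta *: g t) ca Dv.
rewrite -/(z0 t) in h0 Dz0; rewrite -/(z1 t) in h1.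
rewrite !B0 in h0.
have e1 := psi_sub t v (z0 t).
have e2 := IH _ Dz0.
have e3 : psi t.+1 v = psi t v + eta * a t * (lin (x13 t) v + P v).
  rewrite /psi /A fgm_weightS big_ord_recr /= -/(a t).
  by move: (\sum_(s < t) _) (fgm_weight t) (a t) (lin _ _) (P v) (om v) => ? ? ? ? ? ?; ring.
have e4 : dot (eta *: g t) (z1 t - v) = eta * a t * (lin (x13 t) (z1 t) - lin (x13 t) v).
  by rewrite /lin /g !dotZl !dotBr; ring.
have e5 := B_strong (z0 t) (z1 t).
have e6 := smooth (x13 t) (U t.+1).
have UE := US t.
have dE : U t.+1 - x13 t = tau t *: (z1 t - z0 t).
  by rewrite UE /x13 opprD addrACA subrr addr0 -scalerBr.
rewrite dE (nrmZ _ (fgm_tau_ge0 t)) exprMn in e6.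
have e7 : lin (x13 t) (U t.+1) = tau t * lin (x13 t) (z1 t) + (1 - tau t) * lin (x13 t) (U t).
  by rewrite UE /lin !dotBr dotDr !dotZr; ring.
have t01 : 0 <= tau t <= 1 by rewrite fgm_tau_ge0 fgm_tau_le1.
have := P_convex (U t) (z1 t) t01.
rewrite (_ : U t + _ = U t.+1); last first.
  by rewrite UE scalerBr scalerBl scale1r addrCA addrA addrAC.
move=> e8.
have e9 := lin_le (x13 t) (U t).
rewrite e7 in e6.
have el : eta * L = 1 by rewrite mulVf// gt_eqF.
have e10 := step_arith e0 (fgm_weightS t) (fgm_tau_weight t) (fgm_weight_tau_sqr t) el (sqr_ge0 _) e6 e8 (fgm_weight_ge0 _).
have e11 : eta * A t * lin (x13 t) (U t) <= eta * A t * f (U t) by rewrite ler_wpM2l.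
have bz : 0 <= B (z1 t) v by apply: le_trans (B_strong _ _); rewrite mulr_ge0 ?invr_ge0 ?sqr_ge0.
rewrite e4 in h1; rewrite e3.
have e12 : dot (eta *: G t) (z0 t - v) = - dot (eta *: G t) (v - z0 t).
  by rewrite -dotNr opprB.
rewrite e12 in h0.
rewrite -/(A t) -/(A t.+1) -/(a t) in e10.
move: h0 h1 e1 e2 e5 e10 e11 bz; clear.
move: (psi t v) (psi t (z0 t)) (A t) (A t.+1) (a t) (lin _ v) (lin _ (U t)) (lin _ (z1 t)) (f _) (f _)
  (P (U t)) (P _) (P (z0 t)) (P (z1 t)) (P v) (dot _ _) (nrm _ ^+ 2) (B _ (z1 t)) (B (z1 t) v) (B (z0 t) v) (om v) (om (z0 t)) => *.
lra.
Qed.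

(** At u the linear minorants inside [psi] are bounded by f u, which leaves only [om u] as
    excess. *)
Lemma fgm_abstract_gap T u : (0 < T)%N -> D u ->
  f (U T) + P (U T) - (f u + P u) <= L * om u / A T.
Proof.
move=> T0 Du; have h := fgm_estimate T Du.
have A0 : 0 < A T by case: T T0 {h} => // T _; exact: fgm_weightS_gt0.
have h2 : psi T u <= eta * A T * (f u + P u) + om u.
  rewrite /psi mulrDr !lerD2r -mulrA ler_pM2l// /A /fgm_weight mulr_suml.
  by apply: ler_sum => s _; rewrite ler_wpM2l ?lin_le// ltW// fgm_a_gt0.
rewrite ler_pdivlMr// -(ler_pM2l eta_gt0) [leRHS](_ : _ = om u); last first.
  by rewrite mulrA mulVf ?mul1r// gt_eqF.
have := le_trans h h2; move: (f (U T) + _) (f u + _) (A T) => x z A1; lra.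
Qed.

End FastGradientAbstract.

Section FastGradient.
Context {R : realType} (n : nat) (y : signal R) (rbar lambda : R) (pb : problem) (su : prox_setup).
Hypotheses (rbar0 : 0 < rbar) (lambda0 : 0 <= lambda).
Implicit Types u v : 'cV[R]_(n.+1.*2).

Let A := Amx n y.
Let b := bvec n y.
Let f := fLS (n := n) y.
Let D := domU (n := n) rbar pb.
Let om := setup_omega (R := R) su (n := n).
Let nrm (u : 'cV[R]_(n.+1.*2)) := rcnorm (setup_index su)%:E u.
Let L := L_f n y su.

Lemma fLS_line u h (t : R) :
  f (u + t *: h) = f u + dot (A *m u - b) (A *m h) * t + 2^-1 * dot (A *m h) (A *m h) * t ^+ 2.
Proof.
rewrite /f /fLS -/A -/b mulmxDr -scalemxAr addrAC.
move: (A *m u - b) (A *m h) => p q.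
rewrite !(dotDl, dotDr, dotZl, dotZr) (dotC q p); by field.
Qed.

Lemma fLS_grad u h : dot (grad f u) h = dot (A *m u - b) (A *m h).
Proof.
symmetry; apply: (@grad_linear R _ f (fun u h => dot (A *m u - b) (A *m h))).
- move=> v k; apply: is_derive_line.
  rewrite (_ : (fun t => _) = (fun t => f v + dot (A *m v - b) (A *m k) * t + 2^-1 * dot (A *m k) (A *m k) * t ^+ 2)).
    by apply: is_derive_eq; rewrite /GRing.scale /=; ring.
  by apply/funext => t; rewrite fLS_line.
- by move=> v k k'; rewrite mulmxDr dotDr.
- by move=> v a k; rewrite -scalemxAr dotZr.
Qed.

Let fLS_lin x v : f v = f x + dot (grad f x) (v - x) + 2^-1 * dot (A *m (v - x)) (A *m (v - x)).
Proof.
have -> : f v = f (x + 1 *: (v - x)) by rewrite scale1r addrC subrK.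
by rewrite fLS_line fLS_grad expr1n !mulr1.
Qed.

Lemma fLS_convex x v : f x + dot (grad f x) (v - x) <= f v.
Proof. by rewrite (fLS_lin x v) lerDl mulr_ge0 ?dot_ge0// invr_ge0. Qed.

Lemma Amx_sqr_le_Lf u : dot (A *m u) (A *m u) <= L * nrm u ^+ 2.
Proof.
rewrite -rcnorm2_sqr /L /L_f -exprMn.
apply: lerXn2r; rewrite ?nnegrE ?rcnorm_ge0//.
  by rewrite mulr_ge0 ?rcnorm_ge0// (@calA_norm_ge0 R n y su su _ (or_introl erefl)).
exact: (@Amx_le_calA_norm R n y su su _ (or_introl erefl)).
Qed.

Lemma fLS_smooth x v : f v <= f x + dot (grad f x) (v - x) + 2^-1 * L * nrm (v - x) ^+ 2.
Proof. by rewrite (fLS_lin x v) lerD2l -mulrA ler_pM2l ?invr_gt0// Amx_sqr_le_Lf. Qed.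

Lemma L_f_ge0 : 0 <= L.
Proof. exact: sqr_ge0. Qed.

Let px (c : R) (u g : 'cV[R]_(n.+1.*2)) := prox om D (fun xi => c * Psi lambda pb xi) u g.

Let fgm_recursion t : fgm_state n y rbar lambda pb su t.+1 =
  let U := (fgm_state n y rbar lambda pb su t).1 in
  let G := (fgm_state n y rbar lambda pb su t).2 in
  let z0 := px (L^-1 * fgm_weight t) 0 (L^-1 *: G) in
  let g := fgm_a t *: grad f (fgm_tau t *: z0 + (1 - fgm_tau t) *: U) in
  (fgm_tau t *: px (L^-1 * fgm_a t) z0 (L^-1 *: g) + (1 - fgm_tau t) *: U, G + g).
Proof. by rewrite /fgm_state /=; case: (iteri t _ _). Qed.

Lemma fgm_gap_pos T us : 0 < L -> (0 < T)%N -> D us ->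
  f (fgm n y rbar lambda pb su T) + Psi lambda pb (fgm n y rbar lambda pb su T) - (f us + Psi lambda pb us)
  <= L * om us / fgm_weight T.
Proof.
move=> L0 T0 Dus.
apply: (@fgm_abstract_gap R _ f (Psi lambda pb) om nrm (grad f) D (bregman om) px L L0
  _ _ _ _ _ _ _ _ (fun t => (fgm_state n y rbar lambda pb su t).1) (fun t => (fgm_state n y rbar lambda pb su t).2)) => //.
- exact: setup_omega_ge0.
- exact: setup_bregman0.
- exact: (dgf_strong (setup_dgf su n)).
- by move=> a u; exact: rcnorm_setupZ.
- exact: Psi_convex.
- by move=> c u g v c0 Dv; exact: setup_prox.
- exact: fLS_convex.
- exact: fLS_smooth.
- by move=> t; rewrite fgm_recursion.
- by move=> t; rewrite fgm_recursion.
Qed.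

Let px_zero : px 0 0 0 = 0.
Proof. by apply: (prox_zero _ (setup_dgf su n)); [exact: domU_closed|exact: domU_convex|exact: domU0]. Qed.

Lemma fgm_zero T : L = 0 -> fgm n y rbar lambda pb su T = 0.
Proof.
move=> L0; rewrite /fgm; elim: T => [|t IH]; first by [].
by rewrite fgm_recursion /= IH L0 invr0 !mul0r !scale0r !px_zero !scaler0 addr0.
Qed.

(** The total weight T (T + 3) / 4 exceeds T^2 / 4. If L = 0, then A us = 0, and the iterates, which
    stay at 0, are no worse than us. *)
Lemma fgm_gap T us : is_LS pb -> (0 < T)%N -> D us ->
  objective y lambda pb (fgm n y rbar lambda pb su T) - objective y lambda pb us <=
  4 * L * om us / T%:R ^+ 2.
Proof.
move=> LS T0 Dus; rewrite /objective LS -/f.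
have T0' : 0 < T%:R :> R by rewrite ltr0n.
have om0 : 0 <= om us by exact: setup_omega_ge0.
have := L_f_ge0; rewrite le_eqVlt => /predU1P[/esym L0|L0].
  rewrite fgm_zero// L0 mulr0 mul0r mul0r Psi0 addr0.
  have Aus : A *m us = 0.
    by apply: dot_eq0; apply: le_trans (Amx_sqr_le_Lf us) _; rewrite L0 mul0r.
  by rewrite /f /fLS -/A Aus mulmx0 opprD addrA subrr sub0r oppr_le0 Psi_ge0.
apply: le_trans (fgm_gap_pos L0 T0 Dus) _.
rewrite ler_pdivrMr; last by rewrite fgm_weightE !mulr_gt0// addr_gt0.
rewrite fgm_weightE [leRHS]mulrAC ler_pdivlMr ?exprn_gt0//.
have := mulr_ge0 (mulr_ge0 (ltW L0) om0) (ltW T0').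
by move: (om us) (L) (T%:R) => o l t; lra.
Qed.

End FastGradient.

(** * Composite Mirror Prox *)

Section MirrorProxAbstract.
Context {R : realType} (M : nat).
Notation W := 'cV[R]_M.
Variables (F : W -> W) (P : W -> R) (B : W -> W -> R) (D : set W) (px : W -> W -> W) (eta : R).
Hypothesis pxP : forall u g v, D v ->
  D (px u g) /\ dot g (px u g - v) + eta * P (px u g) - eta * P v <= B u v - B (px u g) v - B u (px u g).
Hypothesis step : forall w z q, eta * dot (F z - F w) (z - q) <= B w z + B z q.
Variables (w : nat -> W).
Let h t := px (w t) (eta *: F (w t)).
Hypothesis wS : forall t, w t.+1 = px (w t) (eta *: F (h t)).

(** The three-point inequality of the half step is tested at [w t.+1], that of the full step at z.
    Their sum leaves the variation of F between [w t] and [h t], and [step] bounds it by exactly the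
    two divergences that the half step provides. *)
Lemma mirror_prox_regret T z : D z ->
  \sum_(s < T) (eta * (dot (F (h s)) (h s - z) + P (h s) - P z)) <= B (w 0%N) z - B (w T) z.
Proof.
move=> Dz; elim: T => [|t IH]; first by rewrite big_ord0 subrr.
rewrite big_ord_recr /=.
have [Dw h2] := pxP (w t) (eta *: F (h t)) Dz; rewrite -wS in Dw h2.
have [_ h1] := pxP (w t) (eta *: F (w t)) Dw; rewrite -/(h t) in h1.
have := step (w t) (h t) (w t.+1).
have e : dot (F (h t)) (h t - z) = dot (F (h t)) (h t - w t.+1) + dot (F (h t)) (w t.+1 - z).
  by rewrite -dotDr addrA subrK.
move: h1 h2 IH; rewrite e !dotZl dotBl; clear.
move: (\sum_(s < t) eta * (dot (F (h s)) (h s - z) + P (h s) - P z)).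
move: (dot (F (h t)) (h t - w t.+1)) (dot (F (w t)) (h t - w t.+1)) (dot (F (h t)) (w t.+1 - z)).
move: (P (h t)) (P (w t.+1)) (P z) (B (w 0%N) z) (B (w t) z) (B (w t.+1) z).
move: (B (w t) (w t.+1)) (B (h t) (w t.+1)) (B (w t) (h t)) => *; lra.
Qed.

End MirrorProxAbstract.

Opaque rcnorm setup_omega prox grad.

(** * The joint setup on U x V *)

Section Joint.
Context {R : realType} (n : nat) (su sv : prox_setup) (c1 c2 : R).
Hypotheses (c10 : 0 < c1) (c20 : 0 < c2).
Notation W := 'cV[R]_(n.+1.*2 + n.+1.*2).
Let omu := setup_omega (R := R) su (n := n).
Let omv := setup_omega (R := R) sv (n := n).

(** The form of [joint_omega] with arbitrary positive weights in place of the squared radii. *)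
Definition weighted_omega (w : W) : R := c1 * omu (usubmx w) + c2 * omv (dsubmx w).
Definition weighted_norm (w : W) : R :=
  Num.sqrt (c1 * rcnorm (setup_index su)%:E (usubmx w) ^+ 2 + c2 * rcnorm (setup_index sv)%:E (dsubmx w) ^+ 2).

Lemma is_derive_on_line m (f : 'cV[R]_m -> R) (u h : 'cV[R]_m) (l : R) :
  is_derive u h (f : 'cV[R]_m -> R^o) l -> is_derive (0 : R) 1 (fun t : R => f (u + t *: h)) l.
Proof.
have E : (fun t : R => t^-1 *: (((f : 'cV[R]_m -> R^o) \o shift u) (t *: h) - f u)) =
    (fun t : R => t^-1 *: (((fun t : R => f (u + t *: h)) \o shift 0) (t *: 1) - f (u + 0 *: h))).
  apply/funext => t; congr (_ *: _); rewrite /= scale0r addr0 [t *: 1]mulr1 addr0.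
  by rewrite (addrC u).
move=> [h1 h2]; split; first by rewrite /derivable -E.
by rewrite /derive -E.
Qed.

Let lform (w h : W) : R := c1 * dot (grad omu (usubmx w)) (usubmx h) + c2 * dot (grad omv (dsubmx w)) (dsubmx h).

Let weighted_derive w h : is_derive w h (weighted_omega : W -> R^o) (lform w h).
Proof.
apply: is_derive_line.
have d1 := is_derive_on_line (dgf_derive (setup_dgf su n) (usubmx w) (usubmx h)).
have d2 := is_derive_on_line (dgf_derive (setup_dgf sv n) (dsubmx w) (dsubmx h)).
rewrite (_ : (fun t => _) = (fun t : R => c1 * omu (usubmx w + t *: usubmx h) + c2 * omv (dsubmx w + t *: dsubmx h))).
  by apply: is_derive_eq; rewrite /GRing.scale /= /lform.
by apply/funext => t; rewrite /weighted_omega !linearD !linearZ.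
Qed.

Let usubB (z w : W) : usubmx (z - w) = usubmx z - usubmx w.
Proof. by rewrite linearB. Qed.

Let dsubB (z w : W) : dsubmx (z - w) = dsubmx z - dsubmx w.
Proof. by rewrite linearB. Qed.

Let usub_line (z w : W) t : usubmx (z + t *: (w - z)) = usubmx z + t *: (usubmx w - usubmx z).
Proof. by rewrite linearD linearZ linearB. Qed.

Let dsub_line (z w : W) t : dsubmx (z + t *: (w - z)) = dsubmx z + t *: (dsubmx w - dsubmx z).
Proof. by rewrite linearD linearZ linearB. Qed.

Lemma weighted_grad w h : dot (grad weighted_omega w) h = lform w h.
Proof.
symmetry; apply: (grad_linear weighted_derive).
- by move=> u k k'; rewrite /lform !linearD !dotDr; ring.
- by move=> u a k; rewrite /lform !linearZ !dotZr; ring.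
Qed.

Lemma weighted_bregman w z : bregman weighted_omega w z =
  c1 * bregman omu (usubmx w) (usubmx z) + c2 * bregman omv (dsubmx w) (dsubmx z).
Proof.
rewrite /bregman weighted_grad /lform usubB dsubB /weighted_omega.
move: (omu (usubmx w)) (omu (usubmx z)) (omv (dsubmx w)) (omv (dsubmx z)).
by move: (dot (grad omu _) _) (dot (grad omv _) _) => *; ring.
Qed.

Let usub_continuous : continuous (usubmx : W -> 'cV[R]_(n.+1.*2)).
Proof.
move=> x A /nbhs_ballP[e /= e0 xA]; apply/nbhs_ballP; exists e => // z [_ xz].
by apply: xA; split => // i j; rewrite !mxE; exact: xz.
Qed.

Let dsub_continuous : continuous (dsubmx : W -> 'cV[R]_(n.+1.*2)).
Proof.
move=> x A /nbhs_ballP[e /= e0 xA]; apply/nbhs_ballP; exists e => // z [_ xz].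
by apply: xA; split => // i j; rewrite !mxE; exact: xz.
Qed.

Let weighted_norm_arg_ge0 (a b : R) : 0 <= c1 * a ^+ 2 + c2 * b ^+ 2.
Proof. by rewrite addr_ge0// mulr_ge0 ?sqr_ge0// ltW. Qed.

Lemma weighted_norm_sqr w : weighted_norm w ^+ 2 =
  c1 * rcnorm (setup_index su)%:E (usubmx w) ^+ 2 + c2 * rcnorm (setup_index sv)%:E (dsubmx w) ^+ 2.
Proof. by rewrite /weighted_norm sqr_sqrtr. Qed.

Let half_sum (a b x z : R) : c1 * (2^-1 * a) <= x -> c2 * (2^-1 * b) <= z -> 2^-1 * (c1 * a + c2 * b) <= x + z.
Proof. by move=> *; lra. Qed.

Let sqr_mono (V : normedZmodType R) (x : V) (b : R) : `|x| <= b -> `|x| ^+ 2 <= b ^+ 2.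
Proof. by move=> xb; have b0 := le_trans (normr_ge0 x) xb; apply: (lerXn2r 2 _ _ xb); rewrite nnegrE. Qed.

Lemma weighted_dgf : dgf weighted_omega weighted_norm.
Proof.
split.
- by move=> w h; rewrite weighted_grad; exact: weighted_derive.
- move=> w z; rewrite weighted_bregman weighted_norm_sqr usubB dsubB.
  have h1 := ler_wpM2l (ltW c10) (dgf_strong (setup_dgf su n) (usubmx w) (usubmx z)).
  have h2 := ler_wpM2l (ltW c20) (dgf_strong (setup_dgf sv n) (dsubmx w) (dsubmx z)).
  exact: (half_sum h1 h2).
- move=> w; apply: (@cvgD R R^o _ (nbhs w) _ (fun w : W => c1 * omu (usubmx w)) (fun w : W => c2 * omv (dsubmx w))).
    apply: (@cvgM R _ (nbhs w) _ (cst c1) (omu \o usubmx)); first exact: cvg_cst.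
    by apply: continuous_comp; [exact: usub_continuous|exact: (dgf_cont (setup_dgf su n))].
  apply: (@cvgM R _ (nbhs w) _ (cst c2) (omv \o dsubmx)); first exact: cvg_cst.
  by apply: continuous_comp; [exact: dsub_continuous|exact: (dgf_cont (setup_dgf sv n))].
exists (Num.min c1 c2); first by rewrite lt_min c10.
move=> w; rewrite weighted_norm_sqr.
have hu := rcnorm_coord (usubmx w) (setup_index_gt0 su).
have hv := rcnorm_coord (dsubmx w) (setup_index_gt0 sv).
have hu2 : `|usubmx w| ^+ 2 <= rcnorm (setup_index su)%:E (usubmx w) ^+ 2 by exact: sqr_mono hu.
have hv2 : `|dsubmx w| ^+ 2 <= rcnorm (setup_index sv)%:E (dsubmx w) ^+ 2 by exact: sqr_mono hv.
have wm : `|w| <= Num.max `|usubmx w| `|dsubmx w|.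
  rewrite [leLHS]/Num.norm [leLHS]/= mx_normrE; apply/bigmax_leP; split.
    by rewrite le_max normr_ge0.
  move=> [i j] _ /=; rewrite ord1; case: (split_ordP i) => k ->.
    have -> : w (lshift _ k) 0 = usubmx w k 0 by rewrite mxE.
    rewrite le_max; apply/orP; left; exact: coord_le_norm.
  have -> : w (rshift _ k) 0 = dsubmx w k 0 by rewrite mxE.
    rewrite le_max; apply/orP; right; exact: coord_le_norm.
have wm2 : `|w| ^+ 2 <= `|usubmx w| ^+ 2 + `|dsubmx w| ^+ 2.
  apply: le_trans (_ : Num.max `|usubmx w| `|dsubmx w| ^+ 2 <= _).
    by apply: lerXn2r; rewrite ?nnegrE// le_max normr_ge0.
  move: `|usubmx w| `|dsubmx w| => a b.
  by case: (leP a b) => _; rewrite (lerDr, lerDl) sqr_ge0.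
have m0 : 0 <= Num.min c1 c2 by rewrite le_min !ltW.
apply: le_trans (ler_wpM2l m0 wm2) _; rewrite mulrDr; apply: lerD.
  have m1 : Num.min c1 c2 <= c1 by rewrite ge_min lexx.
  exact: (le_trans (ler_wpM2r (sqr_ge0 _) m1) (ler_wpM2l (ltW c10) hu2)).
have m2 : Num.min c1 c2 <= c2 by rewrite ge_min lexx orbT.
exact: (le_trans (ler_wpM2r (sqr_ge0 _) m2) (ler_wpM2l (ltW c20) hv2)).
Qed.

Lemma weighted_strong w z :
  2^-1 * (c1 * rcnorm (setup_index su)%:E (usubmx z - usubmx w) ^+ 2 +
          c2 * rcnorm (setup_index sv)%:E (dsubmx z - dsubmx w) ^+ 2) <= bregman weighted_omega w z.
Proof. by have := dgf_strong weighted_dgf w z; rewrite weighted_norm_sqr usubB dsubB. Qed.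

Variables (rbar : R) (pb : problem).
Hypothesis rbar0 : 0 < rbar.

Lemma domW_closed : closed (domW (n := n) rbar pb).
Proof.
rewrite (_ : domW _ _ = (usubmx @^-1` domU rbar pb) `&` (dsubmx @^-1` domV (n := n)))//.
apply: closedI.
  by apply: (@preimage_closed _ _ usubmx); [move=> x _; exact: usub_continuous|exact: domU_closed].
by apply: (@preimage_closed _ _ dsubmx); [move=> x _; exact: dsub_continuous|exact: domV_closed].
Qed.

Lemma domW_convex : is_convex_set (domW (n := n) rbar pb).
Proof.
move=> u v t [u1 u2] [v1 v2] t01; split; rewrite (usub_line, dsub_line).
  by apply: domU_convex.
by apply: domV_convex.
Qed.

Lemma domW0 : domW (n := n) rbar pb 0.
Proof. by split; rewrite linear0; [exact: domU0|exact: domV0]. Qed.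

Variable lambda : R.
Hypothesis lambda0 : 0 <= lambda.

Lemma weighted_prox eta w g z : 0 <= eta -> domW rbar pb z ->
  let p := prox weighted_omega (domW rbar pb) (fun w => eta * Psi lambda pb (usubmx w)) w g in
  domW rbar pb p /\
  dot g (p - z) + eta * Psi lambda pb (usubmx p) - eta * Psi lambda pb (usubmx z) <=
  bregman weighted_omega w z - bregman weighted_omega p z - bregman weighted_omega w p.
Proof.
move=> eta0 Dz.
have cP : continuous (fun w : W => eta * Psi lambda pb (usubmx w)).
  move=> x; apply: (@continuous_comp _ _ _ usubmx (fun u => eta * Psi lambda pb u)); first exact: usub_continuous.
  exact: Psi_continuous.
have vP : is_convex_fun (fun w : W => eta * Psi lambda pb (usubmx w)).
  move=> x v t t01; rewrite usub_line; exact: (Psi_scale_convex pb lambda0 eta0 _ _ t01).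
have pP (x : W) : domW rbar pb x -> 0 <= eta * Psi lambda pb (usubmx x).
  by move=> _; rewrite mulr_ge0 ?Psi_ge0.
exact: (prox_three_point weighted_dgf w g domW_closed domW_convex cP vP pP Dz).
Qed.

End Joint.

Section MirrorProx.
Context {R : realType} (n : nat) (y : signal R) (rbar lambda : R) (pb : problem) (su sv : prox_setup).
Variable us : 'cV[R]_(n.+1.*2).
Hypotheses (rbar0 : 0 < rbar) (lambda0 : 0 <= lambda).
Notation W := 'cV[R]_(n.+1.*2 + n.+1.*2).
Let A := Amx n y.
Let b := bvec n y.
Let RV : R := radiusV n sv.
Let RU : R := radiusU_star rbar pb su us.
Let L : R := L_F n y su sv.
Let nu (u : 'cV[R]_(n.+1.*2)) := rcnorm (setup_index su)%:E u.
Let nv (u : 'cV[R]_(n.+1.*2)) := rcnorm (setup_index sv)%:E u.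
Hypotheses (RV0 : 0 < RV) (RU0 : 0 < RU).
Hypothesis RV_ub : forall v : 'cV[R]_(n.+1.*2), domV v -> 2 * setup_omega sv v <= RV ^+ 2.
Hypothesis RU_ub : 2 * setup_omega su us <= RU ^+ 2.
Hypothesis Dus : domU rbar pb us.

Let RV20 : 0 < RV ^+ 2. Proof. exact: exprn_gt0. Qed.
Let RU20 : 0 < RU ^+ 2. Proof. exact: exprn_gt0. Qed.
Let om : W -> R := weighted_omega su sv (RV ^+ 2) (RU ^+ 2).
Let eta : R := cmp_eta y rbar pb su sv us.

Lemma L_F_ge0 : 0 <= L.
Proof. exact: (@calA_norm_ge0 R n y su sv _ (or_intror erefl)). Qed.

Let eta_ge0 : 0 <= eta.
Proof. by rewrite /eta /cmp_eta divr_ge0 ?L_F_ge0// mulr_ge0// ltW. Qed.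

(** Equality fails only for L = 0, where the quotient defining [eta] is 0. *)
Let eta_L : eta * L <= RU * RV.
Proof.
rewrite /eta /cmp_eta -/L -/RU -/RV; have [->|L0] := eqVneq L 0.
  by rewrite mulr0 mulr_ge0// ltW.
by rewrite divfK.
Qed.

Let coupling u v : dot v (A *m u) <= L * (nv v * nu u).
Proof.
apply: le_trans (dot_le_dual sv v (A *m u)) _.
rewrite mulrCA; apply: ler_wpM2l; first exact: rcnorm_ge0.
exact: (@Amx_le_calA_norm R n y su sv _ (or_intror erefl)).
Qed.

Let dot_split (w z : W) : dot w z = dot (usubmx w) (usubmx z) + dot (dsubmx w) (dsubmx z).
Proof. by rewrite /dot big_split_ord /=; congr (_ + _); apply: eq_bigr => i _; rewrite !mxE. Qed.

Let Fop_dot (w z q : W) : dot (Fop y w - Fop y z) q =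
  dot (dsubmx w - dsubmx z) (A *m usubmx q) - dot (dsubmx q) (A *m (usubmx w - usubmx z)).
Proof.
rewrite dot_split !linearB /= /Fop !col_mxKu !col_mxKd -mulmxBr -dot_trmx.
congr (_ + _); rewrite dotC -dotNr; congr dot.
by rewrite -opprD; congr (- _); rewrite opprB addrA subrK.
Qed.

(** Young's inequality with weights r and s. It explains the step size: RU RV / L is what balances
    the bilinear coupling against the two blocks of the joint norm. *)
Let young (e l r s a b' c d : R) : 0 <= a * b' -> 0 <= c * d -> e * l <= r * s -> 
  e * l * (a * b' + c * d) <= 2^-1 * (s ^+ 2 * d ^+ 2 + r ^+ 2 * a ^+ 2) + 2^-1 * (s ^+ 2 * b' ^+ 2 + r ^+ 2 * c ^+ 2).
Proof.
move=> ab cd el; apply: le_trans (ler_wpM2r (addr_ge0 ab cd) el) _.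
have := sqr_ge0 (r * a - s * b'); have := sqr_ge0 (r * c - s * d); nra.
Qed.

Let step (w z q : W) : eta * dot (Fop y z - Fop y w) (z - q) <= bregman om w z + bregman om z q.
Proof.
have s1 := @weighted_strong R n su sv _ _ RV20 RU20 w z.
have s2 := @weighted_strong R n su sv _ _ RV20 RU20 z q.
apply: le_trans (lerD s1 s2); clear s1 s2.
rewrite Fop_dot (_ : usubmx (z - q) = usubmx z - usubmx q); last by rewrite linearB.
rewrite (_ : dsubmx (z - q) = dsubmx z - dsubmx q); last by rewrite linearB.
rewrite -/(nu _) -/(nv _) -/(nu _) -/(nv _).
set xu := usubmx z - usubmx w; set xv := dsubmx z - dsubmx w.
set qu := usubmx q - usubmx z; set qv := dsubmx q - dsubmx z.
have qE : usubmx z - usubmx q = - qu by rewrite opprB.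
have qE' : dsubmx z - dsubmx q = - qv by rewrite opprB.
rewrite qE qE' mulmxN dotNr dotNl opprK.
have c1 := coupling (- qu) xv; have c2 := coupling xu qv.
rewrite mulmxN dotNr /nu rcnormN -/(nu _) in c1; rewrite -/(nu _) in c2.
have h : - dot xv (A *m qu) + dot qv (A *m xu) <= L * (nv xv * nu qu + nv qv * nu xu).
  by rewrite (mulrDr L); exact: (lerD c1 c2).
apply: le_trans (ler_wpM2l eta_ge0 h) _; rewrite mulrA.
have n1 : 0 <= nv xv * nu qu by rewrite mulr_ge0 ?rcnorm_ge0.
have n2 : 0 <= nv qv * nu xu by rewrite mulr_ge0 ?rcnorm_ge0.
exact: (young n1 n2 eta_L).
Qed.

Let w_ t : W := cmp_w y rbar lambda pb su sv us t.
Let h_ t : W := cmp_half y rbar lambda pb su sv us (w_ t).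

Let regret T z : domW rbar pb z ->
  \sum_(s < T) (eta * (dot (Fop y (h_ s)) (h_ s - z) + Psi lambda pb (usubmx (h_ s)) - Psi lambda pb (usubmx z)))
  <= bregman om (w_ 0%N) z - bregman om (w_ T) z.
Proof.
move=> Dz.
have pxP w g v : domW rbar pb v ->
  let p := prox om (domW rbar pb) (fun w => eta * Psi lambda pb (usubmx w)) w g in
  domW rbar pb p /\
  dot g (p - v) + eta * Psi lambda pb (usubmx p) - eta * Psi lambda pb (usubmx v) <=
  bregman om w v - bregman om p v - bregman om w p.
  exact: (@weighted_prox R n su sv _ _ RV20 RU20 rbar pb lambda lambda0 eta w g v eta_ge0).
exact: (@mirror_prox_regret R _ (Fop y) (fun w => Psi lambda pb (usubmx w)) (bregman om) (domW rbar pb)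
  (fun w g => prox om (domW rbar pb) (fun w => eta * Psi lambda pb (usubmx w)) w g) eta pxP step w_ (fun=> erefl) T z Dz).
Qed.

Let h_dom t : domW rbar pb (h_ t).
Proof.
have [h _] := @weighted_prox R n su sv _ _ RV20 RU20 rbar pb lambda lambda0 eta (w_ t) (eta *: Fop y (w_ t)) 0 eta_ge0 (@domW0 R n rbar pb rbar0).
exact: h.
Qed.

Let om_bregman0 z : bregman om 0 z = om z.
Proof.
by rewrite /om weighted_bregman !linear0 !setup_bregman0.
Qed.

(** F is affine with skew-symmetric linear part, so the terms quadratic in h cancel and the regret
    against (us, v) is a gap of the saddle function. *)
Let gain (h : W) v : dot (Fop y h) (h - col_mx us v) =
  dot v (A *m usubmx h - b) - dot (dsubmx h) (A *m us - b).
Proof.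
rewrite dot_split !linearB /= col_mxKu col_mxKd /Fop col_mxKu col_mxKd -dot_trmx.
rewrite -/A mulmxBr /b; move: (A *m usubmx h) (A *m us) (dsubmx h) (bvec n y) => p q s' c.
rewrite !(dotBl, dotBr, dotNl) (dotC p s') (dotC p v) (dotC c s') (dotC c v); ring.
Qed.

Let sumU T := \sum_(s < T) usubmx (h_ s).
Let sumV T := \sum_(s < T) dsubmx (h_ s).

Let cmpE T : cmp y rbar lambda pb su sv us T = T%:R^-1 *: sumU T.
Proof. by rewrite /cmp /cmp_average linearZ linear_sum. Qed.

Let rcnorm1_sum T (F : nat -> 'cV[R]_(n.+1.*2)) : rcnorm 1%:E (\sum_(s < T) F s) <= \sum_(s < T) rcnorm 1%:E (F s).
Proof.
elim: T => [|T IH]; first by rewrite !big_ord0 rcnorm1_0.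
by rewrite !big_ord_recr /=; apply: le_trans (rcnorm1D _ _) _; rewrite lerD2r.
Qed.

Let Psi_sum T (F : nat -> 'cV[R]_(n.+1.*2)) : Psi lambda pb (\sum_(s < T) F s) <= \sum_(s < T) Psi lambda pb (F s).
Proof.
elim: T => [|T IH]; first by rewrite !big_ord0 Psi0.
by rewrite !big_ord_recr /=; apply: le_trans (PsiD pb lambda0 _ _) _; rewrite lerD2r.
Qed.

Let sumV_dom T : (0 < T)%N -> domV (T%:R^-1 *: sumV T).
Proof.
move=> T0; have T0' : 0 < T%:R :> R by rewrite ltr0n.
have TV : 0 <= T%:R^-1 :> R by rewrite invr_ge0 ltW.
rewrite /domV /mkset (rcnorm1Z _ TV) mulrC ler_pdivrMr// mul1r.
apply: le_trans (rcnorm1_sum T (fun s => dsubmx (h_ s))) _.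
rewrite -[leRHS](_ : \sum_(s < T) 1 = _); last by rewrite sumr_const card_ord.
by apply: ler_sum => s _; have [] := h_dom s.
Qed.

Let averaging (t X Y S Q Z O B : R) : 0 < t -> X - Y + S - t * O <= B -> Y <= t * Z -> Q <= S ->
  t^-1 * X + t^-1 * Q <= Z + O + B / t.
Proof.
move=> t0 h1 h2 h3; rewrite -(ler_pM2l t0) !mulrDr !mulrA mulfV ?gt_eqF// !mul1r.
by rewrite mulrAC mulfV ?gt_eqF// mul1r; lra.
Qed.

(** Averaged regret against (us, v) for an arbitrary v. The averaged dual iterate lies in V, so its
    pairing with A us - b is at most the residual at us. *)
Let saddle T v : (0 < T)%N -> 0 < L -> domV v ->
  dot v (A *m cmp y rbar lambda pb su sv us T - b) + Psi lambda pb (cmp y rbar lambda pb su sv us T)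
  <= rcnorm +oo%E (A *m us - b) + Psi lambda pb us + L * (RU * RV) / T%:R.
Proof.
move=> T0 L0 Vv; have T0' : 0 < T%:R :> R by rewrite ltr0n.
have TV : 0 <= T%:R^-1 :> R by rewrite invr_ge0 ltW.
have Dz : domW rbar pb (col_mx us v) by split; rewrite ?col_mxKu ?col_mxKd.
have r := regret T Dz.
have w00 : w_ 0%N = 0 by [].
rewrite w00 om_bregman0 in r.
have bT := bregman_ge0 (@weighted_dgf R n su sv _ _ RV20 RU20) (w_ T) (col_mx us v).
rewrite -/om in bT.
(* Each of the two weighted terms contributes at most half of the product, by the definition of the
   radii. *)
have omz : om (col_mx us v) <= RV ^+ 2 * RU ^+ 2.
  rewrite /om /weighted_omega col_mxKu col_mxKd.
  have h1 := ler_wpM2l (ltW RV20) RU_ub; have h2 := ler_wpM2l (ltW RU20) (RV_ub Vv).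
  move: h1 h2; move: (setup_omega _ _) (setup_omega _ _) (RV ^+ 2) (RU ^+ 2) => *; lra.
have sE : \sum_(s < T) (eta * (dot (Fop y (h_ s)) (h_ s - col_mx us v) + Psi lambda pb (usubmx (h_ s)) - Psi lambda pb (usubmx (col_mx us v)))) =
   eta * (dot v (A *m sumU T - T%:R *: b) - dot (sumV T) (A *m us - b) + \sum_(s < T) Psi lambda pb (usubmx (h_ s)) - T%:R * Psi lambda pb us).
  have S1 : \sum_(s < T) dot (Fop y (h_ s)) (h_ s - col_mx us v) = dot v (A *m sumU T - T%:R *: b) - dot (sumV T) (A *m us - b).
    under eq_bigr do rewrite gain.
    rewrite sumrB dot_suml; congr (_ - _).
    under eq_bigr do rewrite dotBr.
    rewrite sumrB sumr_const card_ord -[_ *+ T]mulr_natl dotBr dotZr; congr (_ - _).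
    by rewrite mulmx_sumr dotC dot_suml; apply: eq_bigr => s _; rewrite dotC.
  have S2 : \sum_(s < T) - Psi lambda pb us = - (T%:R * Psi lambda pb us).
    by rewrite sumrN sumr_const card_ord -[_ *+ T]mulr_natl.
  by rewrite -mulr_sumr big_split big_split col_mxKu S1 S2.
rewrite sE in r.
have pS := Psi_sum T (fun s => usubmx (h_ s)).
have pU : Psi lambda pb (cmp y rbar lambda pb su sv us T) = T%:R^-1 * Psi lambda pb (sumU T).
  by rewrite cmpE PsiZ.
have dV : dot (sumV T) (A *m us - b) <= T%:R * rcnorm +oo%E (A *m us - b).
  have := dot_le1y (T%:R^-1 *: sumV T) (A *m us - b); rewrite dotZl => h.
  rewrite -(ler_pdivrMl _ _ T0'); apply: le_trans h _.
  by apply: ler_piMl; [exact: rcnorm_ge0|exact: sumV_dom T0].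
have etaE : eta = RU * RV / L by [].
have cE : dot v (A *m cmp y rbar lambda pb su sv us T - b) = T%:R^-1 * dot v (A *m sumU T - T%:R *: b).
  by rewrite cmpE -scalemxAr -dotZr scalerBr scalerA mulVf ?gt_eqF// scale1r.
rewrite cE pU; rewrite -/(sumU T) in pS.
set X := dot v _ in r *; set Y := dot (sumV T) _ in r dV; set S := \sum_(s < T) _ in r pS.
set Z := rcnorm _ _ in dV *; set Q := Psi lambda pb (sumU T) in pS *; set O := Psi lambda pb us in r *.
have r2 : eta * (X - Y + S - T%:R * O) <= RV ^+ 2 * RU ^+ 2 by apply: le_trans r _; apply: le_trans omz; rewrite lerBlDr lerDl.
have r3 : X - Y + S - T%:R * O <= L * (RU * RV).
  have RR : 0 < RU * RV by rewrite mulr_gt0.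
  rewrite etaE mulrAC ler_pdivrMr// in r2.
  rewrite -(ler_pM2l RR); apply: le_trans r2 _.
  by rewrite le_eqVlt; apply/orP; left; apply/eqP; ring.
exact: (averaging T0' r3 dV pS).
Qed.

Lemma cmp_zero T : L = 0 -> cmp y rbar lambda pb su sv us T = 0.
Proof.
move=> L0; have e0 : eta = 0 by rewrite /eta /cmp_eta -/L L0 invr0 mulr0.
have px0 : cmp_prox y rbar lambda pb su sv us 0 0 = 0.
  rewrite /cmp_prox -/eta e0.
  exact: (prox_zero _ (@weighted_dgf R n su sv _ _ RV20 RU20) (@domW_closed R n rbar pb) (@domW_convex R n rbar pb) (@domW0 R n rbar pb rbar0)).
have w0 t : w_ t = 0.
  elim: t => [|t IH]; first by [].
  by rewrite /w_ /cmp_w iterS -/(cmp_w _ _ _ _ _ _ _ t) -/(w_ t) IH /cmp_step -/eta e0 scale0r px0.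
rewrite cmpE /sumU big1 ?scaler0// => s _.
by rewrite /h_ w0 /cmp_half -/eta e0 scale0r px0 linear0.
Qed.

Lemma cmp_gap T : ~~ is_LS pb -> (0 < T)%N ->
  objective y lambda pb (cmp y rbar lambda pb su sv us T) - objective y lambda pb us <= L * (RU * RV) / T%:R.
Proof.
move=> UF T0; rewrite !(objective_UF y lambda _ UF) -/A -/b.
have := L_F_ge0; rewrite le_eqVlt => /predU1P[/esym L0|L0].
  rewrite cmp_zero// L0 !mul0r Psi0 addr0 mulmx0 sub0r.
  have Aus : A *m us = 0.
    apply: dot_eq0; have := coupling us (A *m us); by rewrite L0 mul0r.
  by rewrite Aus sub0r opprD addrA subrr sub0r oppr_le0 Psi_ge0.
rewrite lerBlDr addrC -(sup_dot_domV (A *m cmp y rbar lambda pb su sv us T - b)).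
rewrite -lerBrDl; apply: ge_sup; first by exists (dot 0 (A *m cmp y rbar lambda pb su sv us T - b)); exists 0 => //; exact: domV0.
move=> _ [v Vv <-]; rewrite lerBrDl addrC [leRHS]addrC; exact: saddle.
Qed.

End MirrorProx.

Transparent rcnorm setup_omega prox grad.

(** * Radii and the number of iterations *)

(** Passes from the extended-real radius to a real number on sets where [om] is bounded, keeping
    both the upper bound and the domination of [om]. *)
Lemma omega_radius_bounded {R : realType} m (om : 'cV[R]_m -> R) (S : set 'cV[R]_m) (c : R) :
  S !=set0 -> om 0 = 0 -> (forall u, S u -> 0 <= om u) -> (forall u, S u -> 2 * om u <= c) ->
  exists2 rho, omega_radius om S = rho%:E &
    [/\ 0 <= rho, rho ^+ 2 <= c & forall u, S u -> 2 * om u <= rho ^+ 2].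
Proof.
move=> [u0 Su0] om0 omp omc; pose E := [set om u | u in S].
have Eub : has_ubound E.
  by exists (c / 2) => _ [u Su <-]; rewrite ler_pdivlMr// mulrC; exact: omc.
have supE : ereal_sup [set (om u - om 0)%:E | u in S] = (sup E)%:E.
  rewrite -ereal_sup_EFin//; last by exists (om u0); exists u0.
  by rewrite -image_comp; congr (ereal_sup (_ @` _)); apply: eq_imagel => u Su; rewrite om0 subr0.
have le_sup u : S u -> om u <= sup E by move=> Su; apply: ub_le_sup => //; exists u.
have s0 : 0 <= 2 * sup E by rewrite mulr_ge0//; exact: le_trans (omp _ Su0) (le_sup _ Su0).
exists (Num.sqrt (2 * sup E)); first by rewrite /omega_radius supE -EFinM poweR_EFin powR12_sqrt.
split; first exact: sqrtr_ge0.
- rewrite sqr_sqrtr// mulrC -ler_pdivlMr//; apply: ge_sup; first by exists (om u0); exists u0.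
  by move=> _ [u Su <-]; rewrite ler_pdivlMr// mulrC; exact: omc.
- by move=> u Su; rewrite sqr_sqrtr// ler_pM2l//; exact: le_sup.
Qed.

Lemma omega_radius_mono {R : realType} m (om : 'cV[R]_m -> R) (S S' : set 'cV[R]_m) :
  om 0 = 0 -> (forall u, 0 <= om u) -> S !=set0 -> S `<=` S' -> (omega_radius om S <= omega_radius om S')%E.
Proof.
move=> om0 omp [u Su] SS'.
have p (X : set 'cV[R]_m) : X u -> (0 <= 2%:E * ereal_sup [set (om v - om 0)%:E | v in X])%E.
  move=> Xu; apply: mule_ge0 => //; apply: (@le_trans _ _ (om u - om 0)%:E).
    by rewrite om0 subr0 lee_fin.
  by apply: ereal_sup_ubound; exists u.
apply: gt0_ler_poweR; rewrite ?in_itv /= ?leey ?andbT ?p//; first exact: SS'.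
by apply: lee_wpmul2l => //; apply: ereal_sup_le => _ [v Sv <-]; exists v => //; exact: SS'.
Qed.

Section Radii.
Context {R : realType} (n : nat) (rbar : R) (pb : problem) (su sv : prox_setup).
Hypotheses (n1 : (1 <= n)%N) (rbar0 : 0 < rbar).
Let K : R := 9 * (ln n%:R + 1).

Lemma setup_factor_ge1 : 1 <= K.
Proof.
have l0 : 0 <= ln n%:R :> R by rewrite ln_ge0// ler1n.
by rewrite /K; lra.
Qed.

Lemma setup_omega_gt0 s (u : 'cV[R]_(n.+1.*2)) : u != 0 -> 0 < setup_omega s u.
Proof.
move=> u0; rewrite -(setup_bregman0 s u).
apply: lt_le_trans (dgf_strong (setup_dgf s n) 0 u); rewrite subr0 mulr_gt0// exprn_gt0//.
by apply: lt_le_trans (rcnorm_coord u (setup_index_gt0 s)); rewrite normr_gt0.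
Qed.

Lemma radiusV_spec :
  [/\ 0 < radiusV (R := R) n sv, radiusV n sv ^+ 2 <= K &
      forall v : 'cV[R]_(n.+1.*2), domV v -> 2 * setup_omega sv v <= radiusV n sv ^+ 2].
Proof.
have V0 : domV (0 : 'cV[R]_(n.+1.*2)) by exact: domV0.
have [||||rho rE [rho0 rhoK rhoV]] := @omega_radius_bounded R _ (setup_omega sv (n := n)) (domV (n := n)) K.
- by exists 0.
- exact: setup_omega0.
- by move=> u _; exact: setup_omega_ge0.
- move=> u Vu; apply: le_trans (setup_omega_le sv u n1) _.
  rewrite -/K -[leRHS]mulr1; apply: ler_wpM2l; first by apply: le_trans setup_factor_ge1.
  by rewrite exprn_ile1 ?rcnorm_ge0.
rewrite /radiusV rE /=; split=> //.
(* Positivity of the radius needs a nonzero point of V: any nonzero vector, rescaled to l1-norm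
   1. *)
have [e ed] : exists e : 'cV[R]_(n.+1.*2), e != 0.
  exists (const_mx 1); apply/eqP => /matrixP /(_ ord0 0); rewrite !mxE => /eqP; by rewrite oner_eq0.
have ne : 0 < rcnorm 1%:E e.
  by apply: lt_le_trans (rcnorm_coord e (ltr01 : 0 < 1)); rewrite normr_gt0.
pose v := (rcnorm 1%:E e)^-1 *: e.
have cV : 0 <= (rcnorm 1%:E e)^-1 by rewrite invr_ge0 ltW.
have Vv : domV v by rewrite /domV /mkset /v (rcnorm1Z _ cV) mulVf// gt_eqF.
have v0 : v != 0 by rewrite scaler_eq0 negb_or invr_eq0 gt_eqF.
rewrite lt_neqAle rho0 andbT eq_sym; apply/eqP => r0.
have := rhoV _ Vv; rewrite r0 expr0n /=; apply/negP; rewrite -ltNge.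
by rewrite mulr_gt0// setup_omega_gt0.
Qed.

(** The segment lies in U by convexity, hence has the smaller radius even when Omega[U] is infinite.
    By homogeneity omega is at most its value at us on the segment, which brings in the l1-norm of
    us. *)
Lemma radiusU_spec (us : 'cV[R]_(n.+1.*2)) : domU rbar pb us -> us != 0 ->
  [/\ 0 < radiusU_star rbar pb su us, radiusU_star rbar pb su us ^+ 2 <= K * rcnorm 1%:E us ^+ 2 &
      2 * setup_omega su us <= radiusU_star rbar pb su us ^+ 2].
Proof.
move=> Dus us0; have S0 : segment0 us 0 by exists 0; rewrite ?scale0r//= lexx ler01.
have S1 : segment0 us us by exists 1; rewrite ?scale1r//= lexx ler01.
have [||||rho rE [rho0 rhoK rhoV]] := @omega_radius_bounded R _ (setup_omega su (n := n)) (segment0 us) (K * rcnorm 1%:E us ^+ 2).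
- by exists 0.
- exact: setup_omega0.
- by move=> u _; exact: setup_omega_ge0.
- move=> _ [s /= /andP[s0 s1] <-]; rewrite setup_omegaZ mulrCA.
  apply: le_trans (setup_omega_le su us n1); rewrite -[leRHS]mul1r; apply: ler_wpM2r.
    by rewrite mulr_ge0// setup_omega_ge0.
  by rewrite exprn_ile1.
have sub : segment0 us `<=` domU rbar pb.
  move=> _ [s /= s01 <-]; have := domU_convex (domU0 n pb rbar0) Dus s01.
  by rewrite subr0 add0r.
have mono := omega_radius_mono (setup_omega0 su n) (@setup_omega_ge0 R su n) (ex_intro _ _ S0) sub.
rewrite /radiusU_star (min_idPr mono) rE /=; split=> //; last exact: rhoV.
rewrite lt_neqAle rho0 andbT eq_sym; apply/eqP => r0.
have := rhoV _ S1; rewrite r0 expr0n /=; apply/negP; rewrite -ltNge.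
by rewrite mulr_gt0// setup_omega_gt0.
Qed.

End Radii.

Lemma least_threshold {R : realType} (n : nat) (y : signal R) rbar lambda pb eps u T0 :
  accurate_from (n := n) y rbar lambda pb eps u T0 ->
  exists2 Ts, is_Tstar y rbar lambda pb eps u Ts & (Ts <= T0)%N.
Proof.
move=> h; pose P k := `[< accurate_from y rbar lambda pb eps u k >].
have exP : exists k, P k by exists T0; apply/asboolP.
exists (ex_minn exP).
  split; first by case: ex_minnP => k /asboolP.
  by case: ex_minnP => k _ kmin T1 /asboolP; exact: kmin.
by case: ex_minnP => k _ kmin; apply: kmin; apply/asboolP.
Qed.

(** * Comparison of the rates with the target accuracy *)

Section Threshold.
Context {R : realType}.

(** Read N1 = 2n + 1, N2 = n + 1, s the spectral sup-norm, N the l1-norm of the solution, t the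
    iteration count. The rate has numerator at most 2 N1 s^2 K N^2, and (2 K s)^2 >= 4 K s^2 because
    K >= 1. *)
Lemma fgm_arith (N1 N2 s K N om L t sigma : R) : 0 <= N1 -> N1 <= 2 * N2 -> 0 <= s -> 1 <= K -> 0 <= N ->
  0 <= om -> 0 <= L -> L <= N1 * s ^+ 2 -> 2 * om <= K * N ^+ 2 -> 0 < sigma -> 0 < t -> 2 * K * s <= sigma * t ->
  4 * L * om / t ^+ 2 <= sigma ^+ 2 * (N2 * N ^+ 2).
Proof.
move=> N10 N12 s0 K1 N0 om0 L0 LM omK sg0 t0 Bt.
rewrite ler_pdivrMr ?exprn_gt0//.
have a1 : 4 * L * om <= 2 * (N1 * s ^+ 2) * (K * N ^+ 2).
  rewrite (_ : 4 * L * om = 2 * L * (2 * om)); last by ring.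
  apply: ler_pM => //; rewrite ?mulr_ge0//.
  by rewrite ler_pM2l.
apply: le_trans a1 _.
have KsN : 0 <= K * s ^+ 2 * N ^+ 2 by rewrite !mulr_ge0 ?sqr_ge0//; lra.
have a2 : 4 * K * s ^+ 2 <= (sigma * t) ^+ 2.
  apply: (@le_trans _ _ ((2 * K * s) ^+ 2)); last first.
    by apply: lerXn2r => //; rewrite nnegrE ?mulr_ge0//; lra.
  rewrite (_ : (2 * K * s) ^+ 2 = K * (4 * K * s ^+ 2)); last by ring.
  by rewrite ler_peMl// mulr_ge0 ?sqr_ge0//; lra.
have a3 := ler_wpM2r KsN N12.
have N2N : 0 <= N2 * N ^+ 2 by rewrite mulr_ge0 ?sqr_ge0//; lra.
have a4 := ler_wpM2r N2N a2.
move: a3 a4; rewrite exprMn.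
have -> : sigma ^+ 2 * (N2 * N ^+ 2) * t ^+ 2 = sigma ^+ 2 * t ^+ 2 * (N2 * N ^+ 2) by ring.
move: (sigma ^+ 2) (t ^+ 2) (N ^+ 2) (s ^+ 2) => *; lra.
Qed.

(** Here N2 is sqrt(n+1). Since RU RV <= K N, the norm N of the solution is linear on both sides and
    cancels. *)
Lemma cmp_arith (M N2 s K N RU RV L t sigma : R) : 0 <= s -> 1 <= K -> 0 <= N -> 0 <= N2 -> M <= 2 * N2 * s ->
  0 <= L -> L <= M -> 0 <= RU -> 0 <= RV -> RU ^+ 2 <= K * N ^+ 2 -> RV ^+ 2 <= K -> 0 < t -> 2 * K * s <= sigma * t ->
  L * (RU * RV) / t <= sigma * (N2 * N).
Proof.
move=> s0 K1 N0 N20 MM L0 LM RU0 RV0 RUK RVK t0 Bt.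
rewrite ler_pdivrMr//.
have K0 : 0 <= K by lra.
have a1 : RU * RV <= K * N.
  have KN : 0 <= K * N by rewrite mulr_ge0.
  rewrite -(ler_pXn2r (n := 2))// ?nnegrE ?mulr_ge0// !exprMn.
  rewrite (_ : K ^+ 2 * N ^+ 2 = (K * N ^+ 2) * K); last by ring.
  by apply: ler_pM; rewrite ?sqr_ge0.
have a2 : L * (RU * RV) <= 2 * N2 * s * (K * N).
  by apply: ler_pM => //; rewrite ?mulr_ge0//; exact: le_trans LM MM.
apply: le_trans a2 _.
have N2N : 0 <= N2 * N by rewrite mulr_ge0.
have a3 := ler_wpM2r N2N Bt.
by lra.
Qed.

Lemma sqrtr_double_le (a b : R) : 0 <= b -> a <= 2 * b -> Num.sqrt a <= 2 * Num.sqrt b.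
Proof.
move=> b0 ab; rewrite -{1}(ger0_norm (ler0n R 2)) -sqrtr_sqr -sqrtrM ?sqr_ge0//; apply: ler_wsqrtr.
by rewrite expr2; lra.
Qed.

Theorem Tstar_bound (n : nat) (y : signal R) (sigma rbar lambda : R) (su sv : prox_setup) (pb : problem) (phihat : signal R) :
  (1 <= n)%N -> 0 < sigma -> 0 < rbar -> 0 <= lambda -> optimal_filter n y rbar lambda pb phihat ->
  let r := ell1_size n phihat in 0 < r ->
  exists2 Ts : nat, is_Tstar y rbar lambda pb (target_accuracy pb sigma r)
    (approx_solution n y rbar lambda pb su sv phihat) Ts &
    Ts%:R <= 18 * (ln n%:R + 1) * (spectral_sup n y / sigma) + 2.
Proof.
move=> n1 sg0 rbar0 lambda0 opt r r0.
(* B is the solution t of 2 K s = sigma t with K = 9 (ln n + 1) and s the spectral sup-norm. *)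
set B : R := 18 * (ln n%:R + 1) * (spectral_sup n y / sigma).
have [] := optimal_filter_objective opt; set us := vec _ => Dus usmin.
have vE := optimal_value_at Dus usmin.
have rE : r = Num.sqrt n.+1%:R * rcnorm 1%:E us by exact: ell1_sizeE.
(* r > 0 rules out the zero solution, whose segment would have radius 0. *)
have us0 : us != 0.
  by apply: contraTneq r0 => u0; rewrite rE u0 rcnorm1_0 mulr0 ltxx.
have K1 := @setup_factor_ge1 R n n1; set K := 9 * _ in K1.
have B0 : 0 <= B.
  have -> : B = 2 * K * (spectral_sup n y / sigma) by rewrite /B /K; ring.
  have K0 : 0 <= 2 * K by exact: (mulr_ge0 (ler0n R 2) (le_trans ler01 K1)).
  apply: (mulr_ge0 K0); apply: divr_ge0; [exact: spectral_sup_ge0|exact: ltW].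
have BE (t : R) : B <= t -> 2 * K * spectral_sup n y <= sigma * t.
  have -> : B = 2 * K * spectral_sup n y / sigma by rewrite /B /K; ring.
  by rewrite (ler_pdivrMr _ _ sg0) (mulrC t).
have M0 := spectral_bound_ge0 n y.
have dbl : n.*2.+1%:R <= 2 * n.+1%:R :> R by rewrite -natrM ler_nat mul2n doubleS.
have MM : spectral_bound n y <= 2 * Num.sqrt n.+1%:R * spectral_sup n y.
  rewrite /spectral_bound; apply: ler_wpM2r; first exact: spectral_sup_ge0.
  exact: (sqrtr_double_le (ler0n R n.+1) dbl).
have acc T : (0 < T)%N -> B <= T%:R ->
    objective y lambda pb (approx_solution n y rbar lambda pb su sv phihat T) - objective y lambda pb us
    <= target_accuracy pb sigma r.
  move=> T0 BT; have T0' : 0 < T%:R :> R by rewrite ltr0n.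
  have Bt := BE _ BT.
  rewrite /approx_solution /target_accuracy; case: ifPn => LS.
    apply: le_trans (fgm_gap y su rbar0 lambda0 LS T0 Dus) _.
    rewrite rE exprMn (sqr_sqrtr (ler0n R n.+1)).
    apply: (@fgm_arith n.*2.+1%:R n.+1%:R (spectral_sup n y) K (rcnorm 1%:E us) (setup_omega su us) _ T%:R sigma).
    - exact: ler0n.
    - exact: dbl.
    - exact: spectral_sup_ge0.
    - exact: K1.
    - exact: rcnorm_ge0.
    - exact: setup_omega_ge0.
    - exact: sqr_ge0.
    - rewrite /L_f; have h := @calA_norm_le R n y su su _ (or_introl erefl).
      apply: (@le_trans _ _ (spectral_bound n y ^+ 2)).
        by apply: lerXn2r h; rewrite nnegrE; [exact: (@calA_norm_ge0 R n y su su _ (or_introl erefl))|exact: M0].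
      by rewrite /spectral_bound exprMn sqr_sqrtr.
    - exact: setup_omega_le.
    - exact: sg0.
    - exact: T0'.
    - exact: Bt.
  have [RV0 RVK RVu] := @radiusV_spec R n sv n1.
  have [RU0 RUK RUu] := @radiusU_spec R n rbar pb su n1 rbar0 us Dus us0.
  apply: le_trans (cmp_gap y rbar0 lambda0 RV0 RU0 RVu RUu Dus LS T0) _.
  rewrite rE.
  apply: (@cmp_arith (spectral_bound n y) (Num.sqrt n.+1%:R) (spectral_sup n y) K (rcnorm 1%:E us)).
  - exact: spectral_sup_ge0.
  - exact: K1.
  - exact: rcnorm_ge0.
  - exact: sqrtr_ge0.
  - exact: MM.
  - exact: L_F_ge0.
  - exact: (@calA_norm_le R n y su sv _ (or_intror erefl)).
  - exact: ltW.
  - exact: ltW.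
  - exact: RUK.
  - exact: RVK.
  - exact: T0'.
  - exact: Bt.
(* This integer is at least 1 and exceeds B, so it is an admissible threshold. *)
pose T0 := (Num.truncn B).+1.
have accT0 : accurate_from y rbar lambda pb (target_accuracy pb sigma r)
    (approx_solution n y rbar lambda pb su sv phihat) T0.
  split; first exact: ltn0Sn.
  move=> T T0T; rewrite vE; apply: acc; first exact: leq_trans T0T.
  apply: le_trans (_ : T0%:R <= _); last by rewrite ler_nat.
  by apply/ltW; exact: truncnS_gt.
have [Ts TsP TsT0] := least_threshold accT0; exists Ts; first exact: TsP.
apply: (@le_trans _ _ T0%:R); first by rewrite ler_nat.
by rewrite /T0 -natr1; have := truncn_le B; rewrite B0 => h; rewrite -/B; lra.
Qed.

End Threshold.

(** * Gaussian noise *)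

Section Density.
Import HBNNSimple.
Context {R : realType} {d d' : measure_display} {T : measurableType d} {S : measurableType d'}.
Variables (m : {measure set T -> \bar R}) (nu : {measure set S -> \bar R}) (X : T -> S) (G : T -> R) (c : R).
Hypotheses (mX : measurable_fun setT X) (mG : measurable_fun setT G) (G0 : forall x, 0 <= G x) (c0 : 0 <= c).
Hypothesis density : forall B, measurable B -> (\int[m]_x (G x * \1_B (X x))%:E = c%:E * nu B)%E.

(** Extension from indicators to simple functions and, by monotone convergence, to nonnegative
    functions. It is applied with G the normal density and X the identity, and again with G the
    product of all other factors in the independence argument. *)
Lemma ge0_integral_density (f : S -> R) : measurable_fun setT f -> (forall x, 0 <= f x) ->
  (\int[m]_x (G x * f (X x))%:E = c%:E * \int[nu]_x (f x)%:E)%E.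
Proof.
move=> mf f0; have /measurable_EFinP mf' := mf.
pose h := nnsfun_approx measurableT mf'.
have h_cvg x : (h n x)%:E @[n --> \oo] --> (f x)%:E.
  exact: (cvg_nnsfun_approx measurableT mf' (fun x _ => f0 x) Logic.I).
have mh n : measurable_fun setT (h n) by exact/measurable_funP.
have -> : (\int[nu]_x (f x)%:E = limn (fun n => \int[nu]_x (h n x)%:E))%E.
  rewrite -monotone_convergence//.
  - by apply: eq_integral => x _; apply/esym/cvg_lim => //; exact: h_cvg.
  - by move=> n; apply/measurable_EFinP.
  - by move=> n x _; rewrite lee_fin.
  - by move=> x _ a b ab; rewrite lee_fin; exact/lefP/nd_nnsfun_approx.
have -> : (\int[m]_x (G x * f (X x))%:E = limn (fun n => \int[m]_x (G x * h n (X x))%:E))%E.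
  rewrite -monotone_convergence//.
  - apply: eq_integral => x _; apply/esym/cvg_lim => //.
    under eq_fun do rewrite EFinM.
    by rewrite EFinM; apply: cvgeZl => //; exact: h_cvg.
  - move=> n; apply/measurable_EFinP; apply: measurable_funM => //; exact: measurableT_comp (mh n) mX.
  - by move=> n x _; rewrite lee_fin mulr_ge0.
  - move=> x _ a b ab; rewrite lee_fin; apply: ler_wpM2l => //.
    exact/lefP/nd_nnsfun_approx.
have step n : (\int[m]_x (G x * h n (X x))%:E = c%:E * \int[nu]_x (h n x)%:E)%E.
  rewrite integralT_nnsfun sintegralE ge0_mule_fsumr; last by move=> r; exact: nnsfun_mulemu_ge0.
  transitivity (\int[m]_x (\sum_(r \in range (h n)) (r%:E * (G x * \1_(h n @^-1` [set r]) (X x))%:E)%E)%E)%E.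
    apply: eq_integral => x _; rewrite (fimfunE (h n) (X x)) EFinM -fsumEFin//.
    rewrite ge0_mule_fsumr; last by move=> r; exact: nnfun_muleindic_ge0.
    by apply: eq_fsbigr => r _; rewrite -!EFinM mulrCA.
  rewrite ge0_integral_fsum//; last 2 first.
  - move=> r; apply/measurable_EFinP; apply: measurable_funM => //; apply: measurable_funM => //.
    exact: (measurableT_comp (measurable_indic _)).
  - move=> r x _; rewrite -EFinM lee_fin mulrCA mulr_ge0//; exact: nnfun_muleindic_ge0.
  apply: eq_fsbigr => r; rewrite inE => -[x0 _ <-].
  rewrite ge0_integralZl//.
  - by rewrite density// muleCA.
  - apply/measurable_EFinP; apply: measurable_funM => //; exact: (measurableT_comp (measurable_indic _)).
  - by move=> x _; rewrite lee_fin mulr_ge0.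
  - by rewrite lee_fin.
under eq_fun do rewrite step.
rewrite limeMl//; apply: ereal_nondecreasing_is_cvgn => a b ab; apply: ge0_le_integral => //.
- by move=> x _; rewrite lee_fin.
- by apply/measurable_EFinP.
- by apply/measurable_EFinP.
- by move=> x _; rewrite lee_fin; exact/lefP/nd_nnsfun_approx.
Qed.

End Density.

Section Gaussian.
Context {R : realType} {d : measure_display} {T : measurableType d} (P : probability T R).

Lemma integral_normal_prob (f : R -> R) : measurable_fun setT f -> (forall x, 0 <= f x) ->
  (\int[normal_prob 0 1]_x (f x)%:E = \int[lebesgue_measure]_x (normal_pdf 0 1 x * f x)%:E)%E.
Proof.
move=> mf f0; pose nu : {measure set (measurableTypeR R) -> \bar R} := normal_prob 0 1.
rewrite -[LHS]mul1e -(@ge0_integral_density R _ _ _ _ lebesgue_measure nu id (normal_pdf 0 1) 1)//.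
- exact: measurable_normal_pdf.
- by move=> x; exact: normal_pdf_ge0.
- move=> B mB; rewrite mul1e /normal_prob [RHS]integral_mkcond; apply: eq_integral => x _.
  by rewrite epatch_indic -EFinM.
Qed.

Lemma expR_normal_pdf (a x : R) : normal_pdf 0 1 x * expR (a * x) = expR (a ^+ 2 / 2) * normal_pdf a 1 x.
Proof.
rewrite !(normal_pdfE _ (oner_neq0 R)) /normal_fun; move: (normal_peak 1) => p.
by rewrite -(mulrA p) (mulrCA _ p) -!expRD; congr (_ * expR _); field.
Qed.

Lemma normal_mgf (a : R) : (\int[normal_prob 0 1]_x (expR (a * x))%:E = (expR (a ^+ 2 / 2))%:E)%E.
Proof.
have mexp : measurable_fun setT (fun x : R => expR (a * x)).
  by apply: measurableT_comp => //; exact: measurable_funM.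
rewrite (integral_normal_prob mexp (fun x => expR_ge0 _)).
under eq_integral do rewrite expR_normal_pdf EFinM.
rewrite ge0_integralZl//.
- by rewrite integral_normal_pdf mule1.
- by apply/measurable_EFinP; exact: measurable_normal_pdf.
- by move=> x _; rewrite lee_fin normal_pdf_ge0.
Qed.

(** The normal density is at most 1, whatever the centre a; the centre will absorb the unknown
    signal. *)
Lemma gaussian_itv (X : T -> R) (a c : R) : 0 <= c -> standard_gaussian P X ->
  (P (X @^-1` `[(a - c)%R, (a + c)%R]) <= (2 * c)%:E)%E.
Proof.
move=> c0 [mX ->]//; rewrite /normal_prob.
apply: (@le_trans _ _ (\int[lebesgue_measure]_(x in `[(a - c)%R, (a + c)%R]) (cst 1%E x)))%E.
  apply: ge0_le_integral => //.
  - by move=> x _; rewrite lee_fin normal_pdf_ge0.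
  - by apply/measurable_EFinP; apply: measurable_funTS; exact: measurable_normal_pdf.
  move=> x _; rewrite lee_fin; apply: le_trans (normal_pdf_ub _ _ (oner_neq0 R)) _.
  rewrite /normal_peak expr1n mul1r invf_le1; last by rewrite sqrtr_gt0 pmulrn_lgt0// pi_gt0.
  rewrite -[leLHS]sqrtr1; apply: ler_wsqrtr.
  by have := pi_ge2 R; rewrite -mulr_natr; lra.
rewrite integral_cst//.
rewrite mul1e [X in (X <= _)%E](lebesgue_measure_itv `[a - c, a + c]) /=; case: ifP => _; last by rewrite lee_fin mulr_ge0.
by rewrite -EFinB lee_fin; lra.
Qed.

(** Serves both the Chernoff bound over all Fourier coefficients and the count of small samples. *)
Lemma markov_sum (J : finType) (f : J -> T -> R) (a : R) (b : J -> R) : 0 < a ->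
  (forall j, measurable_fun setT (f j)) -> (forall j w, 0 <= f j w) ->
  (forall j, (\int[P]_w (f j w)%:E <= (b j)%:E)%E) ->
  measurable [set w | a <= \sum_j f j w] /\ (P [set w | (a <= \sum_j f j w)%R] <= (a^-1 * \sum_j b j)%:E)%E.
Proof.
move=> a0 mf f0 fb.
have ms : measurable_fun setT (fun w => \sum_j f j w) by exact: measurable_sum.
have /measurable_EFinP ms' := ms.
split; first by have := emeasurable_fun_c_infty measurableT ms' a%:E; rewrite setTI.
have := le_integral_abse P measurableT ms' a0.
rewrite setTI (_ : [set x | _] = [set w | a <= \sum_j f j w]); last first.
  by apply/seteqP; split => w /=; rewrite lee_fin ger0_norm ?sumr_ge0.
rewrite mulrC EFinM lee_pdivlMr// muleC => h; apply: le_trans h _.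
rewrite (_ : (\int[P]_x _)%E = (\sum_j \int[P]_w (f j w)%:E)%E).
  by rewrite -sumEFin; apply: lee_sum => j _; exact: fb.
rewrite -ge0_integral_sum//.
- by apply: eq_integral => w _; rewrite /= ger0_norm ?sumr_ge0// sumEFin.
- by move=> j; apply/measurable_EFinP.
- by move=> j w _; rewrite lee_fin.
Qed.

End Gaussian.

(** * Expectations of products of independent variables *)

Section Independence.
Context {R : realType} {d : measure_display} {T : measurableType d} (P : probability T R) {I : choiceType}.
Variables (D : set I) (X : I -> T -> measurableTypeR R) (nu : {measure set (measurableTypeR R) -> \bar R}).
Variables (f : I -> measurableTypeR R -> R) (M : I -> R).
Hypotheses (indep : mutually_independent P D X) (mX : forall i, D i -> measurable_fun setT (X i)).
Hypotheses (mf : forall i, measurable_fun setT (f i)) (f0 : forall i x, 0 <= f i x).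
Hypothesis law : forall i B, D i -> measurable B -> P (X i @^-1` B) = nu B.
Hypothesis fM : forall i, D i -> (\int[nu]_x (f i x)%:E = (M i)%:E)%E.

Let mprod (s : seq I) (g : I -> measurableTypeR R -> R) : (forall i, i \in s -> D i) -> (forall i, measurable_fun setT (g i)) ->
  measurable_fun setT (fun w => \prod_(i <- s) g i (X i w)).
Proof.
move=> sD mg; elim: s sD => [|i s IH] sD.
  by under eq_fun do rewrite big_nil; exact: measurable_cst.
under eq_fun do rewrite big_cons; apply: measurable_funM; last first.
  by apply: IH => j js; apply: sD; rewrite inE js orbT.
have Di : D i by apply: sD; rewrite inE eqxx.
exact: (measurableT_comp (mg i) (mX Di)).
Qed.

Let prod_indic (s : seq I) (B : I -> set (measurableTypeR R)) w :
  \prod_(i <- s) \1_(B i) (X i w) = \1_(\bigcap_(i in [set` s]) X i @^-1` B i) w :> R.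
Proof.
rewrite indicE; have [h|/existsNP[i /not_implyP[/= si Bi]]] := pselect (forall i, i \in s -> B i (X i w)).
  rewrite mem_set// big_seq big1// => i si; rewrite indicE mem_set//; exact: h.
rewrite memNset; last by move=> /(_ i si).
apply/eqP; rewrite prodf_seq_eq0; apply/hasP; exists i => //=.
by rewrite indicE memNset.
Qed.

(* The indicators [\1_(B i)] of the independence hypothesis are exchanged one at
   a time for the functions [f i]. *)
Let prod_mixed (s1 s2 : seq I) (B : I -> set (measurableTypeR R)) :
  uniq (s1 ++ s2) -> (forall i, i \in s1 ++ s2 -> D i) -> (forall i, measurable (B i)) ->
  (\int[P]_w ((\prod_(i <- s1) f i (X i w)) * \prod_(i <- s2) \1_(B i) (X i w))%:E =
   ((\prod_(i <- s1) M i) * \prod_(i <- s2) fine (P (X i @^-1` B i)))%:E)%E.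
Proof.
elim: s1 s2 B => [|j s1 IH] s2 B us sD mB.
  rewrite !big_nil mul1r.
  have mXB i : i \in s2 -> measurable (X i @^-1` B i).
    by move=> is2; rewrite -[X in measurable X]setTI; apply: mX => //; apply: sD.
  have sE : [set` [fset i in s2]%fset] = [set` s2].
    by apply/seteqP; split => i /=; rewrite inE.
  have : (P (\bigcap_(i in [set` [fset i in s2]%fset]) (X i @^-1` B i)) = \prod_(i <- [fset i in s2]%fset) P (X i @^-1` B i))%E.
    by apply: indep => // i; rewrite sE => is2; exact: sD.
  have pm : perm_eq [fset i in s2]%fset s2.
    by apply: uniq_perm => // i; rewrite inE.
  rewrite (perm_big _ pm) sE /=.
  have -> : (\prod_(i <- s2) P (X i @^-1` B i) = (\prod_(i <- s2) fine (P (X i @^-1` B i)))%:E)%E.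
    rewrite big_seq [in RHS]big_seq; elim/big_ind2 : _ => // [_ x _ z -> ->//|i is2].
    by rewrite fineK// fin_num_measure//; exact: mXB.
  move=> <-; rewrite -[X in P X]setIT -integral_indic//; last first.
    by apply: fin_bigcap_measurable.
  by apply: eq_integral => w _; rewrite big_nil mul1r prod_indic.
have [js us'] : (j \notin s1 ++ s2) /\ uniq (s1 ++ s2) by move: us => /= /andP[].
have Dj : D j by apply: sD; rewrite inE eqxx.
have sD' i : i \in s1 ++ s2 -> D i by move=> h; apply: sD; rewrite inE h orbT.
have s2D i : i \in s2 -> D i by move=> h; apply: sD'; rewrite mem_cat h orbT.
pose G w := (\prod_(i <- s1) f i (X i w)) * \prod_(i <- s2) \1_(B i) (X i w).
pose c := (\prod_(i <- s1) M i) * \prod_(i <- s2) fine (P (X i @^-1` B i)).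
have mG : measurable_fun setT G.
  apply: measurable_funM; last first.
    by apply: (@mprod s2 (fun i => \1_(B i))) => // i; exact: measurable_indic.
  by apply: (@mprod s1 f) => // i is1; apply: sD'; rewrite mem_cat is1.
have G0 w : 0 <= G w by rewrite mulr_ge0// prodr_ge0.
have GE : (\int[P]_w (G w)%:E = c%:E)%E by exact: IH.
have c0 : 0 <= c by rewrite -lee_fin -GE; apply: integral_ge0 => w _; rewrite lee_fin.
transitivity (\int[P]_w (G w * f j (X j w))%:E)%E.
  by apply: eq_integral => w _; congr EFin; rewrite big_cons -mulrA mulrC.
(* G collects the other factors and has integral c. Its density hypothesis for [X j] is the
   induction hypothesis with the indicator of A at index j added to the second list. *)
rewrite (@ge0_integral_density R _ _ T _ P nu (X j) G c)//; last 2 first.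
- exact: mX.
- move=> A mA; pose B' i := if i == j then A else B i.
  have B'E i : i \in s2 -> B' i = B i.
    by rewrite /B'; case: eqVneq => // -> js2; move: js; rewrite mem_cat js2 orbT.
  have h := IH (j :: s2) B' _ _ _.
  transitivity (\int[P]_w ((\prod_(i <- s1) f i (X i w)) * \prod_(i <- j :: s2) \1_(B' i) (X i w))%:E)%E.
    apply: eq_integral => w _; congr EFin; rewrite big_cons /B' eqxx /G -mulrA; congr (_ * _).
    rewrite mulrC; congr (_ * _); rewrite big_seq [RHS]big_seq; apply: eq_bigr => i is2.
    by rewrite -/(B' i) B'E.
  rewrite h.
  + have mXA : measurable (X j @^-1` A).
      by rewrite -[X in measurable X]setTI; exact: (mX Dj measurableT mA).
    have -> : nu A = (fine (P (X j @^-1` A)))%:E.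
      by rewrite fineK ?(law Dj mA)// -(law Dj mA); exact: fin_num_measure.
    rewrite big_cons {1}/B' eqxx.
    rewrite -EFinM /c -mulrA; congr (_ * _)%:E.
    rewrite mulrC; congr (_ * _); rewrite big_seq [RHS]big_seq; apply: eq_bigr => i is2.
    by rewrite B'E.
  + by move: us; rewrite /= -[j :: s2]cat1s uniq_catCA.
  + by move=> i; rewrite mem_cat inE orbCA => h'; apply: sD; rewrite /= inE mem_cat.
  + by move=> i; rewrite /B'; case: ifP.
by rewrite fM// -EFinM /c big_cons mulrC mulrA.
Qed.

Lemma expectation_prod (s : seq I) : uniq s -> (forall i, i \in s -> D i) ->
  (\int[P]_w (\prod_(i <- s) f i (X i w))%:E = (\prod_(i <- s) M i)%:E)%E.
Proof.
move=> us sD; have := @prod_mixed s [::] (fun=> setT); rewrite cats0 big_nil mulr1 => <-//.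
by apply: eq_integral => w _; rewrite big_nil mulr1.
Qed.

End Independence.

Section GaussianSums.
Context {R : realType} {d : measure_display} {T : measurableType d} (P : probability T R) {I : choiceType}.
Variables (D : set I) (X : I -> T -> measurableTypeR R).
Hypotheses (indep : mutually_independent P D X) (gX : forall i, D i -> standard_gaussian P (X i)).

Lemma gaussian_sum_mgf (s : seq I) (a : I -> R) : uniq s -> (forall i, i \in s -> D i) ->
  (\int[P]_w (expR (\sum_(i <- s) a i * X i w))%:E = (expR ((\sum_(i <- s) a i ^+ 2) / 2))%:E)%E.
Proof.
move=> us sD; pose nu : {measure set (measurableTypeR R) -> \bar R} := normal_prob 0 1.
transitivity (\int[P]_w (\prod_(i <- s) expR (a i * X i w))%:E)%E.
  by apply: eq_integral => w _; rewrite expR_sum.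
rewrite (@expectation_prod R d T P I D X nu (fun i x => expR (a i * x)) (fun i => expR (a i ^+ 2 / 2)))//.
- by rewrite mulr_suml expR_sum.
- by move=> i Di; have [] := gX Di.
- by move=> i; apply: measurableT_comp => //; exact: measurable_funM.
- by move=> i B Di mB; have [_ ->] := gX Di.
by move=> i _; exact: normal_mgf.
Qed.

End GaussianSums.

Section ComplexNoise.
Context {R : realType} {d : measure_display} {T : measurableType d} (P : probability T R).
Variables (D : set int) (zeta : int -> T -> R[i]).
Hypothesis noise : iid_complex_gaussian P D zeta.

Lemma independent_Re : mutually_independent P D (fun t w => complex.Re (zeta t w) : measurableTypeR R).
Proof.
move=> J B JD mB; have [_ ind] := noise.
have := ind J (fun i => B i `*` setT) JD.
rewrite (_ : \bigcap_(i in _) _ = \bigcap_(i in [set` J]) ((fun w => complex.Re (zeta i w)) @^-1` B i)); last first.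
  by apply: eq_bigcapr => i _; apply/seteqP; split => w /=; [case|].
move=> ->; last by move=> i iJ; apply: measurableX => //; exact: mB.
by apply: eq_bigr => i _; congr (P _); apply/seteqP; split => w /=; [case|].
Qed.

Lemma independent_Im : mutually_independent P D (fun t w => complex.Im (zeta t w) : measurableTypeR R).
Proof.
move=> J B JD mB; have [_ ind] := noise.
have := ind J (fun i => setT `*` B i) JD.
rewrite (_ : \bigcap_(i in _) _ = \bigcap_(i in [set` J]) ((fun w => complex.Im (zeta i w)) @^-1` B i)); last first.
  by apply: eq_bigcapr => i _; apply/seteqP; split => w /=; [case|].
move=> ->; last by move=> i iJ; apply: measurableX => //; exact: mB.
by apply: eq_bigr => i _; congr (P _); apply/seteqP; split => w /=; [case|].
Qed.

Lemma gaussian_Re t : D t -> standard_gaussian P (fun w => complex.Re (zeta t w)).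
Proof. by move=> Dt; have [/(_ _ Dt)[]] := noise. Qed.

Lemma gaussian_Im t : D t -> standard_gaussian P (fun w => complex.Im (zeta t w)).
Proof. by move=> Dt; have [/(_ _ Dt)[]] := noise. Qed.

End ComplexNoise.

(** * Fourier coefficients as real cosine and sine sums *)

Section Spectrum.
Context {R : realType} (n : nat).
Let N := n.*2.+1.
Implicit Types (x z : signal R) (k j : 'I_N).

Definition grid (j : nat) : int := - n%:Z + j%:Z.

Definition dft_coef (b : bool) (k j : nat) : R :=
  (Num.sqrt N%:R)^-1 * (if b then cos else sin) (dft_angle n.*2 k j).

Definition dft_sum (b : bool) (k : nat) (x : int -> R) : R := \sum_(j < N) dft_coef b k j * x (grid j).

Lemma grid_itv j : - n%:Z <= grid j <= n%:Z.
Proof. rewrite /grid lerDl /=; have := ltn_ord j; rewrite /N ltnS => h.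
by rewrite addrC lerBlDr -PoszD lez_nat addnn h. Qed.

Lemma dft_coef_sqr_sum b k : \sum_(j < N) dft_coef b k j ^+ 2 <= 1.
Proof.
have N0 : 0 < N%:R :> R by rewrite ltr0n.
apply: (@le_trans _ _ (\sum_(j < N) N%:R^-1)).
  apply: ler_sum => j _; rewrite exprMn exprVn (sqr_sqrtr (ltW N0)).
  apply: ler_piMr; first by rewrite invr_ge0 ltW.
  move: (dft_angle _ _ _) (@cos2Dsin2 R (dft_angle n.*2 k j)) => t h.
  by have := sqr_ge0 (cos t); have := sqr_ge0 (sin t); case: b => /= *; lra.
by rewrite sumr_const card_ord -[_ *+ _]mulr_natr mulVf// gt_eqF.
Qed.

Lemma dft_Re_Im x k : (dft n.*2 *m segment (- n%:Z) N x) k 0 =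
  (dft_sum true k (fun t => complex.Re (x t)) - dft_sum false k (fun t => complex.Im (x t))) +i*
  (dft_sum true k (fun t => complex.Im (x t)) + dft_sum false k (fun t => complex.Re (x t))).
Proof.
rewrite mxE /dft_sum -sumrB -big_split /=.
elim/big_ind3 : _ => [|a1 a2 a3 b1 b2 b3 -> ->|j _]; first by [].
  by apply/eqP; rewrite eq_complex /=; apply/andP; split; apply/eqP.
rewrite dftE !mxE -/(grid j) /dft_coef; case: (x _) => a b.
by apply/eqP; rewrite eq_complex /=; apply/andP; split; apply/eqP; ring.
Qed.

(** Real and imaginary parts of each coefficient are at most 2u in absolute value, so the modulus is
    at most sqrt(8) u. *)
Lemma spectral_sup_le_parts x (u : R) : 0 <= u ->
  (forall b k, `|dft_sum b k (fun t => complex.Re (x t))| <= u) ->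
  (forall b k, `|dft_sum b k (fun t => complex.Im (x t))| <= u) -> spectral_sup n x <= 4 * u.
Proof.
move=> u0 hr hi; apply/bigmax_leP; split; first by rewrite mulr_ge0.
move=> k _; rewrite normcE -[leRHS]ger0_norm ?mulr_ge0// -sqrtr_sqr; apply: ler_wsqrtr.
rewrite dft_Re_Im /sqc /=.
have := hr true k; have := hr false k; have := hi true k; have := hi false k.
move: (dft_sum _ _ _) (dft_sum _ _ _) (dft_sum _ _ _) (dft_sum _ _ _) => p q r s.
rewrite !ler_norml => /andP[h1 h2] /andP[h3 h4] /andP[h5 h6] /andP[h7 h8].
have sq (a : R) : - (2 * u) <= a -> a <= 2 * u -> a ^+ 2 <= 4 * u ^+ 2 by move=> *; nra.
apply: le_trans (lerD (sq _ _ _) (sq _ _ _)) _; try lra.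
by have := sqr_ge0 u; rewrite exprMn; lra.
Qed.

Lemma spectral_supD x z y (s : R) : 0 <= s -> (forall t, - n%:Z <= t <= n%:Z -> y t = x t + s%:C * z t) ->
  spectral_sup n y <= spectral_sup n x + s * spectral_sup n z.
Proof.
move=> s0 yE; apply/bigmax_leP; split; first by rewrite addr_ge0 ?mulr_ge0 ?spectral_sup_ge0.
move=> k _; have -> : segment (- n%:Z) N y = segment (- n%:Z) N x + s%:C *: segment (- n%:Z) N z.
  by apply/matrixP => j i; rewrite !mxE yE ?grid_itv.
rewrite mulmxDr -scalemxAr mxE [X in _ + X]mxE; apply: le_trans (le_normcD _ _) _.
rewrite Normc.normcM (_ : Normc.normc s%:C = s); last by rewrite /= expr0n addr0 sqrtr_sqr ger0_norm.
by apply: lerD; [|apply: ler_wpM2l => //]; exact: dft_normc_le.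
Qed.

(* [f j] is the indicator of a small sample: at most half of the samples are small, so Parseval applies. *)
Lemma spectral_sup_lower x (c : R) (f : 'I_N -> R) : 0 <= c -> \sum_j f j <= N%:R / 2 ->
  (forall j, c ^+ 2 * (1 - f j) <= complex.Re (x (grid j)) ^+ 2) -> c <= 2 * spectral_sup n x.
Proof.
move=> c0 fN hf; have N0 : 0 < N%:R :> R by rewrite ltr0n.
have h1 : c ^+ 2 * (N%:R / 2) <= cnorm2 (segment (- n%:Z) N x).
  apply: (@le_trans _ _ (\sum_j c ^+ 2 * (1 - f j))).
    rewrite -mulr_sumr sumrB sumr_const card_ord; apply: ler_wpM2l; first exact: sqr_ge0.
    by rewrite -[1 *+ N]/(N%:R); lra.
  apply: ler_sum => j _; apply: le_trans (hf j) _; rewrite mxE -/(grid j) /sqc lerDl; exact: sqr_ge0.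
have h2 : cnorm2 (segment (- n%:Z) N x) <= N%:R * spectral_sup n x ^+ 2.
  rewrite -(@cnorm2_dft R n.*2) /cnorm2.
  apply: (@le_trans _ _ (\sum_(k < N) spectral_sup n x ^+ 2)); last first.
    by rewrite sumr_const card_ord -[_ *+ _]mulr_natl.
  by apply: ler_sum => k _; exact: sqc_le_cnormy.
have s0 := spectral_sup_ge0 n x.
rewrite -(ler_pXn2r (n := 2))// ?nnegrE ?mulr_ge0//.
have := le_trans h1 h2; rewrite mulrCA ler_pM2l// exprMn.
by have := sqr_ge0 (spectral_sup n x); lra.
Qed.

End Spectrum.

(** * The two exceptional events *)

Section Events.
Context {R : realType} (n : nat) {d : measure_display} {T : measurableType d} (P : probability T R).
Let N := n.*2.+1.
Variable zeta : int -> T -> R[i].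
Hypothesis noise : iid_complex_gaussian P [set tau : int | - n%:Z <= tau <= n%:Z] zeta.

Let part (b : bool) (t : int) (w : T) : R := if b then complex.Re (zeta t w) else complex.Im (zeta t w).
Let D := [set tau : int | - n%:Z <= tau <= n%:Z].
Let gridD (j : 'I_N) : D (grid n j). Proof. exact: grid_itv. Qed.

Let part_gaussian b t : D t -> standard_gaussian P (part b t).
Proof. by move=> Dt; case: b; [exact: (gaussian_Re noise Dt)|exact: (gaussian_Im noise Dt)]. Qed.

Let part_independent b : mutually_independent P D (part b : int -> T -> measurableTypeR R).
Proof. by case: b; [exact: independent_Re noise|exact: independent_Im noise]. Qed.

Let signed (s : bool) (x : R) : R := if s then x else - x.

(** The index records the frequency, cosine or sine, real or imaginary part, and a sign. With both
    signs present, one-sided bounds control absolute values. *)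
Let noise_sum (q : 'I_N * bool * bool * bool) (w : T) : R :=
  signed q.2 (dft_sum n q.1.1.2 q.1.1.1 (fun t => part q.1.2 t w)).

Let noise_sum_measurable q : measurable_fun setT (noise_sum q).
Proof.
have m : measurable_fun setT (fun w => dft_sum n q.1.1.2 q.1.1.1 (fun t => part q.1.2 t w)).
  apply: measurable_sum => j; apply: measurable_funM => //.
  by have [] := part_gaussian q.1.2 (gridD j).
by rewrite /noise_sum /signed; case: q.2 => //; exact: measurableT_comp.
Qed.

Let noise_sum_mgf q : (\int[P]_w (expR (noise_sum q w))%:E <= (expR 2^-1)%:E)%E.
Proof.
case: q => [[[k b] p] s]; rewrite /noise_sum /=.
(* The moment formula is indexed by times, so the coefficient recovers the position t + n from the
   time t. *)
pose a (t : int) := signed s (dft_coef n b k `|(t + n%:Z)%R|%N).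
pose r := [seq grid n (j : 'I_N) | j <- enum 'I_N].
have gridK (j : nat) : `|(grid n j + n%:Z)%R|%N = j by rewrite /grid addrAC addNr add0r.
have ur : uniq r.
  rewrite map_inj_uniq ?enum_uniq// => i j ij; apply: val_inj => /=.
  by rewrite -(gridK i) -(gridK j) ij.
have rD t : t \in r -> D t by move=> /mapP[j _ ->]; exact: gridD.
rewrite (eq_integral (fun w => (expR (\sum_(t <- r) a t * part p t w))%:E)); last first.
  move=> w _; congr (expR _)%:E; rewrite big_map big_enum /= /dft_sum.
  rewrite (_ : signed s _ = \sum_(j < N) signed s (dft_coef n b k j * part p (grid n j) w)).
    by apply: eq_bigr => j _; rewrite /a gridK; case: (s) => //=; rewrite mulNr.
  by case: (s) => //=; rewrite sumrN.
rewrite (gaussian_sum_mgf (part_independent p) (part_gaussian p) a ur rD) lee_fin ler_expR.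
rewrite -[leRHS]mul1r; apply: ler_wpM2r; first by rewrite invr_ge0.
apply: le_trans (@dft_coef_sqr_sum R n b k).
rewrite big_map big_enum /=; apply: ler_sum => j _; rewrite /a gridK.
by case: (s) => //=; rewrite sqrrN.
Qed.

(** There are 8 N signed sums, each with exponential moment at most e^(1/2). At the level u = ln(16
    N / delta) + 1 Markov's inequality gives (delta / 2) e^(-1/2). Keeping the exponential parameter
    equal to 1 yields a bound of order ln N. *)
Lemma noise_event (delta : R) : 0 < delta -> exists2 A : set T,
  measurable A /\ (P A <= (delta / 2)%:E)%E &
  forall w, ~ A w -> spectral_sup n (zeta ^~ w) <= 4 * `|ln (16 * N%:R / delta) + 1|.
Proof.
move=> d0; have N0 : 0 < N%:R :> R by rewrite ltr0n.
set u : R := ln (16 * N%:R / delta) + 1.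
have mE q : measurable_fun setT (fun w => expR (noise_sum q w)) by exact: measurableT_comp.
have [mA PA] := markov_sum (expR_gt0 u) mE (fun q w => expR_ge0 (noise_sum q w)) noise_sum_mgf.
eexists; first split; [exact: mA| |].
  apply: le_trans PA _; rewrite lee_fin sumr_const.
  rewrite -[_ *+ _]mulr_natr -expRN.
  rewrite !card_prod !card_bool card_ord /u opprD expRD expRN lnK ?posrE ?divr_gt0 ?mulr_gt0//.
  have -> : (expR (- 1) : R) = expR (- 2^-1) * expR (- 2^-1) by rewrite -expRD; congr expR; lra.
  have e1 : expR (- 2^-1) * expR 2^-1 = 1 :> R by rewrite -expRD addNr expR0.
  have e2 : expR (- 2^-1) <= 1 :> R by rewrite -[leRHS]expR0 ler_expR; lra.
  rewrite invf_div !natrM.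
  have -> : delta / (16 * N%:R) * (expR (- 2^-1) * expR (- 2^-1)) * (expR 2^-1 * (N%:R * 2 * 2 * 2)) =
     (expR (- 2^-1) * expR 2^-1) * expR (- 2^-1) * (delta / 2) by field; rewrite gt_eqF.
  by rewrite e1 mul1r; apply: ler_piMl => //; rewrite divr_ge0// ltW.
move=> w /= /negP; rewrite -ltNge => Aw.
have h q : noise_sum q w <= `|u|.
  apply: le_trans (ler_norm _); rewrite -ler_expR; apply: ltW; apply: le_lt_trans Aw.
  rewrite (bigD1 q)//= lerDl; apply: sumr_ge0 => q' _; exact: expR_ge0.
apply: spectral_sup_le_parts => // b k.
  have := h (k, b, true, true); have := h (k, b, true, false).
  by rewrite /noise_sum /= ler_norml => h1 h2; apply/andP; split => //; rewrite lerNl.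
have := h (k, b, false, true); have := h (k, b, false, false).
by rewrite /noise_sum /= ler_norml => h1 h2; apply/andP; split => //; rewrite lerNl.
Qed.

(** Re y is small exactly when the real noise falls in an interval centred at -Re x / sigma, so the
    bound is uniform in the signal. With c = delta/8, N probabilities of at most 2c against the
    threshold N/2 give 4c = delta/2. *)
Lemma small_sample_event (delta sigma : R) (x : signal R) : 0 < delta -> 0 < sigma -> exists2 A : set T,
  measurable A /\ (P A <= (delta / 2)%:E)%E &
  forall w y, ~ A w -> (forall t, D t -> y t = x t + sigma%:C * zeta t w) ->
    delta / 8 * sigma <= 2 * spectral_sup n y.
Proof.
move=> d0 s0; have N0 : 0 < N%:R :> R by rewrite ltr0n.
set c := delta / 8; have c0 : 0 < c by rewrite divr_gt0.
pose m (j : 'I_N) := - (complex.Re (x (grid n j)) / sigma).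
pose B (j : 'I_N) := part true (grid n j) @^-1` `[m j - c, m j + c].
have mB j : measurable (B j).
  rewrite -[X in measurable X]setTI; have [mX _] := part_gaussian true (gridD j).
  by apply: mX => //; exact: measurable_itv.
have EB j : (\int[P]_w (\1_(B j) w)%:E <= (2 * c)%:E)%E.
  by rewrite integral_indic// setIT; apply: gaussian_itv; [exact: ltW|exact: part_gaussian].
have N20 : 0 < N%:R / 2 :> R by rewrite divr_gt0.
have iB j w : 0 <= \1_(B j) w :> R by rewrite indicE ler0n.
have [mA PA] := markov_sum N20 (fun j => measurable_indic (mB j)) iB EB.
eexists; first split; [exact: mA| |].
  apply: le_trans PA _; rewrite lee_fin sumr_const card_ord -[_ *+ _]mulr_natl.
  rewrite le_eqVlt; apply/orP; left; apply/eqP; rewrite /c; field; rewrite gt_eqF//.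
move=> w y /= /negP; rewrite -ltNge => Aw yE.
apply: (@spectral_sup_lower R n y (c * sigma) (fun j => \1_(B j) w)); first by rewrite mulr_ge0 ?ltW.
  exact: ltW.
move=> j; rewrite indicE; case: (boolP (w \in B j)) => [|/negP wB].
  by rewrite subrr mulr0 sqr_ge0.
rewrite subr0 mulr1 (yE _ (gridD j)) /=.
have -> : complex.Re (x (grid n j) + sigma%:C * zeta (grid n j) w) = sigma * (part true (grid n j) w - m j).
  rewrite /part /m; case: (x _) (zeta _ w) => [a b] [a' b'] /=; field; by rewrite gt_eqF.
rewrite (mulrC c) (exprMn _ sigma c) (exprMn _ sigma); apply: ler_wpM2l; first exact: sqr_ge0.
have : c < `|part true (grid n j) w - m j|.
  rewrite ltNge; apply/negP => h; apply: wB; rewrite inE /B /= in_itv /=.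
  by move: h; rewrite ler_norml => /andP[h1 h2]; apply/andP; split; lra.
move=> /ltW h; rewrite -[leRHS]real_normK ?num_real//; apply: lerXn2r h; rewrite nnegrE//; exact: ltW.
Qed.

End Events.

(** * Absorption of constants and logarithms into the final rates *)

Lemma horizon_arith {R : realType} (delta l s : R) : 0 < delta -> 0 <= l -> delta / 8 <= 2 * s ->
  18 * (l + 1) * s + 2 <= (18 + 32 / delta) * (l + 1) * s.
Proof.
move=> d0 l0 ds.
(* Hence 2 <= 2 (l + 1) (16 / delta) s, which is the origin of 32 / delta. *)
have h : 1 <= 16 / delta * s.
  have := ler_wpM2l (ltW (divr_gt0 (ltr0n R 8) d0 : 0 < 8 / delta)) ds.
  have -> : 8 / delta * (delta / 8) = 1 by field; rewrite gt_eqF.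
  by have -> : 8 / delta * (2 * s) = 16 / delta * s by ring.
have -> : (18 + 32 / delta) * (l + 1) * s = 18 * (l + 1) * s + 2 * (l + 1) * (16 / delta * s).
  by field; rewrite gt_eqF.
by nra.
Qed.

(** Since 2n + 1 <= 3n, the argument is at most (48 / delta) n, and the sum of the two logarithms is
    bounded by a product. *)
Lemma ln_noise_level {R : realType} (delta : R) (n : nat) : 0 < delta < 1 -> (1 <= n)%N ->
  `|ln (16 * n.*2.+1%:R / delta) + 1| <= (ln (48 / delta) + 1) * (ln n%:R + 1).
Proof.
move=> /andP[d0 d1] n1; have n0 : 0 < n%:R :> R by rewrite ltr0n.
have l0 : 0 <= ln n%:R :> R by rewrite ln_ge0// ler1n.
have a0 : 0 <= ln (48 / delta) by rewrite ln_ge0// ler_pdivlMr// mul1r; lra.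
have N1 : 1 <= n.*2.+1%:R :> R by rewrite ler1n.
have N3 : n.*2.+1%:R <= 3 * n%:R :> R by rewrite -natrM ler_nat mulSn mul2n -addn1 addnC leq_add2r.
have b0 : 0 <= ln (16 * n.*2.+1%:R / delta) by rewrite ln_ge0// ler_pdivlMr// mul1r; lra.
have b1 : ln (16 * n.*2.+1%:R / delta) <= ln (48 / delta) + ln n%:R.
  rewrite -lnM ?posrE ?divr_gt0// ler_ln ?posrE ?divr_gt0 ?mulr_gt0 ?divr_gt0//.
    by rewrite [leRHS]mulrAC ler_pM2r ?invr_gt0//; lra.
  by rewrite invr_gt0.
rewrite ger0_norm; last by lra.
by nra.
Qed.

(** Stated with the constant 8 a b of [rate_x], so that a single C serves both bounds. *)
Lemma rate_y {R : realType} (a b l s t : R) : 1 <= a -> 0 < b -> 0 <= l -> 0 <= s ->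
  t <= b * (l + 1) * s -> t <= 8 * a * b * (l ^+ 2 + 1) * s.
Proof.
move=> a1 b0 l0 s0 /le_trans; apply; apply: ler_wpM2r => //.
have h : l + 1 <= 8 * (l ^+ 2 + 1) by have := sqr_ge0 (l - 1); rewrite sqrrB1 -mulr_natr; have := sqr_ge0 l; lra.
have -> : 8 * a * b * (l ^+ 2 + 1) = b * (a * (8 * (l ^+ 2 + 1))) by ring.
apply: ler_wpM2l; first exact: ltW.
by apply: le_trans h _; rewrite ler_peMl// mulr_ge0// addr_ge0// sqr_ge0.
Qed.

(** The radii and the noise contribute one factor l + 1 each, and (l + 1)^2 <= 2 (l^2 + 1). With the
    factor 4 of the noise bound this gives 8 a b. *)
Lemma rate_x {R : realType} (a b l s s' t : R) : 1 <= a -> 0 < b -> 0 <= l -> 0 <= s ->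
  s' <= s + 4 * (a * (l + 1)) -> t <= b * (l + 1) * s' -> t <= 8 * a * b * (l ^+ 2 + 1) * (s + 1).
Proof.
move=> a1 b0 l0 s0 hs /le_trans; apply.
have bl : 0 <= b * (l + 1) by rewrite mulr_ge0 ?ltW//; lra.
apply: le_trans (ler_wpM2l bl hs) _.
have al : 1 <= a * (l + 1) by rewrite mulr_ege1//; lra.
have h1 : s + 4 * (a * (l + 1)) <= 4 * (a * (l + 1)) * (s + 1).
  by move: al; move: (a * (l + 1)) => w w1; nra.
apply: le_trans (ler_wpM2l bl h1) _; rewrite [leLHS]mulrA; apply: ler_wpM2r; first by lra.
have -> : b * (l + 1) * (4 * (a * (l + 1))) = 4 * (a * b) * (l + 1) ^+ 2 by ring.
have -> : 8 * a * b * (l ^+ 2 + 1) = 4 * (a * b) * (2 * (l ^+ 2 + 1)) by ring.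
apply: ler_wpM2l; first by rewrite !mulr_ge0//; lra.
by rewrite -subr_ge0 (_ : _ - _ = (l - 1) ^+ 2) ?sqr_ge0//; ring.
Qed.

Theorem mainTheorem4 (R : realType) :
  exists kappa : R, 0 < kappa /\
  forall delta : R, 0 < delta < 1 ->
  exists C : R, 0 < C /\
  forall (n : nat) (sigma rbar lambda : R) (x : signal R)
         (su sv : prox_setup) (pb : problem)
         (d : measure_display) (T : measurableType d) (P : probability T R)
         (zeta : int -> T -> R[i]) (y : T -> signal R),
    (1 <= n)%N -> 0 < sigma -> 0 < rbar -> 0 <= lambda ->
    iid_complex_gaussian P [set tau : int | - n%:Z <= tau <= n%:Z] zeta ->
    (forall (om : T) (tau : int), - n%:Z <= tau <= n%:Z ->
       y om tau = x tau + sigma%:C * zeta tau om) ->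
    exists E : set T,
      [/\ measurable E, ((1 - delta)%:E <= P E)%E &
          forall om : T, E om ->
          forall phihat : signal R,
            optimal_filter n (y om) rbar lambda pb phihat ->
            let r := ell1_size n phihat in
            0 < r ->
            exists Tstar : nat,
              [/\ is_Tstar (y om) rbar lambda pb
                    (target_accuracy pb sigma r)
                    (approx_solution n (y om) rbar lambda pb su sv phihat) Tstar,
                  Tstar%:R <= C * (ln n%:R `^ kappa + 1) *
                              (spectral_sup n (y om) / sigma) &
                  Tstar%:R <= C * (ln n%:R `^ kappa + 1) *
                              (spectral_sup n x / sigma + 1)]].
Proof.
exists 2; split => // delta d01; have /andP[d0 d1] := d01.
pose a : R := ln (48 / delta) + 1; pose b : R := 18 + 32 / delta.
have a1 : 1 <= a by rewrite /a lerDr ln_ge0// ler_pdivlMr// mul1r; lra.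
have b0 : 0 < b by rewrite /b addr_gt0// divr_gt0.
exists (8 * a * b); split; first by rewrite !mulr_gt0//; lra.
move=> n sigma rbar lambda x su sv pb d T P zeta y n1 s0 rbar0 lambda0 noise yE.
have [A1 [mA1 PA1] hA1] := noise_event noise d0.
have [A2 [mA2 PA2] hA2] := small_sample_event noise x d0 s0.
have l0 : 0 <= ln n%:R :> R by rewrite ln_ge0// ler1n.
have lE : ln n%:R `^ 2 = ln n%:R ^+ 2 :> R by rewrite -powR_mulrn.
(* The event is determined by the noise and the signal, before any optimal filter is chosen, so it
   serves all of them at once. *)
exists (~` (A1 `|` A2)); split.
- by apply: measurableC; exact: measurableU.
- rewrite probability_setC; last exact: measurableU.
  have PA : (P (A1 `|` A2) <= delta%:E)%E.
    apply: (le_trans (measureU2 _ mA1 mA2)); apply: (le_trans (leeD PA1 PA2)).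
    by rewrite -EFinD lee_fin; lra.
  by rewrite EFinB; apply: leeB.
move=> om /not_orP[nA1 nA2] phihat opt r r0.
have [Ts TsP TsB] := Tstar_bound su sv n1 s0 rbar0 lambda0 opt r0.
exists Ts; rewrite lE.
have low : delta / 8 <= 2 * (spectral_sup n (y om) / sigma).
  by rewrite mulrA ler_pdivlMr//; apply: hA2 nA2 _ => t; exact: yE.
have up : spectral_sup n (y om) / sigma <= spectral_sup n x / sigma + 4 * (a * (ln n%:R + 1)).
  rewrite ler_pdivrMr// mulrDl divfK ?gt_eqF//.
  apply: le_trans (spectral_supD (ltW s0) (yE om)) _.
  rewrite lerD2l mulrC; apply: ler_wpM2r; first exact: ltW.
  by apply: le_trans (hA1 _ nA1) _; rewrite ler_pM2l//; exact: ln_noise_level.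
have Tb := le_trans TsB (horizon_arith d0 l0 low); rewrite -/b in Tb.
have x0 : 0 <= spectral_sup n x / sigma by rewrite divr_ge0 ?spectral_sup_ge0// ltW.
have y0 : 0 <= spectral_sup n (y om) / sigma by rewrite divr_ge0 ?spectral_sup_ge0// ltW.
split; first exact: TsP.
- exact: (rate_y a1 b0 l0 y0 Tb).
- exact: (rate_x a1 b0 l0 x0 up Tb).
Qed.
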